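(* Let $\mathfrak{g}$ be a finite-dimensional semisimple Lie algebra over an algebraically closed field $\Bbbk$ of characteristic $0$, with Cartan subalgebra $\mathfrak{h}$, root system $R$ and base $\Pi$. For all subsets $S,T\subset\Pi$, $$\chi(\mathfrak{g}_{S,T})\leqslant \operatorname{rk}(\mathfrak{g})+\operatorname{card}\mathcal{K}(S)+\operatorname{card}\mathcal{K}(T)-2\dim E_{S,T}.$$
   Context: Index: for a finite-dimensional Lie algebra $\mathfrak{a}$ and $f\in\mathfrak{a}^*$, let $\mathfrak{a}^{(f)}=\{X\in\mathfrak{a}: f([X,Y])=0\ \forall Y\in\mathfrak{a}\}$; the index is $\chi(\mathfrak{a})=\min_{f\in\mathfrak{a}^*}\dim\mathfrak{a}^{(f)}$. Notation: $\mathfrak{g}^\alpha$ is the root space of $\alpha\in R$; $R_+$, $R_-$ are the positive/negative roots w.r.t. $\Pi$; for $S\subset\Pi$, $R^S=R\cap\mathbb{Z}S$, $R_+^S=R\cap\mathbb{N}S$, $R_-^S=R^S\setminus R_+^S$. For $\alpha\in R$, $H_\alpha$ is the unique element of $[\mathfrak{g}^\alpha,\mathfrak{g}^{-\alpha}]$ with $\alpha(H_\alpha)=2$, and $\langle\lambda,\alpha^\vee\rangle=\lambda(H_\alpha)$. If $S\subset\Pi$ is connected (in the Dynkin diagram), $R^S$ is irreducible with base $S$ and $\varepsilon_S$ denotes its highest root. The set $\mathcal{K}(S)$ of subsets of $S$ is defined by induction on $\operatorname{card}S$: $\mathcal{K}(\emptyset)=\emptyset$; if $S_1,\dots,S_r$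 are the connected components of $S$, $\mathcal{K}(S)=\mathcal{K}(S_1)\cup\dots\cup\mathcal{K}(S_r)$; if $S$ is connected, $\mathcal{K}(S)=\{S\}\cup\mathcal{K}(\{\alpha\in S:\langle\alpha,\varepsilon_S^\vee\rangle=0\})$. Every $K\in\mathcal{K}(S)$ is connected. $E_{S,T}$ is the subspace of $\mathfrak{h}^*$ spanned by the $\varepsilon_K$, $K\in\mathcal{K}(S)\cup\mathcal{K}(T)$. Finally $\mathfrak{g}_{S,T}=\mathfrak{h}\oplus\sum_{\alpha\in R_+^S}\mathfrak{g}^\alpha\oplus\sum_{\alpha\in R_-^T}\mathfrak{g}^\alpha$, and $\operatorname{rk}(\mathfrak{g})=\dim\mathfrak{h}$. *)

(* Defs.v *)
From HB Require Import structures.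
From mathcomp Require Import all_boot all_order all_algebra.
From Stdlib Require Import ClassicalEpsilon.
Set Implicit Arguments. Unset Strict Implicit. Unset Printing Implicit Defensive.
Import GRing.Theory.
Local Open Scope ring_scope.

Definition asb (P : Prop) : bool :=
  if excluded_middle_informative P then true else false.

Section LieDefs.
Variable F : fieldType.
Variable L : vectType F.
Variable br : L -> L -> L.

Definition brsp (U V : {vspace L}) : {vspace L} :=
  (<<[seq br u v | u <- vbasis U, v <- vbasis V]>>)%VS.

Definition is_subalg (A : {vspace L}) : Prop :=
  forall x y, x \in A -> y \in A -> br x y \in A.

Definition is_ideal (I : {vspace L}) : Prop :=
  forall x y, y \in I -> br x y \in I.

Definition solvable_sp (I : {vspace L}) : Prop :=
  exists n, iter n (fun J => brsp J J) I = 0%VS.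

Definition semisimple : Prop :=
  forall I, is_ideal I -> solvable_sp I -> I = 0%VS.

Definition is_cartan (h : {vspace L}) : Prop :=
  [/\ is_subalg h,
      exists n, iter n (fun J => brsp h J) h = 0%VS &
      forall x, (forall y, y \in h -> br x y \in h) -> x \in h].

Section Roots.
Variable h : {vspace L}.

Definition hdual := 'Hom(subvs_of h, F^o).

Definition rootsp (a : hdual) : {vspace L} :=
  (\bigcap_(i < \dim h)
     lker (linfun (fun x : L => br (vbasis h)`_i x
                                - (a (vsproj h (vbasis h)`_i) : F) *: x)))%VS.

Definition is_root (a : hdual) : bool := (a != 0) && (rootsp a != 0%VS).

Definition coroot (a : hdual) : L :=
  epsilon (inhabits 0)
    (fun H => H \in brsp (rootsp a) (rootsp (- a)) /\ (a (vsproj h H) : F) = 2).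

Definition pairing (lam a : hdual) : F := lam (vsproj h (coroot a)).

Variable l : nat.
Variable Pi : l.-tuple hdual.

Definition inZS (S : {set 'I_l}) (a : hdual) : Prop :=
  exists c : 'I_l -> int, (forall i, i \notin S -> c i = 0)
    /\ a = \sum_(i < l) (c i)%:~R *: Pi`_i.
Definition inNS (S : {set 'I_l}) (a : hdual) : Prop :=
  exists c : 'I_l -> nat, (forall i, i \notin S -> c i = 0%N)
    /\ a = \sum_(i < l) (c i)%:R *: Pi`_i.

Definition in_RS (S : {set 'I_l}) a : Prop := is_root a /\ inZS S a.
Definition in_RSpos (S : {set 'I_l}) a : Prop := is_root a /\ inNS S a.
Definition in_RSneg (S : {set 'I_l}) a : Prop := in_RS S a /\ ~ in_RSpos S a.

Definition is_base : Prop :=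
  [/\ forall i : 'I_l, is_root Pi`_i,
      basis_of fullv Pi &
      forall a, is_root a -> exists c : 'I_l -> int,
        a = \sum_(i < l) (c i)%:~R *: Pi`_i /\
        ((forall i, (0 <= c i)%R) \/ (forall i, (c i <= 0)%R))].

Definition highest (S : {set 'I_l}) : hdual :=
  epsilon (inhabits 0)
    (fun b => in_RS S b /\ forall g, in_RS S g -> inNS S (b - g)).

Definition dyn_adj (i j : 'I_l) : bool :=
  (i != j) && ((pairing Pi`_i Pi`_j != 0) || (pairing Pi`_j Pi`_i != 0)).

Definition adjS (S : {set 'I_l}) : rel 'I_l :=
  fun i j => [&& i \in S, j \in S & dyn_adj i j].

Definition comps (S : {set 'I_l}) : {set {set 'I_l}} :=
  [set [set j in S | connect (adjS S) i j] | i in S].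

Definition connectedS (S : {set 'I_l}) : bool := #|comps S| == 1%N.

Fixpoint Kf (n : nat) (S : {set 'I_l}) : {set {set 'I_l}} :=
  match n with
  | 0 => set0
  | n'.+1 =>
      if connectedS S then
        S |: Kf n' [set i in S | pairing Pi`_i (highest S) == 0]
      else \bigcup_(C in comps S) Kf n' C
  end.

Definition Kset (S : {set 'I_l}) : {set {set 'I_l}} := Kf #|S| S.

Definition Esp (S T : {set 'I_l}) : {vspace hdual} :=
  (<<[seq highest K | K <- enum (Kset S :|: Kset T)]>>)%VS.

(* g_{S,T}, given the list Rs of all roots *)
Definition gST (Rs : seq hdual) (S T : {set 'I_l}) : {vspace L} :=
  (h + \sum_(a <- Rs | asb (in_RSpos S a)) rootsp a
     + \sum_(a <- Rs | asb (in_RSneg T a)) rootsp a)%VS.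

End Roots.

Definition stabsp (A : {vspace L}) (f : 'Hom(subvs_of A, F^o))
  : {vspace subvs_of A} :=
  (\bigcap_(j < \dim A)
     lker (linfun (fun X : subvs_of A =>
                     f (vsproj A (br (vsval X) (vbasis A)`_j)))))%VS.

Lemma lie_index_ex (A : {vspace L}) :
  exists n, asb (exists f : 'Hom(subvs_of A, F^o), \dim (stabsp f) = n).
Proof.
exists (\dim (stabsp (0 : 'Hom(subvs_of A, F^o)))).
rewrite /asb; case: excluded_middle_informative => // H.
by exfalso; apply: H; exists 0.
Qed.

Definition lie_index (A : {vspace L}) : nat := ex_minn (lie_index_ex A).

End LieDefs.

(* Main.v *)
(* The bound is witnessed by the functional f = kappa(u, -), where kappa is the Killing form and u
   = \sum_(K in K(S)) t^(ht e_K) X_(-e_K) + \sum_(K in K(T)) t^(ht e_K) X_(e_K), e_K being the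
   highest root of R^K. In Kostant's cascade every positive root of R^S outside the e_K, K in
   K(S), has a unique partner, of the same kind, such that the two sum to some e_K. Hence f([x,
   y]) restricted to the sum V0 of the root spaces of g_(S,T) other than the cascade ones has,
   after rescaling, a Gram matrix polynomial in 1/t whose value at 1/t = 0 is invertible, so that
   f is nondegenerate on V0 for some t <> 0. Writing E' for the sum of the cascade root spaces,
   the stabiliser of f has dimension at most dim {e in E' | f([h, e]) = 0} + dim {H in h | e_K(H)
   = 0 for all K} = (card K(S) + card K(T) - dim E) + (rk g - dim E). *)
Require Import Defs.
From HB Require Import structures.
From mathcomp Require Import all_boot all_order all_algebra.
From mathcomp Require Import zify.
From Stdlib Require Import Classical ClassicalEpsilon.
Set Implicit Arguments.
Unset Strict Implicit.
Unset Printing Implicit Defensive.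
Import Order.TTheory GRing.Theory Num.Theory.
Local Open Scope ring_scope.

(** The structure theory rests on one device: [x, y] has trace 0 on every subspace stable under ad x
    and ad y. Applied to sums of weight spaces along suitable strings, it does the work of
    sl_2-theory: weights take rationally proportional values on [x, y], root spaces are lines, the
    values of roots on the coroot of a highest root are known, and roots split along Dynkin
    components. It also stands in for Cartan's criterion: kappa([x, y], [x, y]) is a scalar times a
    sum of rational squares, so an isotropic [x, y] vanishes, and the radical of kappa reduces to a
    nilpotent ideal and a part inside h. Until ad H is known to be diagonalisable, generalised
    weight spaces are used.

    The exponents of t are heights because the absolute height of a + b is the sum of those of a and
    b when they have the same sign, and strictly smaller otherwise. Pairs of opposite signs, over
    which the cascade gives no control, thus carry a positive power of 1/t and disappear at 1/t = 0,
    where only the partner pairs survive. The index being a minimum, one good t suffices. *)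

(** * Subspaces cut out by propositions *)

Section Subspaces.
Variable F : fieldType.

(** Serves bare functions, such as those inside [rootsp] and [stabsp], whose linearity is a separate
    fact and not an instance. *)
Lemma linfunE (U V : vectType F) (f : U -> V) : linear f -> linfun f =1 f.
Proof.
move=> lf; pose g := HB.pack_for {linear U -> V} f (GRing.isLinear.Build F U V _ f lf).
exact: (lfunE g).
Qed.

Variable L : vectType F.

(** A subspace of maximal dimension among those contained in [P] absorbs the line through any vector
    of [P]. *)
Lemma exists_vspace (P : L -> Prop) :
  P 0 -> (forall a x y, P x -> P y -> P (a *: x + y)) ->
  exists U : {vspace L}, forall x, x \in U <-> P x.
Proof.
move=> P0 PD.
pose Q n := exists U : {vspace L}, \dim U = n /\ forall x, x \in U -> P x.
have [n [Qn nmax]] : exists n, Q n /\ forall m, Q m -> (m <= n)%N.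
  apply: NNPP => H.
  have K n : exists2 m, Q m & (n <= m)%N.
    elim: n => [|n [m Qm lenm]].
      by exists 0%N => //; exists 0%VS; split=> [|x]; rewrite ?dimv0 ?memv0 // => /eqP->.
    apply: NNPP => H1; apply: H; exists m; split=> // k Qk.
    rewrite leqNgt; apply/negP => ltmk; apply: H1; exists k => //.
    exact: leq_trans ltmk.
  have [m [U [<- _]] ] := K (\dim {:L}).+1.
  by rewrite ltnNge dimvS ?subvf.
case: Qn => U [dU UP]; exists U => x; split=> [|Px]; first exact: UP.
have : Q (\dim (U + <[x]>)%VS).
  exists (U + <[x]>)%VS; split=> // y /memv_addP[u uU [v /vlineP[k ->] ->]].
  by rewrite addrC; apply: PD => //; apply: UP.
move/nmax; rewrite -dU => le.
have : (U + <[x]>)%VS == U.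
  by rewrite eq_sym eqEdim addvSl.
move/eqP => <-; apply: (subvP (addvSr _ _)); exact: memv_line.
Qed.

(** Comprehension for a [Prop] predicate; the value is arbitrary unless [P] is closed under linear
    combinations. *)
Definition vspace_of (P : L -> Prop) : {vspace L} :=
  epsilon (inhabits 0%VS) (fun U : {vspace L} => forall x, x \in U <-> P x).

Lemma vspace_ofP (P : L -> Prop) :
  P 0 -> (forall a x y, P x -> P y -> P (a *: x + y)) ->
  forall x, x \in vspace_of P <-> P x.
Proof.
move=> P0 PD; exact: (epsilon_spec (inhabits 0%VS) _ (exists_vspace P0 PD)).
Qed.

End Subspaces.

Definition stab (F : fieldType) (L : vectType F) (U : {vspace L}) (f : 'End(L)) :=
  forall x, x \in U -> f x \in U.

(** * Traces on stable subspaces *)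

Section Trace.
Variables (F : closedFieldType) (L : vectType F).
Implicit Types (f g : 'End(L)) (U V : {vspace L}).
Let e := vbasis {:L}.
Let n := \dim {:L}.

Let e_basis : basis_of {:L} e. Proof. exact: vbasisP. Qed.
Definition lfun_mx f : 'M[F]_n := passmx.mxof e e f.
Definition lftrace f : F := \tr (lfun_mx f).

Lemma lftrace_linear : linear_for *%R lftrace.
Proof. by move=> a x y; rewrite /lftrace /lfun_mx passmx.mxof_linear linearP. Qed.
HB.instance Definition _ := GRing.isLinear.Build F _ _ _ lftrace lftrace_linear.

Lemma lfun_mx_comp f g : lfun_mx (f \o g)%VF = lfun_mx g *m lfun_mx f.
Proof. exact: passmx.mxof_comp. Qed.

Lemma lftraceC f g : lftrace (f \o g)%VF = lftrace (g \o f)%VF.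
Proof. by rewrite /lftrace !lfun_mx_comp mxtrace_mulC. Qed.

Lemma lfun_mx_eigen f a (v : 'rV_n) : v *m lfun_mx f = a *: v ->
  f (passmx.vecof e v) = a *: passmx.vecof e v.
Proof.
move=> H; rewrite (passmx.hom_vecof _ e_basis) -/(lfun_mx f) H.
by rewrite -[a *: v]addr0 passmx.vecof_linear /passmx.vecof [X in _ + X]big1 ?addr0 // => i _; rewrite mxE scale0r.
Qed.

Lemma exists_eigenvector f : (0 < n)%N -> exists c v, v != 0 /\ f v = c *: v.
Proof.
move=> n0; have : size (char_poly (lfun_mx f)) != 1%N by rewrite size_char_poly; case: (n) n0.
case/closed_rootP=> c; rewrite -eigenvalue_root_char => /eigenvalueP[v /lfun_mx_eigen H v0].
exists c, (passmx.vecof e v); split=> //.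
by rewrite passmx.vecof_eq0.
Qed.

(** All roots of the characteristic polynomial are 0, so it is X^n, and its coefficient of degree n
    - 1 is minus the trace. *)
Lemma lftrace_nilp f : (forall x, exists k, iter k f x = 0) -> lftrace f = 0.
Proof.
move=> nil; have [n0|n0] := posnP n.
  by rewrite /lftrace /mxtrace big1 // => -[i lti] _; exfalso; move: lti; rewrite n0.
have [r Er] := closed_field_poly_normal (char_poly (lfun_mx f)).
move: Er; rewrite (monicP (char_poly_monic _)) scale1r => Er.
have r0 z : z \in r -> z = 0.
  rewrite -root_prod_XsubC -Er -eigenvalue_root_char => /eigenvalueP[v /lfun_mx_eigen H v0].
  have [k Hk] := nil (passmx.vecof e v).
  have : z ^+ k *: passmx.vecof e v = 0.
    rewrite -Hk; elim: k {Hk} => [|k IH]; first by rewrite expr0 scale1r.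
    by rewrite iterS -IH linearZ /= H scalerA exprSr.
  move/eqP; rewrite scaler_eq0 passmx.vecof_eq0 // (negPf v0) orbF expf_eq0.
  by case/andP=> _ /eqP.
have Er2 : char_poly (lfun_mx f) = 'X^(size r).
  rewrite Er; elim: (r) r0 => [|z s IH] zs; first by rewrite big_nil expr0.
  rewrite big_cons IH; last by move=> w ws; apply: zs; rewrite inE ws orbT.
  by rewrite (zs z) ?inE ?eqxx // subr0 exprS.
have sr : size r = n.
  by have := size_char_poly (lfun_mx f); rewrite Er2 size_polyXn => -[].
have := char_poly_trace (lfun_mx f) n0; rewrite Er2 sr coefXn.
have -> : (n.-1 == n) = false by case: (n) n0 => // m _; rewrite /= ltn_eqF.
by move/eqP; rewrite eq_sym oppr_eq0 => /eqP.
Qed.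

(** The trace of the restriction of [f] to [U], meaningful when [U] is stable under [f]. *)
Definition trace_on U f : F := \sum_i coord (vbasis U) i (f (vbasis U)`_i).

Lemma lftraceE f : lftrace f = \sum_i coord e i (f e`_i).
Proof. by apply: eq_bigr => i _; rewrite !mxE /= passmx.vecof_delta. Qed.

(** Expand each [f e_j] in the basis of [U] and exchange the sums: the sum over j then rebuilds the
    basis vector of [U] from its ambient coordinates. *)
Lemma lftrace_trace_on U f : (forall x, f x \in U) -> lftrace f = trace_on U f.
Proof.
move=> fU; rewrite lftraceE /trace_on.
under eq_bigr => j _ do rewrite {1}(coord_vbasis (fU e`_j)) linear_sum /=.
rewrite exchange_big /=; apply: eq_bigr => i _.
rewrite {2}(coord_vbasis (memvf (vbasis U)`_i)) linear_sum /= linear_sum /=.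
by apply: eq_bigr => j _; rewrite !linearZ /= mulrC.
Qed.

Lemma eq_trace_on U f g : (forall x, x \in U -> f x = g x) -> trace_on U f = trace_on U g.
Proof.
by move=> E; apply: eq_bigr => i _; rewrite E // vbasis_mem // mem_nth // size_tuple.
Qed.

Lemma trace_on_linear U : linear_for *%R (trace_on U).
Proof.
move=> a f g; rewrite /trace_on mulr_sumr -big_split /=; apply: eq_bigr => i _.
by rewrite add_lfunE scale_lfunE linearP.
Qed.
HB.instance Definition _ U := GRing.isLinear.Build F _ _ _ (trace_on U) (trace_on_linear U).

Lemma trace_on_id U : trace_on U \1%VF = (\dim U)%:R.
Proof.
rewrite /trace_on; transitivity (\sum_(i < \dim U) (1 : F)).
  by apply: eq_bigr => i _; rewrite id_lfunE coord_free ?eqxx // (basis_free (vbasisP U)).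
by rewrite sumr_const card_ord.
Qed.

Lemma trace_on_proj U f : stab U f -> trace_on U f = lftrace (f \o projv U)%VF.
Proof.
move=> fU; rewrite (@lftrace_trace_on U); last by move=> x; rewrite comp_lfunE fU ?memv_proj.
by apply: eq_trace_on => x xU; rewrite comp_lfunE projv_id.
Qed.

Lemma trace_on_full f : trace_on fullv f = lftrace f.
Proof. by rewrite (@lftrace_trace_on fullv) // => x; rewrite memvf. Qed.

Lemma trace_onD U V f : stab U f -> stab V f -> (U :&: V = 0)%VS ->
  trace_on (U + V)%VS f = trace_on U f + trace_on V f.
Proof.
move=> fU fV UV; rewrite trace_on_proj; last first.
  by move=> x /memv_addP[u uU [v vV ->]]; rewrite linearD memv_add ?fU ?fV.
have VU : (V :&: U = 0)%VS by rewrite capvC.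
pose p := projv (U + V)%VS.
have -> : (f \o p)%VF = (f \o (daddv_pi U V \o p))%VF + (f \o (daddv_pi V U \o p))%VF.
  apply/lfunP => x; rewrite add_lfunE !comp_lfunE -linearD daddv_pi_add //.
  exact: memv_proj.
rewrite linearD /= (@lftrace_trace_on U) ?(@lftrace_trace_on V); first last.
- by move=> x; rewrite !comp_lfunE fU // memv_pi.
- by move=> x; rewrite !comp_lfunE fV // memv_pi.
congr (_ + _); apply: eq_trace_on => x xU; rewrite !comp_lfunE.
  have xUV : x \in (U + V)%VS := subvP (addvSl U V) x xU.
  by rewrite /p (projv_id xUV) daddv_pi_id.
have xUV : x \in (U + V)%VS := subvP (addvSr U V) x xU.
by rewrite /p (projv_id xUV) daddv_pi_id.
Qed.

(** Hence commutators are traceless on every common stable subspace, the source of all numerical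
    facts about roots below. *)
Lemma trace_on_comm U f g : stab U f -> stab U g -> trace_on U (f \o g)%VF = trace_on U (g \o f)%VF.
Proof.
move=> fU gU; pose p := projv U.
have H f' g' : stab U f' -> stab U g' ->
    trace_on U (f' \o g')%VF = lftrace ((f' \o p) \o (g' \o p))%VF.
  move=> sf sg; rewrite trace_on_proj; last by move=> x xU; rewrite comp_lfunE sf ?sg.
  congr lftrace; apply/lfunP => x; rewrite !comp_lfunE [p (g' _)]projv_id //.
  by rewrite sg ?memv_proj.
by rewrite !H // lftraceC.
Qed.

Lemma trace_on_nilp U f : stab U f -> (forall x, x \in U -> exists k, iter k f x = 0) ->
  trace_on U f = 0.
Proof.
move=> fU nil; rewrite trace_on_proj // lftrace_nilp // => x.
have [k Hk] := nil _ (memv_proj U x).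
case: k Hk => [|k] Hk.
  by exists 1%N; rewrite /= comp_lfunE; move: Hk => /= ->; rewrite linear0.
exists k.+1; rewrite -Hk !iterSr comp_lfunE.
have : f (projv U x) \in U by rewrite fU ?memv_proj.
elim: k {Hk} (f _) => [|k IH] y yU //.
by rewrite !iterSr IH comp_lfunE projv_id ?fU.
Qed.

Lemma trace_on_const U f c : stab U f ->
  (forall x, x \in U -> exists k, iter k (f - c *: \1)%VF x = 0) ->
  trace_on U f = c * (\dim U)%:R.
Proof.
move=> fU nil; rewrite -[f in LHS](subrK (c *: \1%VF)) linearD /= trace_on_nilp //.
  by rewrite linearZ /= trace_on_id add0r.
move=> x xU; rewrite add_lfunE opp_lfunE scale_lfunE id_lfunE.
by rewrite memvB ?fU ?memvZ.
Qed.

End Trace.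

(** * Eigenvectors and Fitting's decomposition on stable subspaces *)

Section Stable.
Variables (F : closedFieldType) (L : vectType F).
Implicit Types (f g : 'End(L)) (U V : {vspace L}).

Lemma stab_eigenvector U f : stab U f -> U != 0%VS ->
  exists c v, [/\ v \in U, v != 0 & f v = c *: v].
Proof.
move=> fU U0; pose g : 'End(subvs_of U) := (linfun (vsproj U) \o f \o linfun vsval)%VF.
have [|c [v [v0 Hv]]] := @exists_eigenvector _ _ g.
  by rewrite dimvf lt0n dimv_eq0.
exists c, (vsval v); split; first exact: subvsP.
  by apply: contra v0 => /eqP H; apply/eqP/subvs_inj; rewrite H.
move: (congr1 vsval Hv); rewrite /g !comp_lfunE !lfunE /= vsprojK // ?fU //.
exact: subvsP.
Qed.

Lemma stab_iter U f k : stab U f -> forall x, x \in U -> iter k f x \in U.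
Proof. by move=> fU x xU; elim: k => //= k; exact: fU. Qed.

(** Choose the power with image of least dimension: it maps that image bijectively onto itself. The
    exponent is a successor so that the kernel of the power contains the kernel of [f]. *)
Lemma fitting U f : stab U f -> exists k,
  (forall x, x \in U -> iter k.+1 f (iter k.+1 f x) = 0 -> iter k.+1 f x = 0) /\
  (forall x, x \in U -> exists y, y \in U /\ iter k.+1 f (x - iter k.+1 f y) = 0).
Proof.
move=> fU; have [g gE] : exists g : nat -> 'End(L), forall k x, g k x = iter k f x.
  exists (fun k => iter k (comp_lfun f) \1%VF) => k x.
  by elim: k => [|k IH]; rewrite /= ?id_lfunE // comp_lfunE IH.
pose P n := exists k, \dim (g k.+1 @: U) = n.
have [n [[k dk] nmin]] : exists n, P n /\ forall m, P m -> (n <= m)%N.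
  apply: NNPP => H.
  have K m : forall n, P n -> (m <= n)%N.
    elim: m => // m IH n Pn; have := IH _ Pn; rewrite leq_eqVlt => /orP[/eqP E|//].
    by exfalso; apply: H; exists n; split=> // n' /IH; rewrite -E.
  by have := K (\dim (g 1%N @: U)).+1 _ (ex_intro _ 0%N erefl); rewrite ltnn.
exists k; set V := (g k.+1 @: U)%VS.
have VU : (V <= U)%VS by apply/subvP => _ /memv_imgP[x xU ->]; rewrite gE stab_iter.
have gV : (g k.+1 @: V <= V)%VS by apply: limgS.
have dV : \dim (g k.+1 @: V) = \dim V.
  apply/eqP; rewrite eqn_leq dimvS //= dk; apply: nmin; exists (k + k).+1.
  congr (\dim _); rewrite -limg_comp; congr (_ @: _)%VS.
  by apply/lfunP => x; rewrite comp_lfunE !gE -iterD addSn addnS.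
have eV : (g k.+1 @: V)%VS = V by apply/eqP; rewrite eqEdim gV dV leqnn.
split=> x xU.
  move=> H; have := limg_ker_dim (g k.+1) V; rewrite dV => /eqP.
  rewrite -[X in _ == X]add0n eqn_add2r dimv_eq0 => /eqP K.
  have : iter k.+1 f x \in (V :&: lker (g k.+1))%VS.
    by rewrite memv_cap memv_ker -gE memv_img //= !gE H.
  by rewrite K memv0 => /eqP.
have : g k.+1 x \in (g k.+1 @: V)%VS by rewrite eV memv_img.
case/memv_imgP => _ /memv_imgP[y yU ->] E; exists y; split=> //.
by rewrite -gE -gE linearB /= E subrr.
Qed.

End Stable.

(* The binomial argument: [c] acts on [B x y] by the Leibniz rule. *)
Lemma nil_bilin (X Y : Type) (Z : zmodType) (B : X -> Y -> Z) (a : X -> X) (b : Y -> Y)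
    (c : Z -> Z) (x0 : X) (y0 : Y) :
  (forall u v, c (u + v) = c u + c v) ->
  (forall y, B x0 y = 0) -> (forall x, B x y0 = 0) ->
  (forall x y, c (B x y) = B (a x) y + B x (b y)) ->
  forall n m x y, iter n a x = x0 -> iter m b y = y0 -> iter (n + m) c (B x y) = 0.
Proof.
move=> cD B0 B1 H n m.
have c0 : c 0 = 0 by apply: (@addrI _ (c 0)); rewrite -cD !addr0.
have z k : iter k c 0 = 0 by elim: k => //= k ->.
have zD k u v : iter k c (u + v) = iter k c u + iter k c v.
  by elim: k => //= k ->.
have [k] := ubnP (n + m); elim: k n m => // k IH [|n] [|m] ltk x y.
- by move=> /= -> _; rewrite B0.
- by move=> E _; rewrite -[x]/(iter 0 a x) E B0 z.
- by move=> _ E; rewrite -[y]/(iter 0 b y) E B1 z.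
move=> Hx Hy; have l1 : (n + m.+1 < k)%N by rewrite -ltnS -addSn.
have l2 : (n.+1 + m < k)%N by rewrite addSn -addnS.
rewrite addSn iterSr H zD (IH _ _ l1 _ _ _ Hy) -?iterSr //.
by rewrite add0r addnS -addSn (IH _ _ l2 _ _ Hx) // -iterSr.
Qed.

Lemma iter_lin0 (F : fieldType) (L : vectType F) (f : 'End(L)) n : iter n f 0 = 0.
Proof. by elim: n => //= n ->; rewrite linear0. Qed.

Lemma iter_lin (F : fieldType) (L : vectType F) (f : 'End(L)) n : linear (iter n f).
Proof. by move=> a x y; elim: n => //= n ->; rewrite linearP. Qed.

Lemma iter_comm (T : Type) (f g : T -> T) n x :
  (forall y, f (g y) = g (f y)) -> iter n f (g x) = g (iter n f x).
Proof. by move=> fg; elim: n => //= n ->. Qed.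

Lemma iter_le0 (F : fieldType) (L : vectType F) (f : 'End(L)) m n x :
  (m <= n)%N -> iter m f x = 0 -> iter n f x = 0.
Proof. by move=> /subnK <- H; rewrite iterD H iter_lin0. Qed.

(** * Engel's argument for commuting nilpotent operators *)

Section Engel.
Variables (F : fieldType) (L : vectType F).
Implicit Types (f g : 'End(L)) (A B U : {vspace L}).

Lemma nilD f g n m x : (forall y, f (g y) = g (f y)) ->
  iter n f x = 0 -> iter m g x = 0 -> iter (n + m) (f + g) x = 0.
Proof.
move=> fg; have [k] := ubnP (n + m); elim: k n m x => // k IH [|n] [|m] x ltk.
- by move=> /= ->.
- by move=> /= -> _; rewrite iter_lin0 linear0.
- by move=> _ /= ->; rewrite iter_lin0 linear0.
move=> Hf Hg; have l1 : (n + m.+1 < k)%N by rewrite -ltnS -addSn.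
have l2 : (n.+1 + m < k)%N by rewrite addSn -addnS.
rewrite addSn iterSr add_lfunE -[f x]scale1r iter_lin scale1r.
rewrite (IH _ _ _ l1) -?iterSr //; last by rewrite iter_comm ?Hg ?linear0.
rewrite add0r addnS -addSn (IH _ _ _ l2) -?iterSr //.
by rewrite (@iter_comm _ f g) ?Hf ?linear0.
Qed.

(** The orbit of [c] ends at 0, inside [A]; its last member outside [A] is the witness, and [C] is
    carried along the orbit. *)
Lemma engel_step (C : L -> Prop) f A c n : C c -> c \notin A -> iter n f c = 0 ->
  (forall x, C x -> C (f x)) -> exists v, [/\ C v, v \notin A & f v \in A].
Proof.
move=> Cc cA Hn CC; elim: n c Cc cA Hn => [|n IH] c Cc cA Hn.
  by rewrite -[c]/(iter 0 f c) Hn mem0v in cA.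
have [fA|fA] := boolP (f c \in A); first by exists c.
by apply: IH fA _; [exact: CC | rewrite -iterSr].
Qed.

(** Induction on [fs]: the vectors of [B] that the earlier operators send into [A] are preserved by
    the new one, by commutation, so [engel_step] applies to them. *)
Lemma comm_engel (fs : seq 'End(L)) A B : (A <= B)%VS -> A != B ->
  (forall f, f \in fs -> stab A f /\ stab B f) ->
  (forall f g x, f \in fs -> g \in fs -> f (g x) = g (f x)) ->
  (forall f x, f \in fs -> x \in B -> exists n, iter n f x = 0) ->
  exists v, [/\ v \in B, v \notin A & forall f, f \in fs -> f v \in A].
Proof.
move=> AB nAB; elim: fs => [|f fs IH] st cm nil.
  have : ~~ (B <= A)%VS by apply: contra nAB => BA; rewrite eqEsubv AB.
  by case/subvPn => v vB vA; exists v.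
have [||| v [vB vA Hv]] := IH.
- by move=> g gs; apply: st; rewrite inE gs orbT.
- by move=> g g' x gs gs'; apply: cm; rewrite inE ?gs ?gs' orbT.
- by move=> g x gs; apply: nil; rewrite inE gs orbT.
pose C x := x \in B /\ forall g, g \in fs -> g x \in A.
have [n Hn] := nil f v (mem_head _ _) vB.
have [| | w [[wB Hw] wA fw]] := @engel_step C f A v n _ vA Hn.
- by [].
- move=> x [xB Hx]; split; first by apply: (st f (mem_head _ _)).2.
  move=> g gs; rewrite -cm ?mem_head ?inE ?gs ?orbT //.
  by apply: (st f (mem_head _ _)).1; exact: Hx.
by exists w; split=> // g; rewrite inE => /predU1P[->|/Hw].
Qed.

End Engel.

(** * Rational elements of a field of characteristic 0 *)

Section CharZero.
Variables (F : fieldType).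
Hypothesis char0 : [pchar F] =i pred0.

Lemma natF_eq0 n : ((n%:R : F) == 0) = (n == 0%N).
Proof. exact: (pcharf0P F).1 char0 n. Qed.

Lemma intF_eq0 (z : int) : ((z%:~R : F) == 0) = (z == 0).
Proof. by case: z => n; rewrite ?NegzE ?mulrNz ?oppr_eq0 natF_eq0. Qed.

Lemma intF_inj (y z : int) : (y%:~R : F) = z%:~R -> y = z.
Proof. by move=> E; apply/eqP; rewrite -subr_eq0 -intF_eq0 mulrzBr E subrr. Qed.

Lemma natF_inj (m n : nat) : (m%:R : F) = n%:R -> m = n.
Proof. by move=> E; have /eqP := @intF_inj m n E; rewrite eqz_nat => /eqP. Qed.

Definition is_rat (x : F) := exists (a : int) (b : nat), x * b.+1%:R = a%:~R.
(** The closed field [F] has no order; positivity of sums of squares is argued inside its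
    nonnegative rationals. *)
Definition is_nneg_rat (x : F) := exists a b : nat, x * b.+1%:R = a%:R.

Lemma is_rat_int z : is_rat z%:~R. Proof. by exists z, 0%N; rewrite mulr1. Qed.
Lemma is_rat_nat n : is_rat n%:R. Proof. exact: (is_rat_int n). Qed.

Lemma is_ratD x y : is_rat x -> is_rat y -> is_rat (x + y).
Proof.
move=> [a [b E]] [c [d E']]; exists (a * d.+1 + c * b.+1), (b.+1 * d.+1).-1.
rewrite prednK // natrM mulrDl mulrA E [b.+1%:R * _]mulrC mulrA E'.
by rewrite rmorphD !rmorphM.
Qed.

Lemma is_ratM x y : is_rat x -> is_rat y -> is_rat (x * y).
Proof.
move=> [a [b E]] [c [d E']]; exists (a * c), (b.+1 * d.+1).-1.
by rewrite prednK // natrM mulrACA E E' rmorphM.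
Qed.

Lemma is_rat_sum (I : Type) (s : seq I) (P : pred I) (x : I -> F) :
  (forall i, P i -> is_rat (x i)) -> is_rat (\sum_(i <- s | P i) x i).
Proof. by move=> H; apply: big_ind => //; [exact: (is_rat_int 0) | exact: is_ratD]. Qed.

Lemma is_ratV x : is_rat x -> is_rat x^-1.
Proof.
move=> [a [b E]]; have [->|x0] := eqVneq x 0; first by rewrite invr0; exact: (is_rat_int 0).
have xE : x = a%:~R / b.+1%:R by rewrite -E mulfK ?natF_eq0.
move: xE x0; case: a {E} => n ->.
  case: n => [|n]; first by rewrite mul0r eqxx.
  by move=> _; exists b.+1%:Z, n; rewrite invf_div mulfVK // natF_eq0.
move=> _; exists (- b.+1%:Z), n; rewrite NegzE !mulrNz mulNr invrN invf_div.
by rewrite mulNr mulfVK // natF_eq0.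
Qed.

Lemma is_rat_sqr x : is_rat x -> is_nneg_rat (x ^+ 2).
Proof.
move=> [a [b E]]; exists (`|a| ^ 2)%N, (b.+1 ^ 2).-1.
rewrite prednK ?expn_gt0 // natrX -exprMn E natrX.
by case: (a) => n; rewrite ?NegzE ?mulrNz ?sqrrN ?abszN.
Qed.

Lemma is_nneg_rat_nat n : is_nneg_rat n%:R. Proof. by exists n, 0%N; rewrite mulr1. Qed.

Lemma is_nneg_ratD x y : is_nneg_rat x -> is_nneg_rat y -> is_nneg_rat (x + y).
Proof.
move=> [a [b E]] [c [d E']]; exists (a * d.+1 + c * b.+1)%N, (b.+1 * d.+1).-1.
rewrite prednK // natrM mulrDl mulrA E [b.+1%:R * _]mulrC mulrA E'.
by rewrite natrD !natrM.
Qed.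

Lemma is_nneg_ratM x y : is_nneg_rat x -> is_nneg_rat y -> is_nneg_rat (x * y).
Proof.
move=> [a [b E]] [c [d E']]; exists (a * c)%N, (b.+1 * d.+1).-1.
by rewrite prednK // natrM mulrACA E E' natrM.
Qed.

Lemma is_nneg_rat_add_eq0 x y : is_nneg_rat x -> is_nneg_rat y -> x + y = 0 -> x = 0.
Proof.
move=> [a [b E]] [c [d E']] xy.
have : (a * d.+1 + c * b.+1)%:R = 0 :> F.
  by rewrite natrD !natrM -E -E' -!mulrA [d.+1%:R * _]mulrC -mulrDl xy mul0r.
move/eqP; rewrite natF_eq0 addn_eq0 muln_eq0 /= orbF => /andP[/eqP a0 _].
by move/eqP: E; rewrite a0 mulf_eq0 natF_eq0 orbF => /eqP.
Qed.

Lemma is_nneg_rat_sum_eq0 (I : eqType) (s : seq I) (x : I -> F) :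
  (forall i, is_nneg_rat (x i)) -> \sum_(i <- s) x i = 0 -> forall i, i \in s -> x i = 0.
Proof.
move=> Q; elim: s => // i s IH; rewrite big_cons => E j.
have Qs : is_nneg_rat (\sum_(k <- s) x k).
  by apply: big_ind => //; [exact: (is_nneg_rat_nat 0) | exact: is_nneg_ratD].
rewrite inE => /predU1P[->|]; first exact: is_nneg_rat_add_eq0 E.
by apply: IH; move: E; rewrite addrC => /is_nneg_rat_add_eq0 ->.
Qed.

End CharZero.

(* Linearity is assumed in the first argument only, so antisymmetry is not formal: [br_alt]
   polarizes only once additivity in the second argument is known. Each defect of T x y z = br
   x (br y z) (of additivity, then of homogeneity, in y) is symmetric in its first two slots
   and antisymmetric in the outer two, so it vanishes. Then br y z + br z y is annihilated by
   T, and such elements span abelian ideals, which semisimplicity kills. *)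
Section Antisymmetry.
Variables (F : fieldType) (char0 : [pchar F] =i pred0).
Variables (L : vectType F) (br : L -> L -> L).
Hypothesis br_linl : forall (a : F) (x y z : L), br (a *: x + y) z = a *: br x z + br y z.
Hypothesis br_alt : forall x : L, br x x = 0.
Hypothesis br_jacobi : forall x y z : L,
  br x (br y z) + br y (br z x) + br z (br x y) = 0.
Hypothesis g_ss : semisimple br.

Lemma brDl x y z : br (x + y) z = br x z + br y z.
Proof. by rewrite -[x]scale1r br_linl !scale1r. Qed.

Lemma br0l z : br 0 z = 0.
Proof. by have := br_linl (-1) 0 0 z; rewrite !scaleN1r oppr0 !add0r addNr. Qed.

Lemma brZl a x z : br (a *: x) z = a *: br x z.
Proof. by have := br_linl a x 0 z; rewrite br0l !addr0. Qed.

Lemma scale_natF_eq0 n (x : L) : n.+1%:R *: x = 0 -> x = 0.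
Proof. by move/eqP; rewrite scaler_eq0 natF_eq0 //= => /eqP. Qed.

Lemma double_eq0 (x : L) : x + x = 0 -> x = 0.
Proof. by move=> E; apply: (@scale_natF_eq0 1); rewrite scaler_nat mulr2n. Qed.

Lemma br0r x : br x 0 = 0.
Proof.
apply: (@scale_natF_eq0 2); have := br_jacobi x x x.
by rewrite br_alt scaler_nat !mulrS mulr0n addr0 addrA.
Qed.

Lemma abelian_ideal_eq0 (I : {vspace L}) : is_ideal br I ->
  (forall x y, x \in I -> y \in I -> br x y = 0) -> I = 0%VS.
Proof.
move=> idI abI; apply: g_ss => //; exists 1%N => /=; apply/eqP.
rewrite -subv0; apply/span_subvP => z /allpairsP[[u v] /= [uI vI ->]].
by rewrite memv0 abI ?vbasis_mem.
Qed.

(** The line through [q] is an abelian ideal. Every multiple [t *: q] is tested because homogeneity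
    in the second argument is not yet available. *)
Lemma br_null_line q : (forall v t, br v (t *: q) = 0) -> q = 0.
Proof.
move=> H; have : <[q]>%VS = 0%VS.
  apply: abelian_ideal_eq0 => [x y|x y _] /vlineP[k ->]; by rewrite H ?mem0v.
by move/eqP; rewrite -dimv_eq0 dim_vline eqb0 negbK => /eqP.
Qed.

(** Polarisation of h x x = 0 at x = a + c, where the shift rule does the work of additivity in the
    first argument. *)
Lemma anti_of_shift (h : L -> L -> L) : (forall a b c, h a (b + c) = h a b + h a c) ->
  (forall a c, h (a + c) c = h a c) -> (forall c, h 0 c = 0) ->
  forall a c, h a c = - h c a.
Proof.
move=> hD hS h0 a c; have hh x : h x x = 0 by rewrite -[x in h x _]add0r hS.
apply/eqP; rewrite -addr_eq0 -[h a c]hS -[h c a]hS [c + a]addrC addrC -hD.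
by rewrite hh.
Qed.

(** The transpositions (1 2) and (1 3) are conjugate yet act with opposite signs, so [R] equals its
    own opposite. *)
Lemma sym_anti_eq0 (R : L -> L -> L -> L) :
  (forall a b c, R a b c = R b a c) -> (forall a b c, R a b c = - R c b a) ->
  forall a b c, R a b c = 0.
Proof.
move=> S A a b c; apply: double_eq0; apply/eqP; rewrite addr_eq0; apply/eqP.
rewrite [LHS]A S [R b c a]A opprK S [LHS]A S //.
Qed.

Let T x y z := br x (br y z).

Let T_cyc x y z : T x y z = - (T y z x + T z x y).
Proof. by apply/eqP; rewrite -addr_eq0 addrA br_jacobi. Qed.

Let TDl x x' y z : T (x + x') y z = T x y z + T x' y z.
Proof. exact: brDl. Qed.

Let TDm x y y' z : T x (y + y') z = T x y z + T x y' z.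
Proof.
pose R a b c := T x (a + b) c - T x a c - T x b c.
have RE a b c : R a b c = T c x a + T c x b - T c x (a + b).
  rewrite /R ![T x _ c]T_cyc TDl !opprD !opprK.
  rewrite (AC (3*2*2)%AC ((1*4)*(2*6)*(5*7)*3)%AC) /= !addNr !add0r.
  congr (_ + _).
suff : R y y' z = 0.
  by rewrite /R -[_ - _ - _]addrA -opprD => /eqP; rewrite subr_eq0 => /eqP.
apply: (sym_anti_eq0 (R := R)) => a b c; first by rewrite /R [a + b]addrC addrAC.
have := @anti_of_shift (fun a c => R a b c); apply => [p q r|p q|q].
- by rewrite !RE !TDl opprD [X in X + _ = _]addrACA [LHS]addrACA.
- by rewrite /R /T !brDl br_alt !addr0.
- by rewrite /R add0r /T br0l br0r subr0 subrr.
Qed.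

Let TDr x y z z' : T x y (z + z') = T x y z + T x y z'.
Proof.
by rewrite ![T x y _]T_cyc TDm TDl -opprD; congr (- _); rewrite addrACA.
Qed.

Let T_anti x y z : T x y z = - T x z y.
Proof.
apply: (@anti_of_shift (fun y z => T x y z)) => {y z} [a b c|a c|c].
- exact: TDr.
- by rewrite /T brDl br_alt addr0.
- by rewrite /T br0l br0r.
Qed.

Let TZm t x y z : T x (t *: y) z = t *: T x y z.
Proof.
pose R z x y := T x (t *: y) z - t *: T x y z.
suff : R z x y = 0 by move/eqP; rewrite subr_eq0 => /eqP.
apply: (sym_anti_eq0 (R := R)) => a b c.
  rewrite /R ![T b _ a]T_cyc ![T a b _]T_anti.
  have -> : T (t *: c) a b = t *: T c a b by exact: brZl.
  by rewrite opprB scalerN opprK scalerBr addrA subrK.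
have := @anti_of_shift (fun a c => R a b c); apply => [p q r|p q|q].
- by rewrite /R scalerDr !TDm scalerDr opprD addrACA.
- by rewrite /R !TDr /T !brZl br_alt scaler0 br0r !addr0.
- by rewrite /R /T !br0r scaler0 subrr.
Qed.

Let T_eq0 w : (forall v u, T v u w = 0) -> w = 0.
Proof.
have Hq w' x : (forall v u, T v u w' = 0) -> br x w' = 0.
  by move=> H; apply: br_null_line => v t; rewrite -brZl; exact: H.
move=> H; apply: br_null_line => v t; apply: Hq => x u.
by rewrite T_anti TZm T_anti H oppr0 scaler0 oppr0.
Qed.

Lemma brNC x y : br x y = - br y x.
Proof.
apply/eqP; rewrite -addr_eq0; apply/eqP; apply: T_eq0 => v u; rewrite TDr.
rewrite {1}/T -[br u (br x y)]/(T u x y) T_anti -[T u y x]scale1r -scaleNr -brZl.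
rewrite -[br v _]/(T v (-1 *: u) (br y x)) TZm scaleN1r.
by rewrite addNr.
Qed.

End Antisymmetry.

Lemma asbP (P : Prop) : reflect P (asb P).
Proof. by rewrite /asb; case: excluded_middle_informative => p; constructor. Qed.

(** * Weight spaces *)

Section Weights.
Variables (F : closedFieldType) (L : vectType F) (br : L -> L -> L).
Hypothesis brl : forall (a : F) (x y z : L), br (a *: x + y) z = a *: br x z + br y z.
Hypothesis brr : forall (a : F) (x y z : L), br z (a *: x + y) = a *: br z x + br z y.
Hypothesis br_alt : forall x : L, br x x = 0.
Hypothesis br_jacobi : forall x y z : L,
  br x (br y z) + br y (br z x) + br z (br x y) = 0.

Definition ad (x : L) : 'End(L) := linfun (br x).

Lemma adE x y : ad x y = br x y.
Proof. by apply: linfunE => a u v; exact: brr. Qed.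

Lemma ad_linear : linear ad.
Proof.
move=> a x y; apply/lfunP => z.
by rewrite add_lfunE scale_lfunE !adE brl.
Qed.
HB.instance Definition _ := GRing.isLinear.Build F _ _ _ ad ad_linear.

Lemma brC x y : br x y = - br y x.
Proof.
have D u v z : br (u + v) z = br u z + br v z by rewrite -!adE linearD add_lfunE.
have := br_alt (x + y); rewrite D -!adE !linearD /= !adE !br_alt add0r addr0.
by move/eqP; rewrite addr_eq0 => /eqP.
Qed.

Lemma br_der x y z : br x (br y z) = br (br x y) z + br y (br x z).
Proof.
have /eqP := br_jacobi x y z; rewrite -addrA addr_eq0 opprD => /eqP->.
rewrite [br z (br x y)]brC opprK addrC; congr (_ + _).
by rewrite [br z x]brC -!adE linearN opprK.
Qed.

Lemma ad_br x y : ad (br x y) = (ad x \o ad y)%VF - (ad y \o ad x)%VF.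
Proof.
apply/lfunP => z; rewrite add_lfunE opp_lfunE !comp_lfunE !adE.
by rewrite br_der addrK.
Qed.

Lemma br0x z : br 0 z = 0. Proof. by rewrite -adE linear0 zero_lfunE. Qed.
Lemma brx0 z : br z 0 = 0. Proof. by rewrite -adE linear0. Qed.

Variable h : {vspace L}.
Hypothesis h_ab : forall x y, x \in h -> y \in h -> br x y = 0.
Notation hd := (hdual h).
Implicit Types a b c : hd.

Definition ev a (H : L) : F := a (vsproj h H).

Lemma ev_linear a : linear_for *%R (ev a).
Proof. by move=> k x y; rewrite /ev !linearP. Qed.
HB.instance Definition _ a := GRing.isLinear.Build F _ _ _ (ev a) (ev_linear a).

Lemma evD a b H : ev (a + b) H = ev a H + ev b H.
Proof. by rewrite /ev add_lfunE. Qed.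
Lemma evN a H : ev (- a) H = - ev a H.
Proof. by rewrite /ev opp_lfunE. Qed.
Lemma evZ k a H : ev (k *: a) H = k * ev a H.
Proof. by rewrite /ev scale_lfunE. Qed.
Lemma ev0 H : ev 0 H = 0.
Proof. by rewrite /ev zero_lfunE. Qed.
Lemma ev_inj a b : (forall H, H \in h -> ev a H = ev b H) -> a = b.
Proof.
move=> E; apply/lfunP => x; have := E _ (subvsP x).
by rewrite /ev vsvalK.
Qed.

Lemma mem_rootsp a x :
  x \in rootsp br a <-> (forall H, H \in h -> br H x = ev a H *: x).
Proof.
have lin i : linear (fun x : L => br (vbasis h)`_i x - (a (vsproj h (vbasis h)`_i) : F) *: x).
  move=> k u v; rewrite brr scalerDr !scalerBr !scalerA opprD -!scalerA [_ *: (k *: u)]scalerA.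
  by rewrite mulrC -scalerA addrACA.
split=> [|H].
  move/subv_bigcapP => H K KH; rewrite (coord_vbasis KH) -adE !linear_sum /=.
  rewrite sum_lfunE scaler_suml; apply: eq_bigr => i _.
  rewrite !linearZ /= scale_lfunE adE -scalerA; congr (_ *: _).
  have := H i isT; rewrite -memvE memv_ker (linfunE (lin i)) subr_eq0.
  by move/eqP.
apply/subv_bigcapP => i _; rewrite -memvE memv_ker (linfunE (lin i)).
by rewrite subr_eq0 H // vbasis_mem // mem_nth // size_tuple.
Qed.

Definition shift_ad (H : L) (k : F) : 'End(L) := ad H - k *: \1%VF.
Lemma shift_adE H k x : shift_ad H k x = br H x - k *: x.
Proof. by rewrite add_lfunE opp_lfunE scale_lfunE id_lfunE adE. Qed.

Lemma shift_ad_comm H K k l x : H \in h -> K \in h ->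
  shift_ad H k (shift_ad K l x) = shift_ad K l (shift_ad H k x).
Proof.
move=> hH hK; rewrite !shift_adE -!adE !linearB /= !linearZ /= !adE [br H (br K x)]br_der (h_ab hH hK) br0x add0r.
rewrite !scalerA [l * k]mulrC -!addrA; congr (_ + _).
by rewrite addrCA.
Qed.

(** Generalised weight vectors; that they are genuine ones is established only at
    [rootsp_gwspace]. *)
Definition gweight a x := forall H, H \in h -> exists n, iter n (shift_ad H (ev a H)) x = 0.
Definition gwspace a : {vspace L} := vspace_of (gweight a).

Lemma iter_add0 (f : 'End(L)) k x y m n : iter m f x = 0 -> iter n f y = 0 ->
  iter (m + n) f (k *: x + y) = 0.
Proof.
move=> Hx Hy; rewrite iter_lin (iter_le0 (leq_addr _ _) Hx).
by rewrite (iter_le0 (leq_addl _ _) Hy) scaler0 addr0.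
Qed.

Lemma mem_gwspace a x : x \in gwspace a <-> gweight a x.
Proof.
apply: vspace_ofP => [H _|k u v Hu Hv H hH]; first by exists 0%N.
have [m Hm] := Hu H hH; have [n Hn] := Hv H hH; exists (m + n)%N.
exact: iter_add0.
Qed.

Lemma rootsp_sub_gwspace a : (rootsp br a <= gwspace a)%VS.
Proof.
apply/subvP => x /mem_rootsp Hx; apply/mem_gwspace => H hH; exists 1%N.
by rewrite /= shift_adE Hx // subrr.
Qed.

Lemma gwspace_br a b x y : x \in gwspace a -> y \in gwspace b -> br x y \in gwspace (a + b).
Proof.
move=> /mem_gwspace Hx /mem_gwspace Hy; apply/mem_gwspace => H hH.
have [m Hm] := Hx H hH; have [n Hn] := Hy H hH; exists (m + n)%N.
apply: (nil_bilin (B := br) (a := shift_ad H (ev a H)) (b := shift_ad H (ev b H)) _ _ _ _ Hm Hn).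
- by move=> u v; rewrite linearD.
- exact: br0x.
- exact: brx0.
move=> u v; rewrite evD !shift_adE scalerDl opprD br_der.
have -> : br (br H u - ev a H *: u) v = br (br H u) v - ev a H *: br u v.
  by rewrite addrC -scaleNr brl scaleNr addrC.
have -> : br u (br H v - ev b H *: v) = br u (br H v) - ev b H *: br u v.
  by rewrite addrC -scaleNr brr scaleNr addrC.
by rewrite addrACA.
Qed.

Lemma gwspace_op a H k : H \in h -> stab (gwspace a) (shift_ad H k).
Proof.
move=> hH x /mem_gwspace Hx; apply/mem_gwspace => K hK; have [n Hn] := Hx K hK; exists n.
by rewrite iter_comm ?Hn ?linear0 // => y; rewrite shift_ad_comm.
Qed.

Definition hstab (U : {vspace L}) := forall H x, H \in h -> x \in U -> br H x \in U.

Lemma gwspace_hstab a : hstab (gwspace a).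
Proof.
move=> H x hH xU; have := gwspace_op 0 hH xU.
by rewrite shift_adE scale0r subr0.
Qed.

Lemma hstab_op U H k : hstab U -> H \in h -> stab U (shift_ad H k).
Proof. by move=> sU hH x xU; rewrite shift_adE memvB ?memvZ ?sU. Qed.

Lemma h_sub_gwspace0 : (h <= gwspace (0%R : hd))%VS.
Proof.
apply/subvP => x hx; apply/mem_gwspace => H hH; exists 1%N.
by rewrite /= shift_adE ev0 scale0r subr0 h_ab.
Qed.

Lemma iter_scale (f : 'End(L)) t k x : iter k (t *: f) x = t ^+ k *: iter k f x.
Proof.
elim: k => [|k IHk]; first by rewrite expr0 scale1r.
by rewrite !iterS IHk scale_lfunE linearZ /= scalerA exprS.
Qed.

(** Induction on [s]. Choose H with a(H) distinct from b(H); a power of ad H - b(H) removes the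
    component of weight b, and the induction hypothesis then says that it kills x. *)
Lemma gwspace_indep (s : seq hd) a x : a \notin s -> x \in gwspace a ->
  x \in (\sum_(b <- s) gwspace b)%VS -> x = 0.
Proof.
elim: s a x => [|b s IH] a x.
  by rewrite big_nil memv0 => _ _ /eqP.
rewrite inE negb_or => /andP[ab als] xa; rewrite big_cons => /memv_addP[u ub [v vs E]].
have [H hH nE] : exists2 H, H \in h & ev a H != ev b H.
  apply: NNPP => K; case/eqP: ab; apply: ev_inj => H hH; apply/eqP.
  by apply: contra_notT K => K; exists H.
have [n Hn] := (mem_gwspace b u).1 ub H hH.
have [m Hm] := (mem_gwspace a x).1 xa H hH.
set f := shift_ad H (ev b H) in Hn.
have fs : stab (\sum_(c <- s) gwspace c)%VS f.
  rewrite /f => y; elim: (s) y => [|c t IHt] y.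
    by rewrite big_nil memv0 => /eqP->; rewrite linear0 mem0v.
  rewrite big_cons => /memv_addP[y1 h1 [y2 h2 ->]]; rewrite linearD.
  by rewrite memv_add ?gwspace_op ?IHt.
have fx : iter n f x = 0.
  apply: (IH a) => //; first exact: (stab_iter _ (gwspace_op _ _)).
  rewrite E -[u]scale1r iter_lin scale1r Hn add0r; exact: (stab_iter _ fs).
(* Powers of both ad H - a(H) and ad H - b(H) kill x; their difference is a nonzero scalar, which is
   therefore nilpotent on x. *)
have H2 : iter (n + m) ((- (ev a H - ev b H)) *: \1%VF : 'End(L)) x = 0.
  have -> : (- (ev a H - ev b H)) *: \1%VF = - f + shift_ad H (ev a H) :> 'End(L).
    by rewrite /f /shift_ad !opprB addrA subrK scalerBl.
  apply: nilD => //.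
    by move=> y; rewrite !opp_lfunE linearN /f shift_ad_comm.
  have -> : - f = (-1) *: f by rewrite scaleN1r.
  by rewrite iter_scale fx scaler0.
move: H2; have -> k y : iter k ((- (ev a H - ev b H)) *: \1%VF : 'End(L)) y =
     (- (ev a H - ev b H)) ^+ k *: y.
  elim: k => [|k IHk]; first by rewrite expr0 scale1r.
  by rewrite iterS IHk scale_lfunE id_lfunE scalerA exprS.
move/eqP; rewrite scaler_eq0 expf_eq0 oppr_eq0 subr_eq0 (negPf nE) andbF /=.
by move/eqP.
Qed.

Lemma big_addv_sub (I : eqType) (s : seq I) (U : I -> {vspace L}) (V : {vspace L}) :
  (forall i, i \in s -> (U i <= V)%VS) -> (\sum_(i <- s) U i <= V)%VS.
Proof.
move=> H; rewrite big_seq; apply: (big_ind (fun W => (W <= V)%VS)) => //.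
  exact: sub0v.
by move=> A B HA HB; rewrite subv_add HA.
Qed.

Lemma sub_big_addv (I : eqType) (s : seq I) (U : I -> {vspace L}) i :
  i \in s -> (U i <= \sum_(i <- s) U i)%VS.
Proof.
elim: s => // j s IH; rewrite inE big_cons => /predU1P[<-|/IH H]; first exact: addvSl.
exact: subv_trans H (addvSr _ _).
Qed.

Lemma big_addvS (I : Type) (s : seq I) (U V : I -> {vspace L}) :
  (forall i, (U i <= V i)%VS) -> (\sum_(i <- s) U i <= \sum_(i <- s) V i)%VS.
Proof.
by move=> H; apply: (big_ind2 (fun A B => (A <= B)%VS)) => // *; exact: addvS.
Qed.

Lemma nil_sum (I : Type) (s : seq I) (c : I -> F) (f : I -> 'End(L)) x :
  (forall i j y, f i (f j y) = f j (f i y)) -> (forall i, exists n, iter n (f i) x = 0) ->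
  exists n, iter n (\sum_(i <- s) c i *: f i) x = 0.
Proof.
move=> fc nil; elim: s => [|i s [n Hn]].
  by exists 1%N; rewrite big_nil /= zero_lfunE.
have [m Hm] := nil i; exists (m + n)%N; rewrite big_cons nilD //.
  move=> y; rewrite !scale_lfunE !sum_lfunE linear_sum scaler_sumr; apply: eq_bigr => j _.
  by rewrite !scale_lfunE !linearZ /= fc !scalerA mulrC.
by rewrite iter_scale Hm scaler0.
Qed.

(** The hypothesis says that each ad H has a single eigenvalue on [U]. The eigenvalues on a basis of
    h define the weight, and commuting nilpotents handle the other H. *)
Lemma single_weight U : hstab U -> U != 0%VS ->
  (forall H k v, H \in h -> v \in U -> v != 0 -> shift_ad H k v = 0 ->
     forall x, x \in U -> exists n, iter n (shift_ad H k) x = 0) ->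
  exists a, (U <= gwspace a)%VS /\ exists2 v, v != 0 & v \in (U :&: rootsp br a)%VS.
Proof.
move=> sU U0 nilU.
have eig i : exists k : F, forall x, x \in U -> exists n, iter n (shift_ad (vbasis h)`_i k) x = 0.
  have hi : (vbasis h)`_i \in h.
    have [lti|gei] := ltnP i (size (vbasis h)); last by rewrite nth_default ?mem0v.
    by rewrite vbasis_mem ?mem_nth.
  have [|k [v [vU v0 Ev]]] := @stab_eigenvector _ _ U (ad (vbasis h)`_i) _ U0.
    by move=> x xU; rewrite adE sU.
  exists k; apply: (nilU _ _ v) => //.
  by rewrite shift_adE -adE Ev subrr.
pose k i := epsilon (inhabits 0) (fun k : F =>
  forall x, x \in U -> exists n, iter n (shift_ad (vbasis h)`_i k) x = 0).
have kP i x : x \in U -> exists n, iter n (shift_ad (vbasis h)`_i (k i)) x = 0.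
  exact: (epsilon_spec (inhabits 0) _ (eig i)).
pose f (w : subvs_of h) : F^o := \sum_(i < \dim h) coord (vbasis h) i (vsval w) * k i.
have flin : linear f.
  move=> t u v; rewrite /f scaler_sumr -big_split /=; apply: eq_bigr => i _.
  by rewrite linearP mulrDl -mulrA.
pose a : hd := linfun f.
have aE H : H \in h -> ev a H = \sum_(i < \dim h) coord (vbasis h) i H * k i.
  by move=> hH; rewrite /ev (linfunE flin) /f vsprojK.
have hb (i : 'I_(\dim h)) : (vbasis h)`_i \in h by rewrite vbasis_mem // mem_nth // size_tuple.
have ab (i : 'I_(\dim h)) : ev a (vbasis h)`_i = k i :> F.
  rewrite aE // (bigD1 i) //= coord_free ?(basis_free (vbasisP h)) // eqxx mul1r.
  rewrite big1 ?addr0 // => j ji.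
  by rewrite coord_free ?(basis_free (vbasisP h)) // eq_sym (negPf ji) mul0r.
exists a; split.
  apply/subvP => x xU; apply/mem_gwspace => H hH.
  have -> : shift_ad H (ev a H) = \sum_(i < \dim h) coord (vbasis h) i H *: shift_ad (vbasis h)`_i (k i).
    rewrite {1}(coord_vbasis hH) /shift_ad linear_sum aE // scaler_suml -sumrB.
    by apply: eq_bigr => i _; rewrite linearZ /= scalerBr scalerA.
  by apply: nil_sum => [i j y|i]; [rewrite shift_ad_comm | exact: kP].
(* Engel's argument relative to the zero subspace gives a common eigenvector, so that the weight has
   a nonzero [rootsp]. *)
pose fs := [seq shift_ad (vbasis h)`_i (k i) | i <- iota 0 (\dim h)].
have fsP g : g \in fs -> exists2 i : 'I_(\dim h), g = shift_ad (vbasis h)`_i (k i) & true.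
  case/mapP => i; rewrite mem_iota /= add0n => lti ->.
  by exists (Ordinal lti).
have [| | | | | v [vU v0 Hv]] := @comm_engel _ _ fs 0%VS U.
- exact: sub0v.
- by rewrite eq_sym.
- move=> g /fsP[i -> _]; split; last exact: hstab_op.
  by move=> x; rewrite memv0 => /eqP->; rewrite linear0 mem0v.
- by move=> g g' x /fsP[i -> _] /fsP[j -> _]; rewrite shift_ad_comm.
- by move=> g x /fsP[i -> _]; exact: kP.
exists v; first by rewrite memv0 in v0.
rewrite memv_cap vU; apply/mem_rootsp => H hH.
rewrite {1}(coord_vbasis hH) aE // -adE linear_sum sum_lfunE scaler_suml.
apply: eq_bigr => i _; rewrite linearZ scale_lfunE /= adE -scalerA; congr (_ *: _).
have := Hv (shift_ad (vbasis h)`_i (k i)); rewrite shift_adE memv0 subr_eq0 => E; apply/eqP/E.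
by apply/mapP; exists (val i); rewrite // mem_iota add0n ltn_ord.
Qed.

(** Induction on the dimension. If [single_weight] fails, some ad H - k has an eigenvector v for 0
    and is not nilpotent on [U]; its Fitting components are h-stable, and both are proper since the
    image misses v. *)
Lemma gwspace_decomp (Ws : seq hd) U : (forall a, rootsp br a != 0%VS -> a \in Ws) ->
  hstab U -> (U <= \sum_(a <- Ws) (U :&: gwspace a))%VS.
Proof.
move=> HW; have [n] := ubnP (\dim U); elim: n U => // n IH U ltn sU.
have [->|U0] := eqVneq U 0%VS; first exact: sub0v.
have [nil|] := classic (forall H k v, H \in h -> v \in U -> v != 0 -> shift_ad H k v = 0 ->
     forall x, x \in U -> exists n, iter n (shift_ad H k) x = 0).
  have [a [Ua [v v0]]] := single_weight sU U0 nil.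
  rewrite memv_cap => /andP[vU va].
  have aW : a \in Ws by apply: HW; apply: contra v0 => /eqP E; rewrite -memv0 -E.
  apply: subv_trans (sub_big_addv (fun a => U :&: gwspace a)%VS aW).
  by rewrite subv_cap subvv.
move=> nnil.
have [H [k [v [hH [vU v0 Hv] [x xU nx]]]]] : exists H k v, [/\ H \in h, [/\ v \in U, v != 0 & shift_ad H k v = 0] &
    exists2 x, x \in U & forall n, iter n (shift_ad H k) x <> 0].
  apply: NNPP => K; apply: nnil => H k v hH vU v0 Hv x xU.
  apply: NNPP => K2; apply: K; exists H, k, v; split=> //; exists x => // n' E.
  by apply: K2; exists n'.
set f := shift_ad H k in Hv nx.
have [m [inj dec]] := fitting (hstab_op k sU hH).
pose K := vspace_of (fun x => iter m.+1 f x = 0).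
have KP y : y \in K <-> iter m.+1 f y = 0.
  apply: vspace_ofP => [|t u w Hu Hw]; first exact: iter_lin0.
  by rewrite iter_lin Hu Hw scaler0 addr0.
pose I := vspace_of (fun x => exists2 y, y \in U & x = iter m.+1 f y).
have IP y : y \in I <-> exists2 z, z \in U & y = iter m.+1 f z.
  apply: vspace_ofP => [|t u w [p pU ->] [q qU ->]].
    by exists 0; rewrite ?mem0v // iter_lin0.
  by exists (t *: p + q); rewrite ?memvD ?memvZ // iter_lin.
have fU : stab U f by exact: hstab_op.
have IU : (I <= U)%VS by apply/subvP => y /IP[z zU ->]; exact: stab_iter.
have UKI : (U <= (U :&: K) + I)%VS.
  apply/subvP => y yU; have [z [zU E]] := dec y yU.
  rewrite -[y](subrK (iter m.+1 f z)) memv_add //; last by apply/IP; exists z.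
  by rewrite memv_cap memvB ?stab_iter //=; apply/KP.
have op0 G y : G \in h -> br G y = shift_ad G 0 y by move=> _; rewrite shift_adE scale0r subr0.
have it G y : G \in h -> iter m.+1 f (br G y) = br G (iter m.+1 f y).
  by move=> hG; rewrite !op0 // iter_comm // => w; rewrite shift_ad_comm.
have sK : hstab (U :&: K)%VS.
  move=> G y hG; rewrite !memv_cap => /andP[yU /KP yK]; rewrite sU //=.
  by apply/KP; rewrite it // yK brx0.
have sI : hstab I.
  move=> G y hG /IP[z zU ->]; apply/IP; exists (br G z); first exact: sU.
  by rewrite it.
have ltK : (\dim (U :&: K) < \dim U)%N.
  rewrite ltn_neqAle dimvS ?capvSl // andbT; apply/negP => /eqP E.
  have /eqP UK : (U :&: K == U)%VS by rewrite eqEdim capvSl E leqnn.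
  by apply: (nx m.+1); apply/KP; move: xU; rewrite -{1}UK memv_cap => /andP[].
have ltI : (\dim I < \dim U)%N.
  rewrite ltn_neqAle dimvS // andbT; apply/negP => /eqP E.
  have /eqP UI : (I == U)%VS by rewrite eqEdim IU E leqnn.
  have : v \in I by rewrite UI.
  case/IP => z zU vE; case/eqP: v0; rewrite vE; apply: inj => //.
  by rewrite -vE iterSr Hv iter_lin0.
apply: subv_trans UKI _; rewrite subv_add; apply/andP; split.
  apply: subv_trans (IH _ _ sK) _; first by rewrite -ltnS (leq_trans _ ltn).
  by apply: big_addvS => a; rewrite capvS ?capvSl.
apply: subv_trans (IH _ _ sI) _; first by rewrite -ltnS (leq_trans _ ltn).
by apply: big_addvS => a; rewrite capvS.
Qed.

(** * The Killing form and coroots *)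

Section Semisimple.
Hypothesis char0 : [pchar F] =i pred0.
Hypothesis no_abelian : forall I : {vspace L}, is_ideal br I ->
  (forall x y, x \in I -> y \in I -> br x y = 0) -> I = 0%VS.
Hypothesis h_norm : forall x, (forall y, y \in h -> br x y \in h) -> x \in h.
Variable Ws : seq hd.
Hypothesis Ws_uniq : uniq Ws.
Hypothesis WsE : forall a, (a \in Ws) = (a == 0) || (rootsp br a != 0%VS).
Hypothesis sep : forall H, H \in h -> (forall a, a \in Ws -> ev a H = 0) -> H = 0.

Lemma gwspace_decomp_Ws U : hstab U -> (U <= \sum_(a <- Ws) (U :&: gwspace a))%VS.
Proof. by apply: gwspace_decomp => a a0; rewrite WsE a0 orbT. Qed.

Lemma gwspace_full : (\sum_(a <- Ws) gwspace a)%VS = fullv.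
Proof.
apply/eqP; rewrite eqEsubv subvf /=.
have := @gwspace_decomp_Ws fullv (fun _ _ _ _ => memvf _).
by under eq_bigr do rewrite capfv.
Qed.

Lemma gwspace_out a x : x \in gwspace a -> x != 0 -> a \in Ws.
Proof.
move=> xa; apply: contraR => aW; apply/eqP; apply: (gwspace_indep aW) => //.
by rewrite gwspace_full memvf.
Qed.

Lemma gwspace_disj a b x : a != b -> x \in gwspace a -> x \in gwspace b -> x = 0.
Proof.
move=> ab xa xb; apply: (@gwspace_indep [:: b] a) => //; first by rewrite inE.
by rewrite big_seq1.
Qed.

Lemma mem_big_addv_ind (I : eqType) (s : seq I) (U : I -> {vspace L}) (P : L -> Prop) :
  P 0 -> (forall x y, P x -> P y -> P (x + y)) ->
  (forall i x, i \in s -> x \in U i -> P x) ->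
  forall x, x \in (\sum_(i <- s) U i)%VS -> P x.
Proof.
move=> P0 PD; elim: s => [|i s IH] H x.
  by rewrite big_nil memv0 => /eqP->.
rewrite big_cons => /memv_addP[u ui [v vs ->]]; apply: PD.
  by apply: (H i); rewrite ?mem_head.
by apply: IH => // j y js; apply: H; rewrite inE js orbT.
Qed.

Lemma full_ind (P : L -> Prop) :
  P 0 -> (forall x y, P x -> P y -> P (x + y)) ->
  (forall a x, a \in Ws -> x \in gwspace a -> P x) -> forall x, P x.
Proof.
move=> P0 PD PL x; apply: (mem_big_addv_ind (s := Ws) (U := gwspace)) => //.
by rewrite gwspace_full memvf.
Qed.

(** A weight vector of the quotient of [B] by its part in [A], lifted to a homogeneous element:
    Engel's argument inside one weight component of [B] not contained in [A]. *)
Lemma relative_weight A B : hstab A -> hstab B -> ~~ (B <= A)%VS ->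
  exists a v, [/\ v \in B, v \in gwspace a, v \notin A &
    forall H, H \in h -> shift_ad H (ev a H) v \in A].
Proof.
move=> sA sB nBA.
have [a aW] : exists2 a, a \in Ws & ~~ (B :&: gwspace a <= A)%VS.
  apply: NNPP => K; case/negP: nBA; apply: subv_trans (gwspace_decomp_Ws sB) _.
  apply: big_addv_sub => a aW; apply/negPn/negP => K2; apply: K; by exists a.
move=> nA; pose fs := [seq shift_ad (vbasis h)`_i (ev a (vbasis h)`_i) | i <- iota 0 (\dim h)].
have fsP g : g \in fs -> exists2 H, H \in h & g = shift_ad H (ev a H).
  case/mapP => i; rewrite mem_iota /= add0n => lti ->; exists (vbasis h)`_i => //.
  by rewrite vbasis_mem // mem_nth // size_tuple.
have [| | | | | v [vB vA Hv]] := @comm_engel _ _ fs (A :&: (B :&: gwspace a))%VS (B :&: gwspace a)%VS.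
- exact: capvSr.
- by apply: contra nA => /eqP <-; exact: capvSl.
- move=> g /fsP[H hH ->].
  have st : stab (B :&: gwspace a)%VS (shift_ad H (ev a H)).
    by move=> x; rewrite !memv_cap => /andP[xB xa]; rewrite hstab_op // gwspace_op.
  split=> // x /memv_capP[xA xB]; apply/memv_capP.
  by split; [exact: hstab_op | exact: st].
- by move=> g g' x /fsP[H hH ->] /fsP[K hK ->]; rewrite shift_ad_comm.
- move=> g x /fsP[H hH ->]; rewrite memv_cap => /andP[_ /mem_gwspace]; exact.
move: (vB); rewrite memv_cap => /andP[vB' va]; exists a, v; split=> //.
  by apply: contra vA => vA; rewrite memv_cap vA.
move=> H hH; have -> : shift_ad H (ev a H) v = \sum_(i < \dim h) coord (vbasis h) i H *: shift_ad (vbasis h)`_i (ev a (vbasis h)`_i) v.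
  rewrite shift_adE -adE {1 2}(coord_vbasis hH) !linear_sum sum_lfunE scaler_suml -sumrB.
  apply: eq_bigr => i _.
  by rewrite !linearZ /= scale_lfunE adE shift_adE scalerBr scalerA scalerN.
apply: memv_suml => i _; rewrite memvZ //.
have := Hv (shift_ad (vbasis h)`_i (ev a (vbasis h)`_i)); rewrite memv_cap => K.
have /K/andP[] // : shift_ad (vbasis h)`_i (ev a (vbasis h)`_i) \in fs.
by apply/mapP; exists (val i); rewrite // mem_iota add0n ltn_ord.
Qed.

Lemma h_hstab : hstab h.
Proof. by move=> H x hH hx; rewrite h_ab ?mem0v. Qed.

(** Otherwise [relative_weight] over h gives a vector outside h of weight 0 that normalises h,
    against self-normalisation. *)
Lemma gwspace0 : gwspace 0%R = h.
Proof.
apply/eqP; rewrite eqEsubv h_sub_gwspace0 andbT; apply/negPn/negP => nh.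
have [a [v [v0 va vh Hv]]] := relative_weight h_hstab (@gwspace_hstab 0) nh.
have vn0 : v != 0 by apply: contraNneq vh => ->; rewrite mem0v.
have a0 : a = 0 by apply/eqP; apply: contraNT vn0 => a0; apply/eqP; exact: (gwspace_disj a0).
case/negP: vh; apply: h_norm => H hH; rewrite brC memvN.
by have := Hv H hH; rewrite a0 shift_adE ev0 scale0r subr0.
Qed.

Definition kappa (x y : L) : F := lftrace (ad x \o ad y)%VF.

Lemma kappaC x y : kappa x y = kappa y x. Proof. exact: lftraceC. Qed.

Lemma kappa_linear x : linear_for *%R (kappa x).
Proof. by move=> k u v; rewrite /kappa linearP comp_lfunDr -comp_lfunZr linearP. Qed.
HB.instance Definition _ x := GRing.isLinear.Build F _ _ _ (kappa x) (kappa_linear x).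

Lemma kappaDl x y z : kappa (x + y) z = kappa x z + kappa y z.
Proof. by rewrite ![kappa _ z]kappaC linearD. Qed.
Lemma kappaZl k x z : kappa (k *: x) z = k * kappa x z.
Proof. by rewrite ![kappa _ z]kappaC linearZ. Qed.
Lemma kappaNl x z : kappa (- x) z = - kappa x z.
Proof. by rewrite ![kappa _ z]kappaC linearN. Qed.
Lemma kappa0l z : kappa 0 z = 0.
Proof. by rewrite kappaC linear0. Qed.

Lemma kappa_inv x y z : kappa (br x y) z = kappa x (br y z).
Proof.
rewrite /kappa !ad_br comp_lfunDl comp_lfunDr comp_lfunNl comp_lfunNr !linearB /=.
congr (_ - _); first by rewrite comp_lfunA.
by rewrite -comp_lfunA lftraceC -comp_lfunA.
Qed.

(** By invariance of kappa the two shifts of ad H combine into multiplication by -(a + b)(H), which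
    [nil_bilin] makes nilpotent on kappa(x, y). *)
Lemma kappa_orth a b x y : a + b != 0 -> x \in gwspace a -> y \in gwspace b -> kappa x y = 0.
Proof.
move=> ab /mem_gwspace Hx /mem_gwspace Hy.
have [H hH nE] : exists2 H, H \in h & ev (a + b) H != 0.
  apply: NNPP => K; case/eqP: ab; apply: ev_inj => H hH; rewrite ev0; apply/eqP.
  by apply: contra_notT K => K; exists H.
have [m Hm] := Hx H hH; have [n Hn] := Hy H hH.
have := nil_bilin (B := kappa) (a := shift_ad H (ev a H)) (b := shift_ad H (ev b H))
  (c := fun z => - ev (a + b) H * z) _ _ _ _ Hm Hn.
have -> k z : iter k (fun z => - ev (a + b) H * z) z = (- ev (a + b) H) ^+ k * z.
  elim: k => [|k IHk]; first by rewrite expr0 mul1r.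
  by rewrite iterS IHk exprS mulrA.
move=> K; apply/eqP; have /eqP : (- ev (a + b) H) ^+ (m + n) * kappa x y = 0.
  apply: K => [u v|u|u|u v]; rewrite ?mulrDr ?kappa0l ?linear0 //.
  rewrite !shift_adE kappaDl kappaNl kappaZl [kappa u (_ - _)]linearB /= [kappa u (_ *: _)]linearZ /=.
  rewrite [br H u]brC kappaNl kappa_inv evD mulNr mulrDl opprD.
  by rewrite addrACA addNr add0r.
by rewrite mulf_eq0 expf_eq0 oppr_eq0 (negPf nE) andbF.
Qed.

Lemma big_addv_img (I : eqType) (s : seq I) (U : I -> {vspace L}) (f : 'End(L)) (W : {vspace L}) :
  (forall i x, i \in s -> x \in U i -> f x \in W) ->
  forall x, x \in (\sum_(i <- s) U i)%VS -> f x \in W.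
Proof.
move=> H; apply: (mem_big_addv_ind (P := fun x => f x \in W)) => //.
  by rewrite linear0 mem0v.
by move=> u v Hu Hv; rewrite linearD memvD.
Qed.

Lemma trace_on0 (f : 'End(L)) : trace_on 0%VS f = 0.
Proof.
apply: trace_on_nilp => x; rewrite memv0 => /eqP->; last by exists 0%N.
by rewrite linear0 mem0v.
Qed.

Lemma trace_on_big (s : seq hd) (U : hd -> {vspace L}) H : uniq s -> H \in h ->
  (forall a, hstab (U a)) -> (forall a, (U a <= gwspace a)%VS) ->
  trace_on (\sum_(a <- s) U a)%VS (ad H) = \sum_(a <- s) ev a H * (\dim (U a))%:R.
Proof.
move=> us hH sU UL; elim: s us => [|a s IH] /=; first by rewrite !big_nil trace_on0.
case/andP=> als us; rewrite !big_cons -IH // trace_onD.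
- congr (_ + _); apply: trace_on_const => [x xU|x xU]; first by rewrite adE sU.
  exact: ((mem_gwspace a x).1 (subvP (UL a) x xU) H hH).
- by move=> x xU; rewrite adE sU.
- apply: big_addv_img => b u bs ub.
  by rewrite adE (subvP (sub_big_addv U bs)) // sU.
apply/eqP; rewrite -subv0; apply/subvP => x; rewrite memv_cap memv0 => /andP[xa xs].
apply/eqP; apply: (gwspace_indep als); first exact: (subvP (UL a)).
by apply: subvP xs; apply: big_addvS.
Qed.

Lemma trace_comm (s : seq hd) (U : hd -> {vspace L}) x y : uniq s -> br x y \in h ->
  (forall a, hstab (U a)) -> (forall a, (U a <= gwspace a)%VS) ->
  stab (\sum_(a <- s) U a)%VS (ad x) -> stab (\sum_(a <- s) U a)%VS (ad y) ->
  \sum_(a <- s) ev a (br x y) * (\dim (U a))%:R = 0.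
Proof.
move=> us hH sU UL sx sy; rewrite -trace_on_big // ad_br linearB /= trace_on_comm //.
exact: subrr.
Qed.

Lemma stab_filter (P : pred hd) c x : x \in gwspace c ->
  (forall a, a \in Ws -> P a -> a + c \in Ws -> P (a + c)) ->
  stab (\sum_(a <- filter P Ws) gwspace a)%VS (ad x).
Proof.
move=> xc HP; apply: big_addv_img => b u.
rewrite mem_filter => /andP[Pb bW] ub; rewrite adE brC memvN.
have : br u x \in gwspace (b + c) by apply: gwspace_br.
have [->|n0 H] := eqVneq (br u x) 0; first by move=> _; rewrite mem0v.
have bcW := gwspace_out H n0.
have m : b + c \in filter P Ws by rewrite mem_filter bcW andbT HP.
exact: (subvP (sub_big_addv gwspace m)).
Qed.

(** [P] selects a set of weights closed under adding and subtracting c within [Ws], so that its sum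
    is stable under ad x and ad y. *)
Lemma trace_filter (P : pred hd) c x y : x \in gwspace c -> y \in gwspace (- c) ->
  (forall a, a \in Ws -> P a -> a + c \in Ws -> P (a + c)) ->
  (forall a, a \in Ws -> P a -> a - c \in Ws -> P (a - c)) ->
  \sum_(a <- Ws | P a) ev a (br x y) * (\dim (gwspace a))%:R = 0.
Proof.
move=> xc yc H1 H2; rewrite -big_filter; apply: trace_comm.
- exact: filter_uniq.
- by rewrite -gwspace0 -(subrr c) gwspace_br.
- exact: gwspace_hstab.
- by [].
- exact: stab_filter H1.
- exact: stab_filter H2.
Qed.

Lemma evMz a (k : int) H : ev (k%:~R *: a) H = k%:~R * ev a H.
Proof. exact: evZ. Qed.

(* [br x y] acts with trace 0 on the sum of the weight spaces of weight b + k c, k an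
   integer. *)
Lemma ratio c x y b : x \in gwspace c -> y \in gwspace (- c) -> b \in Ws ->
  exists2 r, is_rat r & ev b (br x y) = r * ev c (br x y).
Proof.
move=> xc yc bW; set H := br x y.
have [b0|b0] := eqVneq b 0.
  by exists 0; [exact: (is_rat_nat F 0) | rewrite b0 ev0 mul0r].
pose Q a (k : int) := a = b + k%:~R *: c.
pose P a := asb (exists k, Q a k).
have Pb : P b by apply/asbP; exists 0; rewrite /Q scale0r addr0.
pose k a := epsilon (inhabits 0) (Q a).
have kP a : P a -> a = b + (k a)%:~R *: c.
  by move/asbP => Qa; exact: (epsilon_spec (inhabits 0) _ Qa).
have tr0 : \sum_(a <- Ws | P a) ev a H * (\dim (gwspace a))%:R = 0.
  apply: trace_filter xc yc _ _ => a _ Pa _; apply/asbP.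
    by exists (k a + 1); rewrite /Q {1}(kP a Pa) -addrA rmorphD scalerDl scale1r.
  by exists (k a - 1); rewrite /Q {1}(kP a Pa) -addrA rmorphB scalerBl scale1r.
pose D := (\sum_(a <- Ws | P a) \dim (gwspace a))%N.
pose E : F := \sum_(a <- Ws | P a) (k a)%:~R * (\dim (gwspace a))%:R.
(* The vanishing trace with each weight of the string written as b + k c. *)
have ED : ev b H * D%:R + E * ev c H = 0.
  rewrite -tr0 /D /E natr_sum mulr_sumr mulr_suml -big_split /=.
  apply: eq_bigr => a Pa; rewrite [in ev a](kP a Pa) evD evMz mulrDl; congr (_ + _).
  by rewrite mulrAC.
have D0 : (D%:R : F) != 0.
  rewrite natF_eq0 // -lt0n /D (big_rem b) //= Pb addn_gt0 lt0n dimv_eq0.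
  apply/orP; left; move: bW; rewrite WsE (negPf b0) /=; apply: contra => /eqP E0.
  by rewrite -subv0 -E0 rootsp_sub_gwspace.
exists (- E / D%:R).
  apply: is_ratM; last by apply: is_ratV => //; exact: is_rat_nat.
  rewrite -mulN1r; apply: is_ratM; first exact: (is_rat_int F (-1)).
  by apply: is_rat_sum => a _; apply: is_ratM; [exact: is_rat_int | exact: is_rat_nat].
by rewrite mulrAC -[ev b H](mulfK D0) mulNr; congr (_ / _); apply/eqP; rewrite -addr_eq0 ED.
Qed.

Lemma dim_gwspace_gt0 a : a \in Ws -> a != 0 -> (0 < \dim (gwspace a))%N.
Proof.
move=> aW a0; rewrite lt0n dimv_eq0; move: aW; rewrite WsE (negPf a0) /=; apply: contra => /eqP E0.
by rewrite -subv0 -E0 rootsp_sub_gwspace.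
Qed.

Lemma kappa_h H : H \in h -> kappa H H = \sum_(a <- Ws) ev a H ^+ 2 * (\dim (gwspace a))%:R.
Proof.
move=> hH; rewrite /kappa -trace_on_full -gwspace_full; set f := (_ \o _)%VF.
have st a : stab (gwspace a) f by move=> x xa; rewrite comp_lfunE !adE !gwspace_hstab.
elim: Ws Ws_uniq => [|a s IH] /=; first by rewrite !big_nil trace_on0.
case/andP=> als us; rewrite !big_cons -IH // trace_onD //.
- congr (_ + _); apply: trace_on_const => // x xa.
  have [n Hn] := (mem_gwspace a x).1 xa H hH; exists n.
  pose g := shift_ad H (- ev a H).
  have -> : f - ev a H ^+ 2 *: \1%VF = (g \o shift_ad H (ev a H))%VF.
    apply/lfunP => y; rewrite add_lfunE opp_lfunE scale_lfunE id_lfunE !comp_lfunE !shift_adE.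
    rewrite !adE scaleNr opprK scalerBr scalerA -expr2 -!adE linearB /= -scalerA.
    by rewrite [ad H (_ *: _)]linearZ /= addrA subrK.
  have gc y : g (shift_ad H (ev a H) y) = shift_ad H (ev a H) (g y) by rewrite /g shift_ad_comm.
  have -> : iter n (g \o shift_ad H (ev a H))%VF x = iter n g (iter n (shift_ad H (ev a H)) x).
    elim: n {Hn} => // n IHn; rewrite iterS IHn comp_lfunE [in RHS]iterS [iter n.+1 (shift_ad _ _) x]iterS.
    by rewrite -iter_comm.
  by rewrite Hn iter_lin0.
- apply: big_addv_img => b u bs ub.
  by rewrite (subvP (sub_big_addv gwspace bs)) // st.
apply/eqP; rewrite -subv0; apply/subvP => x; rewrite memv_cap memv0 => /andP[xa xs].
by apply/eqP; apply: (gwspace_indep als).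
Qed.

(** Put H = [x, y]. If c(H) were nonzero, dividing kappa(H, H) by its square would give, by [ratio],
    a vanishing sum of nonnegative rationals whose term at c is positive. So c(H) = 0, every weight
    vanishes at H, and weights separate h. *)
Lemma isotropic_eq0 c x y : x \in gwspace c -> y \in gwspace (- c) ->
  kappa (br x y) (br x y) = 0 -> br x y = 0.
Proof.
move=> xc yc; have hH : br x y \in h by rewrite -gwspace0 -(subrr c) gwspace_br.
have [->|x0] := eqVneq x 0; first by rewrite br0x.
have cW := gwspace_out xc x0; rewrite kappa_h // => K.
have [c0|c0] := eqVneq c 0.
  by move: xc yc; rewrite c0 oppr0 gwspace0; exact: h_ab.
have cH : ev c (br x y) = 0.
  apply/eqP; apply/negPn/negP => nz.
  pose r a := ev a (br x y) / ev c (br x y).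
  have rQ a : a \in Ws -> is_rat (r a).
    by move=> aW; have [q qQ E] := ratio xc yc aW; rewrite /r E mulfK.
  pose r' a := if a \in Ws then r a else 0.
  have : \sum_(a <- Ws) r' a ^+ 2 * (\dim (gwspace a))%:R = 0.
    apply: (mulfI (_ : ev c (br x y) ^+ 2 != 0)); first by rewrite expf_eq0 /=.
    rewrite mulr0 -[RHS]K mulr_sumr; apply: eq_big_seq => a aW.
    by rewrite /r' aW mulrA -exprMn /r mulrCA divff // mulr1.
  have N a : is_nneg_rat (r' a ^+ 2 * (\dim (gwspace a))%:R).
    apply: is_nneg_ratM; last exact: is_nneg_rat_nat.
    by apply: is_rat_sqr; rewrite /r'; case: ifP => [/rQ //|_]; exact: (is_rat_nat F 0).
  move/(is_nneg_rat_sum_eq0 char0 N)/(_ c cW)/eqP.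
  rewrite /r' cW /r divff // expr1n mul1r natF_eq0 // => /eqP E.
  by have := dim_gwspace_gt0 cW c0; rewrite E.
apply: sep => // a aW; have [q _ ->] := ratio xc yc aW.
by rewrite cH mulr0.
Qed.

(** * Engel's theorem for ideals without zero weight, and non-degeneracy of the Killing form *)

Lemma ad_nilp a x : a != 0 -> x \in gwspace a -> forall y, exists n, iter n (ad x) y = 0.
Proof.
move=> a0 xa; apply: full_ind => [|u v [m Hm] [n Hn]|b y bW yb].
- by exists 0%N.
- by exists (m + n)%N; rewrite -[u]scale1r iter_add0.
have it n : iter n (ad x) y \in gwspace (b + n%:R *: a).
  elim: n => [|n IH]; first by rewrite scale0r addr0.
  by rewrite iterS adE -natr1 scalerDl scale1r addrA [_ + a]addrC gwspace_br.
apply: NNPP => K.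
have inW n : b + n%:R *: a \in Ws.
  by apply: (gwspace_out (it n)); apply/eqP => E; apply: K; exists n.
pose f (i : 'I_(size Ws).+1) := b + (i%:R : F) *: a.
have : injective f.
  move=> i j /addrI /eqP; rewrite -subr_eq0 -scalerBl scaler_eq0 (negPf a0) orbF.
  by rewrite subr_eq0 => /eqP /(natF_inj char0) /val_inj.
move=> finj; have : (size [seq f i | i : 'I_(size Ws).+1] <= size Ws)%N.
  apply: uniq_leq_size; first by rewrite map_inj_uniq // enum_uniq.
  by move=> _ /mapP[i _ ->]; exact: inW.
by rewrite size_map -cardE card_ord ltnn.
Qed.

(** Engel's conclusion for all subquotients B/A at once, so that it applies to an ideal modulo a
    subalgebra. *)
Definition acts_nilp (U : {vspace L}) := forall A B : {vspace L}, (A <= B)%VS -> A != B ->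
  (forall u x, u \in U -> x \in A -> br u x \in A) ->
  (forall u x, u \in U -> x \in B -> br u x \in B) ->
  exists v, [/\ v \in B, v \notin A & forall u, u \in U -> br u v \in A].

(** The vectors of [B] sent into [A] by [U] are stable under x, which normalises [U]; nilpotency of
    ad x finishes by [engel_step]. *)
Lemma acts_nilpS U a x : acts_nilp U -> a != 0 -> x \in gwspace a ->
  (forall u, u \in U -> br u x \in U) -> acts_nilp (U + <[x]>)%VS.
Proof.
move=> nU a0 xa Ux A B AB nAB sA sB.
have UU u : u \in U -> u \in (U + <[x]>)%VS by exact: (subvP (addvSl _ _)).
have xU : x \in (U + <[x]>)%VS by rewrite (subvP (addvSr _ _)) // memv_line.
have [| |v [vB vA Hv]] := nU A B AB nAB.
- by move=> u w /UU; exact: sA.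
- by move=> u w /UU; exact: sB.
pose C w := w \in B /\ forall u, u \in U -> br u w \in A.
have [n Hn] := ad_nilp a0 xa v.
have [| |w [[wB Cw] wA Hw]] := @engel_step _ _ C (ad x) A v n _ vA Hn.
- by [].
- move=> w [wB Cw]; rewrite adE; split; first exact: sB.
  by move=> u uU; rewrite br_der memvD ?Cw ?Ux // sA // Cw.
exists w; split=> // _ /memv_addP[u uU [_ /vlineP[k ->] ->]].
rewrite -adE linearD add_lfunE linearZ scale_lfunE memvD ?memvZ //= adE.
exact: Cw.
Qed.

(* Engel's argument, run on ad-nilpotent homogeneous elements. *)
Lemma acts_nilp_ideal (J : {vspace L}) : is_ideal br J -> hstab J ->
  (forall x, x \in J -> x \in gwspace 0%R -> x = 0) -> acts_nilp J.
Proof.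
move=> idJ sJ J0.
pose good (U : {vspace L}) := [/\ (U <= J)%VS, hstab U,
  forall u v, u \in U -> v \in U -> br u v \in U & acts_nilp U].
(* The dimension of a good subalgebra is pushed up until it is all of [J]; taking n beyond the
   dimension of [J] excludes the first alternative. *)
have step n : (exists2 U, good U & (n <= \dim U)%N) \/ acts_nilp J.
  elim: n => [|n [[U [UJ sU bU nU] dU]|]]; last by right.
    left; exists 0%VS => //; split.
    - exact: sub0v.
    - by move=> H x _; rewrite memv0 => /eqP->; rewrite brx0 mem0v.
    - by move=> u v; rewrite memv0 => /eqP-> _; rewrite br0x mem0v.
    move=> A B AB nAB _ _.
    have : ~~ (B <= A)%VS by apply: contra nAB => BA; rewrite eqEsubv AB.
    case/subvPn => v vB vA; exists v; split=> // u.
    by rewrite memv0 => /eqP->; rewrite br0x mem0v.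
  have [EU|nE] := eqVneq U J; first by right; rewrite -EU.
  left.
  have [| |v [vJ vU Hv]] := nU U J UJ nE.
  - by move=> u x uU xU; exact: bU.
  - by move=> u x uU xJ; exact: idJ.
  (* The normaliser of [U] in [J]: Engel for [U] on J/U shows that it is strictly larger, and a
     homogeneous element of it extends [U]. *)
  pose N := vspace_of (fun x => x \in J /\ forall u, u \in U -> br u x \in U).
  have NP x : x \in N <-> x \in J /\ forall u, u \in U -> br u x \in U.
    apply: vspace_ofP => [|k y z [yJ Hy] [zJ Hz]].
      by split; [exact: mem0v | move=> u _; rewrite brx0 mem0v].
    split=> [|u uU]; first by rewrite memvD ?memvZ.
    by rewrite brr memvD ?memvZ ?Hy ?Hz.
  have sN : hstab N.
    move=> H x hH /NP[xJ Hx]; apply/NP; split=> [|u uU]; first exact: sJ.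
    rewrite br_der; apply: memvD; last by apply: sU => //; exact: Hx.
    by apply: Hx; rewrite brC memvN sU.
  have [|a [x [xN xa xU Hx]]] := relative_weight sU sN _.
    by apply/subvPn; exists v => //; apply/NP.
  have [xJ Ux] := (NP x).1 xN.
  have a0 : a != 0.
    by apply: contraNneq xU => a0; rewrite (J0 x) ?mem0v // -a0.
  exists (U + <[x]>)%VS; last first.
    apply: leq_ltn_trans dU _; rewrite ltn_neqAle dimvS ?addvSl // andbT.
    apply: contra xU => /eqP E; have /eqP -> : (U == U + <[x]>)%VS by rewrite eqEdim addvSl E leqnn.
    by rewrite (subvP (addvSr _ _)) // memv_line.
  split.
  - by rewrite subv_add UJ /= -memvE.
  - move=> H _ hH /memv_addP[u uU [_ /vlineP[k ->] ->]].
    have -> : br H (u + k *: x) = (br H u + k *: shift_ad H (ev a H) x) + (k * ev a H) *: x.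
      rewrite shift_adE scalerBr scalerA addrA subrK -!adE linearD linearZ //.
    by rewrite memv_add ?memvD ?memvZ ?sU ?Hx ?memv_line.
  - move=> _ _ /memv_addP[u uU [_ /vlineP[k ->] ->]] /memv_addP[w wU [_ /vlineP[l ->] ->]].
    apply: (subvP (addvSl U <[x]>)).
    rewrite [u + _]addrC brl [w + _]addrC !brr br_alt scaler0 add0r.
    rewrite memvD ?memvZ ?[br x w]brC ?memvN ?Ux //.
    by rewrite memvD ?memvZ ?Ux ?bU.
  exact: (acts_nilpS nU a0 xa Ux).
have [[U [UJ _ _ _] ltU]|//] := step (\dim J).+1.
by have := leq_trans ltU (dimvS UJ); rewrite ltnn.
Qed.

(** If [J] were nonzero, Engel's conclusion with A = 0 would give a nonzero element of the centre of
    [J], an abelian ideal. *)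
Lemma nilp_ideal_eq0 (J : {vspace L}) : is_ideal br J -> hstab J ->
  (forall x, x \in J -> x \in gwspace 0%R -> x = 0) -> J = 0%VS.
Proof.
move=> idJ sJ J0; have nJ := acts_nilp_ideal idJ sJ J0.
apply/eqP; apply/negPn/negP => Jn0.
have [| | | |v [vJ v0 Hv]] := nJ 0%VS J.
- exact: sub0v.
- by rewrite eq_sym.
- by move=> u x _; rewrite memv0 => /eqP->; rewrite brx0 mem0v.
- by move=> u x _ xJ; exact: idJ.
pose Z := vspace_of (fun x => x \in J /\ forall u, u \in J -> br u x = 0).
have ZP x : x \in Z <-> x \in J /\ forall u, u \in J -> br u x = 0.
  apply: vspace_ofP => [|k y z [yJ Hy] [zJ Hz]].
    by split; [exact: mem0v | move=> u _; rewrite brx0].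
  split=> [|u uU]; first by rewrite memvD ?memvZ.
  by rewrite brr Hy ?Hz // scaler0 addr0.
have Z0 : Z = 0%VS.
  apply: no_abelian => [x y /ZP[yJ Hy]|x y /ZP[xJ Hx] /ZP[yJ Hy]]; last exact: Hy.
  apply/ZP; split=> [|u uJ]; first exact: idJ.
  by rewrite br_der [br u x]brC !Hy ?brx0 ?addr0 // memvN idJ.
case/negP: v0; rewrite -Z0; apply/ZP; split=> // u uJ.
by have := Hv u uJ; rewrite memv0 => /eqP.
Qed.

(** The part [J] of nonzero weight of the radical [I] is an ideal without zero weight, hence 0; then
    [I] lies in h and is an abelian ideal. *)
Lemma kappa_nd x : (forall y, kappa x y = 0) -> x = 0.
Proof.
pose I := vspace_of (fun x => forall y, kappa x y = 0).
have IP z : z \in I <-> forall y, kappa z y = 0.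
  apply: vspace_ofP => [y|k u v Hu Hv y]; first by rewrite kappa0l.
  by rewrite kappaDl kappaZl Hu Hv mulr0 addr0.
have idI : is_ideal br I.
  by move=> y z /IP zI; apply/IP => w; rewrite brC kappaNl kappa_inv zI oppr0.
have sI : hstab I by move=> H y _; exact: idI.
pose J := (\sum_(a <- Ws | a != 0%R) (I :&: gwspace a))%VS.
have JP a z : a != 0 -> z \in I -> z \in gwspace a -> z \in J.
  move=> a0 zI za; have [->|z0] := eqVneq z 0; first by rewrite mem0v.
  have aW := gwspace_out za z0; rewrite /J -big_filter.
  have m : a \in [seq a <- Ws | a != 0] by rewrite mem_filter a0.
  by apply: (subvP (sub_big_addv (fun a => I :&: gwspace a)%VS m)); rewrite memv_cap zI.
(* A bracket could leave [J] only by landing in weight 0; it then lies in the radical, so it is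
   isotropic and vanishes. *)
have idJ : is_ideal br J.
  move=> y z zJ; rewrite -adE; move: z zJ; rewrite /J -big_filter; apply: big_addv_img => a z.
  rewrite mem_filter => /andP[a0 aW]; rewrite memv_cap big_filter => /andP[zI za].
  rewrite adE; move: y; apply: full_ind => [|u v Hu Hv|b u bW ub].
  - by rewrite br0x mem0v.
  - by rewrite -adE linearD add_lfunE !adE memvD.
  have [ab|ab] := eqVneq (b + a) 0; last by apply: (JP (b + a)); rewrite ?idI ?gwspace_br.
  have aE : a = - b by apply/eqP; rewrite -addr_eq0 addrC ab.
  rewrite (@isotropic_eq0 b) ?mem0v -?aE //.
  exact: ((IP _).1 (idI u z zI)).
have J0 z : z \in J -> z \in gwspace 0%R -> z = 0.
  move=> zJ z0; apply: (@gwspace_indep [seq a <- Ws | a != 0] 0) => //.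
    by rewrite mem_filter eqxx.
  apply: subvP zJ; rewrite /J -big_filter; apply: big_addvS => a; exact: capvSr.
have JE : J = 0%VS by apply: nilp_ideal_eq0 => // H z _; exact: idJ.
have Ih : (I <= h)%VS.
  apply: subv_trans (gwspace_decomp_Ws sI) _; apply: big_addv_sub => a aW.
  have [->|a0] := eqVneq a 0; first by rewrite gwspace0 capvSr.
  apply/subvP => z; rewrite memv_cap => /andP[zI za].
  by have := JP a z a0 zI za; rewrite JE memv0 => /eqP->; rewrite mem0v.
have I0 : I = 0%VS.
  by apply: no_abelian => // y z /(subvP Ih) yh /(subvP Ih); exact: h_ab.
by move/IP; rewrite I0 memv0 => /eqP.
Qed.

Lemma kappa_pair a e : e \in gwspace a -> e != 0 -> exists2 y, y \in gwspace (- a) & kappa e y != 0.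
Proof.
move=> ea e0; apply: NNPP => K; case/eqP: e0; apply: kappa_nd; apply: full_ind.
- exact: linear0.
- by move=> u v Hu Hv; rewrite linearD /= Hu Hv addr0.
move=> b y bW yb; have [ab|ab] := eqVneq (a + b) 0; last exact: kappa_orth ab ea yb.
apply/eqP; apply: contra_notT K => K; exists y => //.
by have -> : - a = b by apply/eqP; rewrite eq_sym -addr_eq0 addrC ab.
Qed.

Lemma kappa_rootsp a e y H : e \in rootsp br a -> H \in h ->
  kappa H (br e y) = ev a H * kappa e y.
Proof. by move=> /mem_rootsp He hH; rewrite -kappa_inv He // kappaZl. Qed.

Lemma br_opp_h a x y : x \in gwspace a -> y \in gwspace (- a) -> br x y \in h.
Proof. by move=> xa ya; rewrite -gwspace0 -(subrr a) gwspace_br. Qed.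

(** If a([e, y]) = 0 then [e, y] is isotropic, hence 0; but kappa(H, [e, y]) = a(H) kappa(e, y)
    would then make a vanish on h. *)
Lemma ev_br_neq0 a e y : a != 0 -> e \in rootsp br a -> y \in gwspace (- a) ->
  kappa e y != 0 -> ev a (br e y) != 0.
Proof.
move=> a0 ea ya K; have ea' := subvP (rootsp_sub_gwspace a) e ea.
apply: contra a0 => /eqP E; apply/eqP; apply: ev_inj => H hH; rewrite ev0.
have T0 : br e y = 0.
  by apply: (isotropic_eq0 ea' ya); rewrite (kappa_rootsp y ea) ?(br_opp_h ea' ya) // E mul0r.
by have := kappa_rootsp y ea hH; rewrite T0 linear0 => /esym/eqP; rewrite mulf_eq0 (negPf K) orbF => /eqP.
Qed.

(** * One-dimensional root spaces and coroots *)

Lemma WsN a : a \in Ws -> - a \in Ws.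
Proof.
rewrite WsE => /orP[/eqP->|nz]; first by rewrite oppr0 WsE eqxx.
have e0 : vpick (rootsp br a) != 0 by rewrite vpick0.
have ea := subvP (rootsp_sub_gwspace a) _ (memv_pick (rootsp br a)).
have [y ya K] := kappa_pair ea e0; apply: (gwspace_out ya).
by apply: contraNneq K => ->; rewrite linear0.
Qed.

Lemma rootsp_pick a : a \in Ws -> a != 0 -> exists2 e, e \in rootsp br a & e != 0.
Proof.
rewrite WsE => /orP[/eqP->|nz _]; first by rewrite eqxx.
by exists (vpick (rootsp br a)); [exact: memv_pick | rewrite vpick0].
Qed.

(* [br e y] acts with trace 0 on F e + h + \sum_(k >= 1) gwspace (- k a), where its
   eigenvalue on each summand is a known multiple of that on e. *)
Lemma dim_gwspaceN a : a \in Ws -> a != 0 -> \dim (gwspace (- a)) = 1%N.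
Proof.
move=> aW a0; have [e ea e0] := rootsp_pick aW a0.
have ea' := subvP (rootsp_sub_gwspace a) e ea.
have [y ya K] := kappa_pair ea' e0.
have nz := ev_br_neq0 a0 ea ya K.
pose Q b (k : nat) := b = - (k.+1%:R *: a).
pose P b := asb (exists k, Q b k).
pose k b := epsilon (inhabits 0%N) (Q b).
have kP b : P b -> b = - ((k b).+1%:R *: a).
  by move/asbP => Qb; exact: (epsilon_spec (inhabits 0%N) _ Qb).
(* One summand inside each generalised weight space, 0 off the string, in the form that [trace_comm]
   expects. *)
pose U b := if b == a then <[e]>%VS else if b == 0 then h else if P b then gwspace b else 0%VS.
have UL b : (U b <= gwspace b)%VS.
  rewrite /U; case: eqP => [->|_]; first by rewrite -memvE.
  case: eqP => [->|_]; first by rewrite gwspace0.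
  by case: ifP => _ //; exact: sub0v.
have sU b : hstab (U b).
  rewrite /U; case: eqP => [_|_].
    move=> H _ hH /vlineP[t ->]; rewrite -adE linearZ /= adE.
    by rewrite ((mem_rootsp a e).1 ea) // scalerA memvZ ?memv_line.
  case: eqP => _; first exact: h_hstab.
  case: ifP => _; first exact: gwspace_hstab.
  by move=> H x _; rewrite memv0 => /eqP->; rewrite brx0 mem0v.
have Nk m : - (m.+1%:R *: a) != 0 :> hd.
  by rewrite oppr_eq0 scaler_eq0 natF_eq0 // (negPf a0).
have Na m : - (m.+1%:R *: a) != a.
  by rewrite eq_sym -subr_eq0 opprK -{1}[a]scale1r -scalerDl -mulrS scaler_eq0 natF_eq0 // (negPf a0).
have PNa : P (- a) by apply/asbP; exists 0%N; rewrite /Q scale1r.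
have UP b : P b -> U b = gwspace b.
  by move=> Pb; rewrite /U Pb {1 2}(kP b Pb) (negPf (Na _)) (negPf (Nk _)).
have Ua : U a = <[e]>%VS by rewrite /U eqxx.
have U0 : U 0 = h by rewrite /U eq_sym (negPf a0) eqxx.
set V := (\sum_(b <- Ws) U b)%VS.
have inV b x : x \in U b -> x \in V.
  move=> xb; have [->|x0] := eqVneq x 0; first by rewrite mem0v.
  exact: (subvP (sub_big_addv U (gwspace_out (subvP (UL b) x xb) x0))).
have UPin b x : x \in gwspace b -> P b -> x \in V.
  by move=> xb Pb; apply: (inV b); rewrite UP.
have Vh x : x \in h -> x \in V by rewrite -U0; exact: inV.
have Ve : e \in V by apply: (inV a); rewrite Ua memv_line.
have st_e : stab V (ad e).
  apply: big_addv_img => b x _; rewrite adE /U.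
  case: eqP => [_ /vlineP[t ->]|_].
    by rewrite -adE linearZ /= adE br_alt scaler0 mem0v.
  case: eqP => [_ xh|_].
    by rewrite brC memvN ((mem_rootsp a e).1 ea) // memvZ.
  case: ifP => [Pb|_]; last by rewrite memv0 => /eqP->; rewrite brx0 mem0v.
  move=> xb; have := gwspace_br ea' xb; have := kP b Pb; case: (k b) => [|m] bE.
    by rewrite bE scale1r subrr gwspace0; exact: Vh.
  move=> H; apply: UPin H _; apply/asbP; exists m; rewrite /Q bE.
  by rewrite -natr1 scalerDl scale1r opprD addrCA subrr addr0.
have st_y : stab V (ad y).
  apply: big_addv_img => b x _; rewrite adE /U.
  case: eqP => [_ /vlineP[t ->]|_].
    rewrite -adE linearZ /= adE memvZ // Vh // brC memvN; exact: br_opp_h ea' ya.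
  case: eqP => [_ xh|_].
    rewrite brC memvN; apply: UPin PNa; exact: gwspace_hstab.
  case: ifP => [Pb|_]; last by rewrite memv0 => /eqP->; rewrite brx0 mem0v.
  move=> xb; have H := gwspace_br ya xb; apply: UPin H _; apply/asbP; exists (k b).+1.
  by rewrite /Q {1}(kP b Pb) -opprD -[(k b).+2%:R]natr1 scalerDl scale1r addrC.
have := trace_comm Ws_uniq (br_opp_h ea' ya) sU UL st_e st_y.
pose w b := if P b then ((k b).+1 * \dim (gwspace b))%N else 0%N.
rewrite (bigD1_seq a) //= Ua dim_vline e0 mulr1.
rewrite (eq_bigr (fun b => - ev a (br e y) * (w b)%:R)); last first.
  move=> b ba; rewrite /w; case: ifP => [Pb|nPb].
    rewrite UP // {1}(kP b Pb) evN evZ natrM !mulNr; congr (- _).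
    by rewrite mulrA [ev a _ * _]mulrC.
  rewrite mulr0 /U (negPf ba) nPb; case: eqP => [->|_]; first by rewrite ev0 mul0r.
  by rewrite dimv0 mulr0.
rewrite -mulr_sumr mulNr -{1}[ev a _]mulr1 -mulrBr => /eqP.
rewrite mulf_eq0 (negPf nz) /= subr_eq0 -natr_sum => /eqP E1.
(* After cancelling a([e, y]), the sum of k times the dimension of weight -k a, over k >= 1, equals
   1; its term at -a bounds that dimension by 1. *)
have E : 1%N = (\sum_(b <- Ws | b != a) w b)%N by apply: (natF_inj char0); rewrite -E1.
apply/eqP; rewrite eqn_leq; apply/andP; split.
  rewrite E -big_filter (big_rem (- a)) /=.
    by rewrite /w PNa; apply: leq_trans (leq_addr _ _); rewrite leq_pmull.
  by rewrite mem_filter WsN // andbT; have := Na 0%N; rewrite scale1r.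
by rewrite dim_gwspace_gt0 ?WsN ?oppr_eq0.
Qed.

Lemma dim_gwspace a : a \in Ws -> a != 0 -> \dim (gwspace a) = 1%N.
Proof. by move=> aW a0; rewrite -[a]opprK dim_gwspaceN ?WsN ?oppr_eq0. Qed.

Lemma rootspE a : a \in Ws -> a != 0 -> rootsp br a = gwspace a.
Proof.
move=> aW a0; apply/eqP; rewrite eqEdim rootsp_sub_gwspace dim_gwspace // lt0n dimv_eq0.
by move: aW; rewrite WsE (negPf a0).
Qed.

Lemma br_Zl k x y : br (k *: x) y = k *: br x y.
Proof. by rewrite -adE linearZ scale_lfunE adE. Qed.
Lemma br_Zr k x y : br x (k *: y) = k *: br x y.
Proof. by rewrite -adE linearZ /= adE. Qed.
Lemma br_Dl x x' y : br (x + x') y = br x y + br x' y.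
Proof. by rewrite -adE linearD add_lfunE !adE. Qed.
Lemma br_Dr x y y' : br x (y + y') = br x y + br x y'.
Proof. by rewrite -adE linearD /= !adE. Qed.

(** From here on h acts diagonally. *)
Lemma rootsp_gwspace a : rootsp br a = gwspace a.
Proof.
have [aW|aW] := boolP (a \in Ws).
  have [->|a0] := eqVneq a 0; last exact: rootspE.
  apply/eqP; rewrite eqEsubv rootsp_sub_gwspace gwspace0; apply/subvP => x xh.
  by apply/mem_rootsp => H hH; rewrite h_ab // ev0 scale0r.
apply/eqP; rewrite eqEsubv rootsp_sub_gwspace; apply/subvP => x xa.
have [->|x0] := eqVneq x 0; first by rewrite mem0v.
by rewrite (gwspace_out xa x0) in aW.
Qed.

Lemma rootE a : is_root br a = (a != 0) && (a \in Ws).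
Proof. by rewrite /is_root WsE; case: eqP. Qed.

Lemma root_neq0 a : is_root br a -> a != 0. Proof. by case/andP. Qed.
Lemma root_Ws a : is_root br a -> a \in Ws. Proof. by rewrite rootE => /andP[]. Qed.
Lemma rootN a : is_root br a -> is_root br (- a).
Proof. by rewrite !rootE oppr_eq0 => /andP[-> /WsN]. Qed.

Local Notation g := (@rootsp F L br h).

Lemma rootsp0 : g (0 : hd) = h. Proof. by rewrite rootsp_gwspace gwspace0. Qed.

Lemma rootsp_br a b x y : x \in g a -> y \in g b -> br x y \in g (a + b).
Proof. by rewrite !rootsp_gwspace; exact: gwspace_br. Qed.

Lemma rootsp_out a x : x \in g a -> x != 0 -> a \in Ws.
Proof. by rewrite rootsp_gwspace; exact: gwspace_out. Qed.

Lemma rootsp_eq0 a x : a \notin Ws -> x \in g a -> x = 0.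
Proof. by move=> aW xa; apply/eqP; apply: contraNT aW; exact: rootsp_out xa. Qed.

Lemma rootsp_line a e x : is_root br a -> e \in g a -> e != 0 -> x \in g a -> exists k, x = k *: e.
Proof.
move=> ra ea e0 xa; apply/vlineP.
have -> : <[e]>%VS = g a; last by [].
apply/eqP; rewrite eqEdim -memvE ea dim_vline e0 rootsp_gwspace dim_gwspace //; first exact: root_Ws.
exact: root_neq0.
Qed.

Lemma rootsp_pair a e : e \in g a -> e != 0 -> exists2 y, y \in g (- a) & kappa e y != 0.
Proof. by rewrite !rootsp_gwspace; exact: kappa_pair. Qed.

Lemma rootsp_orth a b x y : a + b != 0 -> x \in g a -> y \in g b -> kappa x y = 0.
Proof. by rewrite !rootsp_gwspace; exact: kappa_orth. Qed.

Lemma rootsp_br_h a x y : x \in g a -> y \in g (- a) -> br x y \in h.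
Proof. by rewrite !rootsp_gwspace; exact: br_opp_h. Qed.

Lemma trace_roots (P : pred hd) c x y : x \in g c -> y \in g (- c) ->
  (forall a, a \in Ws -> P a -> a + c \in Ws -> P (a + c)) ->
  (forall a, a \in Ws -> P a -> a - c \in Ws -> P (a - c)) ->
  \sum_(a <- Ws | P a) ev a (br x y) = 0.
Proof.
rewrite !rootsp_gwspace => xc yc H1 H2; rewrite -[RHS](trace_filter xc yc H1 H2).
rewrite [LHS]big_seq_cond [RHS]big_seq_cond; apply: eq_bigr => a /andP[aW _].
have [->|a0] := eqVneq a 0; first by rewrite !ev0 mul0r.
by rewrite dim_gwspace // mulr1.
Qed.

(** The brackets of the two root lines span the line through one [e, y] on which a does not vanish,
    so the choice in [coroot] has a genuine witness. *)
Lemma corootP a : is_root br a -> exists x y,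
  [/\ x \in g a, y \in g (- a), coroot br a = br x y & ev a (coroot br a) = 2].
Proof.
move=> ra; have [e ea e0] := rootsp_pick (root_Ws ra) (root_neq0 ra).
have [y ya K] := rootsp_pair ea e0.
have y0 : y != 0 by apply: contraNneq K => ->; rewrite linear0.
have nz : ev a (br e y) != 0.
  by apply: ev_br_neq0 (root_neq0 ra) ea _ K; rewrite -rootsp_gwspace.
have sp : (brsp br (g a) (g (- a)) <= <[br e y]>)%VS.
  apply/span_subvP => _ /allpairsP[[u v] /= [/vbasis_mem ua /vbasis_mem va ->]].
  have [k ->] := rootsp_line ra ea e0 ua; have [l ->] := rootsp_line (rootN ra) ya y0 va.
  by rewrite br_Zl br_Zr !memvZ ?memv_line.
have ex : exists H, H \in brsp br (g a) (g (- a)) /\ (a (vsproj h H) : F) = 2.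
  exists ((2 / ev a (br e y)) *: br e y); split; last first.
    by rewrite -[LHS]/(ev a _) linearZ /= divfK.
  apply: memvZ.
  rewrite (coord_vbasis ea) -adE [ad _]linear_sum sum_lfunE.
  apply: memv_suml => i _; rewrite (coord_vbasis ya) linear_sum; apply: memv_suml => j _.
  rewrite /= adE br_Zl br_Zr !memvZ //; apply: memv_span; apply/allpairsP.
  exists ((vbasis (g a))`_i, (vbasis (g (- a)))`_j) => /=.
  by split=> //; rewrite mem_nth ?size_tuple.
have [H1 H2] := epsilon_spec (inhabits 0) _ ex.
rewrite -/(coroot br a) in H1 H2.
have /vlineP[k E] := subvP sp _ H1.
exists (k *: e), y; split=> //; first by rewrite memvZ.
by rewrite br_Zl.
Qed.

Lemma coroot_h a : is_root br a -> coroot br a \in h.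
Proof. by move=> /corootP[x [y [xa ya -> _]]]; exact: rootsp_br_h ya. Qed.

Lemma F2_neq0 : (2 : F) != 0. Proof. by rewrite natF_eq0. Qed.

Lemma kappa_coroot a : is_root br a -> exists2 k, k != 0 &
  forall H, H \in h -> kappa H (coroot br a) = k * ev a H.
Proof.
move=> ra; have [x [y [xa ya E E2]]] := corootP ra; exists (kappa x y); last first.
  by move=> H hH; rewrite E (kappa_rootsp y xa) // mulrC.
apply/eqP => K; have : ev a (coroot br a) = 0.
  rewrite E; suff -> : br x y = 0 by rewrite linear0.
  apply: (@isotropic_eq0 a); rewrite -?rootsp_gwspace // (kappa_rootsp y xa) ?K ?mulr0 //.
  exact: rootsp_br_h ya.
by rewrite E2 => /eqP; rewrite (negPf F2_neq0).
Qed.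

Lemma pair_sym0 a b : is_root br a -> is_root br b ->
  (ev a (coroot br b) == 0) = (ev b (coroot br a) == 0).
Proof.
move=> ra rb; have [k k0 Hk] := kappa_coroot ra; have [m m0 Hm] := kappa_coroot rb.
have E : m * ev b (coroot br a) = k * ev a (coroot br b).
  by rewrite -Hm ?coroot_h // -Hk ?coroot_h // kappaC.
by rewrite -(inj_eq (mulfI k0)) mulr0 -E mulf_eq0 (negPf m0).
Qed.

Lemma trace_coroot (P : pred hd) a : is_root br a ->
  (forall b, b \in Ws -> P b -> b + a \in Ws -> P (b + a)) ->
  (forall b, b \in Ws -> P b -> b - a \in Ws -> P (b - a)) ->
  \sum_(b <- Ws | P b) ev b (coroot br a) = 0.
Proof. by move=> /corootP[x [y [xa ya -> _]]]; exact: trace_roots. Qed.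

(** With b + a not a weight, g^a kills x; if g^(-a) did too, so would the coroot of a, which acts on
    x by a nonzero scalar. *)
Lemma br_neq0 a b y x : is_root br a -> b + a \notin Ws -> ev b (coroot br a) != 0 ->
  y \in g (- a) -> y != 0 -> x \in g b -> x != 0 -> br y x != 0.
Proof.
move=> ra ab nz ya y0 xb x0; have [u [v [ua va E _]]] := corootP ra.
apply: contraNneq nz => Z; have [k vE] := rootsp_line (rootN ra) ya y0 va.
have : br (coroot br a) x = 0.
  have -> : br (coroot br a) x = br u (br v x) - br v (br u x).
    by rewrite E br_der addrK.
  have -> : br u x = 0 by apply: (rootsp_eq0 (a := b + a)) => //; rewrite addrC rootsp_br.
  by rewrite vE br_Zl Z scaler0 !brx0 subrr.
rewrite ((mem_rootsp b x).1 xb) ?coroot_h // => /eqP.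
by rewrite scaler_eq0 (negPf x0) orbF.
Qed.

Lemma kappa_coroot_rat a : is_root br a -> forall b, b \in Ws -> is_rat (ev b (coroot br a)).
Proof.
move=> ra b bW; have [x [y [xa ya E E2]]] := corootP ra.
have [||r rQ Er] := @ratio a x y b _ _ bW; rewrite -?rootsp_gwspace //.
by rewrite E Er -E E2; apply: is_ratM => //; exact: (is_rat_nat F 2).
Qed.

(** * Bases and the root lattice *)

Section Base.
Variables (l : nat) (Pi : l.-tuple hd).
Hypothesis Pi_base : is_base br Pi.
Implicit Types S T : {set 'I_l}.

Definition icomb (c : 'I_l -> int) : hd := \sum_(i < l) (c i)%:~R *: Pi`_i.
Definition inZ a := exists c : 'I_l -> int, a = icomb c.
(** Coordinates in the simple roots, unique in characteristic 0 and arbitrary outside the root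
    lattice. *)
Definition icoef a : 'I_l -> int := epsilon (inhabits (fun=> 0)) (fun c : 'I_l -> int => a = icomb c).

Lemma icombD (c d : 'I_l -> int) : icomb (fun i => c i + d i) = icomb c + icomb d.
Proof. by rewrite /icomb -big_split; apply: eq_bigr => i _; rewrite rmorphD scalerDl. Qed.
Lemma icombN (c : 'I_l -> int) : icomb (fun i => - c i) = - icomb c.
Proof. by rewrite /icomb -sumrN; apply: eq_bigr => i _; rewrite rmorphN scaleNr. Qed.
Lemma icomb0 : icomb (fun=> 0) = 0.
Proof. by rewrite /icomb big1 // => i _; rewrite scale0r. Qed.

Lemma Pi_free : free Pi. Proof. by case: Pi_base => _ /basis_free. Qed.

Lemma icomb_eq0 (c : 'I_l -> int) : icomb c = 0 -> forall i, c i = 0.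
Proof.
move=> E i; apply/eqP; rewrite -(intF_eq0 char0); apply/eqP.
have /freeP Pi0 := Pi_free; exact: (Pi0 (fun i => (c i)%:~R) E i).
Qed.

Lemma icomb_inj (c d : 'I_l -> int) : icomb c = icomb d -> c =1 d.
Proof.
move=> E i; apply/eqP; rewrite -subr_eq0; apply/eqP.
by apply: (@icomb_eq0 (fun i => c i - d i)); rewrite icombD icombN E subrr.
Qed.

Lemma icoefE a : inZ a -> a = icomb (icoef a).
Proof. by move=> H; exact: (epsilon_spec (inhabits (fun=> 0)) (fun c : 'I_l -> int => a = icomb c) H). Qed.

Lemma icoef_icomb (c : 'I_l -> int) : icoef (icomb c) =1 c.
Proof. by apply: icomb_inj; rewrite -icoefE //; exists c. Qed.

Lemma inZD a b : inZ a -> inZ b -> inZ (a + b).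
Proof. by move=> [c ->] [d ->]; exists (fun i => c i + d i); rewrite icombD. Qed.
Lemma inZN a : inZ a -> inZ (- a).
Proof. by move=> [c ->]; exists (fun i => - c i); rewrite icombN. Qed.
Lemma inZ0 : inZ 0. Proof. by exists (fun=> 0); rewrite icomb0. Qed.

Lemma icoefD a b i : inZ a -> inZ b -> icoef (a + b) i = icoef a i + icoef b i.
Proof. by move=> [c ->] [d ->]; rewrite -icombD !icoef_icomb. Qed.
Lemma icoefN a i : inZ a -> icoef (- a) i = - icoef a i.
Proof. by move=> [c ->]; rewrite -icombN !icoef_icomb. Qed.
Lemma icoef0 i : icoef 0 i = 0. Proof. by rewrite -icomb0 icoef_icomb. Qed.

Lemma inZ_root a : is_root br a -> inZ a.
Proof. by case: Pi_base => _ _ H /H[c [-> _]]; exists c. Qed.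

Lemma root_Pi (i : 'I_l) : is_root br Pi`_i. Proof. by case: Pi_base. Qed.

Lemma icomb_delta (i : 'I_l) : Pi`_i = icomb (fun j => (j == i)%:Z).
Proof.
rewrite /icomb (bigD1 i) //= eqxx scale1r big1 ?addr0 // => j /negPf ->.
by rewrite scale0r.
Qed.

Lemma icoef_Pi (i j : 'I_l) : icoef Pi`_i j = (j == i)%:Z.
Proof. by rewrite icomb_delta icoef_icomb. Qed.

Lemma icoef_eq0 a : inZ a -> (forall i, icoef a i = 0) -> a = 0.
Proof. by move=> /icoefE aE H; rewrite aE -icomb0; apply: eq_bigr => i _; rewrite H. Qed.

Lemma inZSP S a : inZS Pi S a <-> inZ a /\ forall i, i \notin S -> icoef a i = 0.
Proof.
split=> [[c [cS aE]]|[aZ aS]].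
  by split=> [|i iS]; [exists c | rewrite aE icoef_icomb cS].
by exists (icoef a); split=> //; exact: icoefE.
Qed.

Lemma inNSP S a : inNS Pi S a <->
  [/\ inZ a, forall i, 0 <= icoef a i & forall i, i \notin S -> icoef a i = 0].
Proof.
split=> [[c [cS aE]]|[aZ a0 aS]].
  have aE' : a = icomb (fun i => (c i)%:Z) by rewrite aE.
  split=> [|i|i iS]; first by exists (fun i => (c i)%:Z).
    by rewrite aE' icoef_icomb.
  by rewrite aE' icoef_icomb cS.
exists (fun i => absz (icoef a i)); split=> [i iS|]; first by rewrite aS.
rewrite {1}(icoefE aZ); apply: eq_bigr => i _.
by rewrite -[in LHS](gez0_abs (a0 i)).
Qed.

Lemma inNS_inZ S a : inNS Pi S a -> inZ a. Proof. by case/inNSP. Qed.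
Lemma inNS_inZS S a : inNS Pi S a -> inZS Pi S a.
Proof. by case/inNSP => ? _ ?; apply/inZSP. Qed.

Lemma inNSD S a b : inNS Pi S a -> inNS Pi S b -> inNS Pi S (a + b).
Proof.
move=> /inNSP[aZ a0 aS] /inNSP[bZ b0 bS]; apply/inNSP; split=> [|i|i iS].
- exact: inZD.
- by rewrite icoefD // addr_ge0.
by rewrite icoefD // aS // bS.
Qed.

Lemma inNS0 S : inNS Pi S 0.
Proof. by apply/inNSP; split=> [|i|i _]; [exact: inZ0 | rewrite icoef0 | rewrite icoef0]. Qed.

Lemma inNSS S T a : S \subset T -> inNS Pi S a -> inNS Pi T a.
Proof.
move=> /subsetP ST /inNSP[aZ a0 aS]; apply/inNSP; split=> // i iT; apply: aS.
by apply: contra iT => /ST.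
Qed.

Lemma inNS_anti S T a : inNS Pi S a -> inNS Pi T (- a) -> a = 0.
Proof.
move=> /inNSP[aZ a0 _] /inNSP[_ Na0 _]; apply: icoef_eq0 => // i; apply/eqP.
by rewrite eq_le a0 andbT -oppr_ge0 -icoefN.
Qed.

Lemma inNS_face S T T' a b : inNS Pi S (a + b) -> inNS Pi T a -> inNS Pi T' b -> inNS Pi S a.
Proof.
move=> /inNSP[_ _ abS] /inNSP[aZ a0 _] /inNSP[bZ b0 _]; apply/inNSP; split=> // i iS.
by have /eqP := abS i iS; rewrite icoefD // paddr_eq0 // => /andP[/eqP].
Qed.

Lemma inNS_inZS_face S T a : inZS Pi S a -> inNS Pi T a -> inNS Pi S a.
Proof. by move=> /inZSP[_ aS] /inNSP[aZ a0 _]; apply/inNSP. Qed.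

Lemma inZSD S a b : inZS Pi S a -> inZS Pi S b -> inZS Pi S (a + b).
Proof.
move=> /inZSP[aZ aS] /inZSP[bZ bS]; apply/inZSP; split=> [|i iS]; first exact: inZD.
by rewrite icoefD // aS // bS.
Qed.

Lemma inZSN S a : inZS Pi S a -> inZS Pi S (- a).
Proof.
move=> /inZSP[aZ aS]; apply/inZSP; split=> [|i iS]; first exact: inZN.
by rewrite icoefN // aS // oppr0.
Qed.

Lemma root_sign a : is_root br a -> inNS Pi setT a \/ inNS Pi setT (- a).
Proof.
move=> ra; have aZ := inZ_root ra.
case: Pi_base => _ _ /(_ a ra)[c [aE c0]].
have cE i : icoef a i = c i by rewrite aE icoef_icomb.
case: c0 => c0; [left | right]; apply/inNSP; split=> [|i|i]; rewrite ?inE //.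
- by rewrite cE.
- exact: inZN.
by rewrite icoefN // cE oppr_ge0.
Qed.

Lemma RS_sign S a : in_RS br Pi S a -> in_RSpos br Pi S a \/ in_RSpos br Pi S (- a).
Proof.
move=> [ra aS]; case: (root_sign ra) => H; [left | right]; split=> //.
- exact: inNS_inZS_face H.
- exact: rootN.
by apply: inNS_inZS_face H; exact: inZSN.
Qed.

Lemma RSpos_RS S a : in_RSpos br Pi S a -> in_RS br Pi S a.
Proof. by move=> [ra /inNS_inZS]. Qed.

Lemma RS_N S a : in_RS br Pi S a -> in_RS br Pi S (- a).
Proof. by move=> [/rootN ra /inZSN]. Qed.

Lemma RSneg_pos T a : in_RSneg br Pi T a <-> in_RSpos br Pi T (- a).
Proof.
split=> [[aT nT]|aT].
  by case: (RS_sign aT).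
split; first by rewrite -[a]opprK; apply: RS_N; exact: RSpos_RS.
move=> [ra aN]; case: aT => _ Na; have /eqP := inNS_anti aN Na.
by rewrite (negPf (root_neq0 ra)).
Qed.

Lemma RSpos_Pi S (i : 'I_l) : i \in S -> in_RSpos br Pi S Pi`_i.
Proof.
move=> iS; split; first exact: root_Pi.
apply/inNSP; split=> [|j|j jS]; first exact: inZ_root (root_Pi i).
  by rewrite icoef_Pi.
by rewrite icoef_Pi; case: eqP => // ji; rewrite -ji (negPf jS) in iS.
Qed.

Lemma ev_icomb a H : inZ a -> ev a H = \sum_(i < l) (icoef a i)%:~R * ev Pi`_i H.
Proof.
move=> /icoefE {1}->; rewrite /icomb.
elim/big_rec2: _ => [|i y1 y2 _ E]; first by rewrite ev0.
by rewrite evD evZ E.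
Qed.

(* [kappa] is positive definite on rational combinations of roots. *)
Lemma base_definite (c : 'I_l -> nat) (s := icomb (fun i => (c i)%:Z)) :
  (forall i, c i != 0%N -> ev s (coroot br Pi`_i) = 0) -> forall i, c i = 0%N.
Proof.
move=> H.
have K (i : 'I_l) : exists k : F, k != 0 /\ (forall G, G \in h -> kappa G (coroot br Pi`_i) = k * ev Pi`_i G).
  by have [k k0 Hk] := kappa_coroot (root_Pi i); exists k.
pose k i := epsilon (inhabits 0) (fun k : F => k != 0 /\ (forall G, G \in h -> kappa G (coroot br Pi`_i) = k * ev Pi`_i G)).
have kP (i : 'I_l) : k i != 0 /\ (forall G, G \in h -> kappa G (coroot br Pi`_i) = k i * ev Pi`_i G).
  exact: (epsilon_spec (inhabits 0) _ (K i)).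
have kQ (i : 'I_l) : is_rat (k i).
  have [k0 Hk] := kP i.
  have [x [y [_ _ _ E2]]] := corootP (root_Pi i).
  have -> : k i = kappa (coroot br Pi`_i) (coroot br Pi`_i) / 2.
    by rewrite Hk ?coroot_h ?root_Pi // E2 mulfK // F2_neq0.
  apply: is_ratM; last by apply: is_ratV => //; exact: (is_rat_nat F 2).
  rewrite kappa_h ?coroot_h ?root_Pi // big_seq; apply: is_rat_sum => // a aW.
  have q := kappa_coroot_rat (root_Pi i) aW.
  by rewrite expr2; do 2?apply: is_ratM => //; exact: is_rat_nat.
(* The element of h representing [s] through kappa. Then kappa(t, t) = s(t) only involves the
   coroots with [c i != 0], on which [s] vanishes. *)
pose t := \sum_(i < l) ((c i)%:R / k i) *: coroot br Pi`_i.
have th : t \in h by apply: memv_suml => i _; rewrite memvZ // coroot_h ?root_Pi.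
have tE G : G \in h -> kappa G t = ev s G.
  move=> Gh; rewrite /t linear_sum ev_icomb; last by exists (fun i => (c i)%:Z).
  apply: eq_bigr => i _; rewrite linearZ /= (kP i).2 // mulrA divfK ?(kP i).1 //.
  by rewrite icoef_icomb.
have tt : kappa t t = 0.
  rewrite tE // {1}/t linear_sum big1 // => i _; rewrite linearZ /=.
  by have [->|ci] := eqVneq (c i) 0%N; [rewrite mul0r mul0r | rewrite H // mulr0].
have t0 : t = 0.
  apply: sep => // a aW; have [->|a0] := eqVneq a 0; first by rewrite ev0.
  pose f b := if b \in Ws then ev b t else 0.
  have fQ b : is_nneg_rat (f b ^+ 2 * (\dim (gwspace b))%:R).
    apply: is_nneg_ratM => //; last exact: is_nneg_rat_nat.
    apply: is_rat_sqr => //; rewrite /f; case: ifP => [bW|_]; last exact: (is_rat_nat F 0).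
    rewrite /t linear_sum; apply: is_rat_sum => // i _; rewrite linearZ /=.
    apply: is_ratM => //; last exact: kappa_coroot_rat (root_Pi i) _ bW.
    by apply: is_ratM => //; [exact: is_rat_nat | apply: is_ratV].
  have : \sum_(b <- Ws) f b ^+ 2 * (\dim (gwspace b))%:R = 0.
    by rewrite -[RHS]tt kappa_h //; apply: eq_big_seq => b bW; rewrite /f bW.
  move/(is_nneg_rat_sum_eq0 char0 fQ)/(_ a aW)/eqP.
  by rewrite /f aW dim_gwspace // mulr1 expf_eq0 /= => /eqP.
have s0 : s = 0 by apply: ev_inj => G Gh; rewrite -tE // t0 linear0 ev0.
by move=> i; have := icomb_eq0 s0 i => -[].
Qed.

Lemma connect_closed (I : finType) (e : rel I) (P : I -> Prop) i j :
  P i -> (forall j k, P j -> e j k -> P k) -> connect e i j -> P j.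
Proof.
move=> Pi0 H /connectP[p]; elim: p i Pi0 => [|k p IH] i Pi0 /=; first by move=> _ ->.
by case/andP=> eik; apply: IH; exact: H eik.
Qed.

Lemma connectedS_connect S i j : connectedS br Pi S -> i \in S -> j \in S ->
  connect (adjS br Pi S) i j.
Proof.
move=> /cards1P[C CE] iS jS.
have inC k : k \in S -> [set m in S | connect (adjS br Pi S) k m] = C.
  by move=> kS; apply/set1P; rewrite -CE; apply/imsetP; exists k.
have : j \in C by rewrite -(inC j jS) inE jS connect0.
by rewrite -(inC i iS) inE => /andP[].
Qed.

Lemma adjS_ev S i j : adjS br Pi S i j -> ev Pi`_j (coroot br Pi`_i) != 0.
Proof.
case/and3P=> _ _ /andP[_]; rewrite /pairing -!/(ev _ _).
by rewrite [X in X || _](congr1 negb (pair_sym0 (root_Pi i) (root_Pi j))) orbb.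
Qed.

Lemma seq_argmax (I : eqType) (s : seq I) (f : I -> int) x : x \in s ->
  exists2 y, y \in s & forall z, z \in s -> f z <= f y.
Proof.
elim: s x => // y [|z s] IH x _.
  by exists y; rewrite ?mem_head // => a; rewrite inE => /eqP->.
have [b bs Hb] := IH z (mem_head _ _).
have [le|lt] := leP (f y) (f b).
  by exists b; rewrite ?(mem_behead (s := y :: _)) // => a; rewrite inE => /predU1P[->|/Hb].
exists y; rewrite ?mem_head // => a; rewrite inE => /predU1P[->//|/Hb le].
exact: le_trans le (ltW lt).
Qed.

Definition height a : int := \sum_(i < l) icoef a i.

Lemma heightD a b : inZ a -> inZ b -> height (a + b) = height a + height b.
Proof. by move=> aZ bZ; rewrite /height -big_split; apply: eq_bigr => i _; rewrite icoefD. Qed.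

Lemma height_ge0 S a : inNS Pi S a -> 0 <= height a.
Proof. by case/inNSP => _ a0 _; apply: sumr_ge0 => i _. Qed.

Lemma height_gt0 S a : inNS Pi S a -> a != 0 -> 0 < height a.
Proof.
move=> aS a0; rewrite lt_def (height_ge0 aS) andbT; apply: contra a0 => /eqP E.
case/inNSP: aS => aZ ca _; apply/eqP; apply: icoef_eq0 => // i.
by apply/eqP; move/eqP: E; rewrite psumr_eq0 // => /allP/(_ i (mem_index_enum i)).
Qed.

Lemma RSpos_D S a b : in_RSpos br Pi S a -> in_RSpos br Pi S b -> a + b \in Ws ->
  in_RSpos br Pi S (a + b).
Proof.
move=> [ra aS] [rb bS] abW; split; last exact: inNSD.
rewrite rootE abW andbT; apply: contra (root_neq0 ra); rewrite addr_eq0 => /eqP E.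
by apply/eqP/(inNS_anti aS (T := S)); rewrite E opprK.
Qed.

Lemma maximal_root S i : i \in S -> exists2 b, in_RSpos br Pi S b &
  forall a, in_RSpos br Pi S a -> a + b \notin Ws.
Proof.
move=> iS; pose s := filter (fun a => asb (in_RSpos br Pi S a)) Ws.
have inS a : in_RSpos br Pi S a -> a \in s.
  by move=> aS; rewrite mem_filter (root_Ws aS.1) andbT; apply/asbP.
have [b] := seq_argmax height (inS _ (RSpos_Pi iS)).
rewrite mem_filter => /andP[/asbP bS bW] Hb; exists b => // a aS; apply/negP => abW.
have := Hb _ (inS _ (RSpos_D aS bS abW)); rewrite (heightD (inNS_inZ aS.2) (inNS_inZ bS.2)).
by rewrite gerDr leNgt (height_gt0 aS.2 (root_neq0 aS.1)).
Qed.

(** * Existence of the highest root of a connected set *)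

(** The module that the negative root vectors of R^S generate from [x0], later taken to be a highest
    weight vector. *)
Inductive lower_mod S (x0 : L) : L -> Prop :=
| lower_mod_gen : lower_mod S x0 x0
| lower_mod_lin k x y : lower_mod S x0 x -> lower_mod S x0 y -> lower_mod S x0 (k *: x + y)
| lower_mod_neg a y w : in_RSpos br Pi S a -> y \in g (- a) -> lower_mod S x0 w -> lower_mod S x0 (br y w).

Lemma lower_mod0 S x0 : lower_mod S x0 0.
Proof. by rewrite -(subrr x0) addrC -scaleN1r; apply: lower_mod_lin; exact: lower_mod_gen. Qed.

Lemma lower_modZ S x0 k x : lower_mod S x0 x -> lower_mod S x0 (k *: x).
Proof. by move=> Hx; rewrite -[_ *: _]addr0; apply: lower_mod_lin => //; exact: lower_mod0. Qed.

(** Move z to the right past each negative root vector: the commutator is again in h or in a root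
    space of R^S, and at the end z scales or kills [x0]. *)
Lemma lower_mod_pos S b x0 : x0 \in g b -> (forall a, in_RSpos br Pi S a -> a + b \notin Ws) ->
  forall w, lower_mod S x0 w -> forall a z, a = 0 \/ in_RSpos br Pi S a -> z \in g a ->
  lower_mod S x0 (br z w).
Proof.
move=> xb bmax w; elim=> [|k x y _ IHx _ IHy|a' y v aS ya Hv IH] a z Ha za.
- case: Ha => [a0|aS].
    move: za; rewrite a0 rootsp0 => zh; rewrite ((mem_rootsp b x0).1 xb) //.
    by apply: lower_modZ; exact: lower_mod_gen.
  rewrite (_ : br z x0 = 0); first exact: lower_mod0.
  by apply: (rootsp_eq0 (bmax a aS)); exact: rootsp_br.
- by rewrite brr; apply: lower_mod_lin; [exact: IHx Ha za | exact: IHy Ha za].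
rewrite br_der -[X in lower_mod _ _ (X + _)]scale1r; apply: lower_mod_lin; last first.
  by apply: lower_mod_neg aS ya _; exact: IH Ha za.
have zy : br z y \in g (a - a') by exact: rootsp_br.
have [->|nz] := eqVneq (br z y) 0; first by rewrite br0x; exact: lower_mod0.
have aaW := rootsp_out zy nz.
have [aa0|aan0] := eqVneq (a - a') 0; first by apply: IH zy; left.
have raa : is_root br (a - a') by rewrite rootE aan0.
have ZS : inZS Pi S (a - a').
  apply: inZSD; last by apply: inZSN; exact: inNS_inZS aS.2.
  by case: Ha => [->|[_ /inNS_inZS//]]; apply: inNS_inZS; exact: inNS0.
case: (RS_sign (conj raa ZS)) => H; first by apply: IH zy; right.
by apply: lower_mod_neg H _ Hv; rewrite opprK.
Qed.

Lemma lower_mod_weight S b x0 : x0 \in g b -> forall w, lower_mod S x0 w ->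
  forall c z, ~ inNS Pi S (b - c) -> z \in g (- c) -> kappa z w = 0.
Proof.
move=> xb w; elim=> [|k x y _ IHx _ IHy|a y v aS ya _ IH] c z nc icomb.
- apply: (rootsp_orth (a := - c) (b := b)) => //; apply/eqP => E; apply: nc.
  by rewrite addrC E; exact: inNS0.
- by rewrite linearP /= (IHx c) // (IHy c) // mulr0 addr0.
rewrite -kappa_inv; apply: (IH (c + a)); last by rewrite opprD rootsp_br.
move=> H; apply: nc; have -> : b - c = (b - (c + a)) + a by rewrite opprD addrA subrK.
exact: inNSD aS.2.
Qed.

Lemma root_coroot_Pi S a : in_RS br Pi S a ->
  exists2 i, i \in S & ev Pi`_i (coroot br a) != 0.
Proof.
move=> [ra /inZSP[aZ aS]]; apply: NNPP => K.
have [x [y [_ _ _ E2]]] := corootP ra.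
have : ev a (coroot br a) = 0; last by rewrite E2 => /eqP; apply/negP; exact: F2_neq0.
rewrite (ev_icomb _ aZ); apply: big1 => i _.
have [iS|iS] := boolP (i \in S); last by rewrite aS // mul0r.
have -> : ev Pi`_i (coroot br a) = 0; last by rewrite mulr0.
by apply/eqP; apply: contra_notT K => K; exists i.
Qed.

(** Take b of maximal height. The module generated by its root vector contains every root vector of
    R^S, and all its weights lie in b minus nonnegative combinations of [S]. *)
Lemma highest_exists S : connectedS br Pi S -> exists b, in_RS br Pi S b /\
  forall a, in_RS br Pi S a -> inNS Pi S (b - a).
Proof.
move=> conS.
have [i iS] : exists i, i \in S.
  have /cards1P[C CE] := conS; have : C \in comps br Pi S by rewrite CE set11.
  by case/imsetP => i iS _; exists i.
have [b bS bmax] := maximal_root iS; exists b; split; first exact: RSpos_RS.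
have [x0 xb x0n] := rootsp_pick (root_Ws bS.1) (root_neq0 bS.1).
have act a z w : in_RS br Pi S a -> z \in g a -> lower_mod S x0 w -> lower_mod S x0 (br z w).
  move=> aS za Hw; case: (RS_sign aS) => H.
    by apply: (lower_mod_pos xb bmax Hw) za; right.
  by apply: lower_mod_neg H _ Hw; rewrite opprK.
pose A a := forall x, x \in g a -> lower_mod S x0 x.
have Acor a : in_RS br Pi S a -> A a -> lower_mod S x0 (coroot br a).
  move=> aS Aa; have [x [y [xa ya -> _]]] := corootP aS.1.
  by rewrite brC -scaleN1r; apply: lower_modZ; apply: (act (- a)) => //; [exact: RS_N | exact: Aa].
(* Membership spreads from a root to every root not orthogonal to it, through the coroot;
   connectedness then carries it from b to all simple roots of [S]. *)
have corA a a' : in_RS br Pi S a -> A a -> in_RS br Pi S a' -> ev a' (coroot br a) != 0 -> A a'.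
  move=> aS Aa aS' nz x xa.
  have := act a' x _ aS' xa (Acor a aS Aa); rewrite brC ((mem_rootsp a' x).1 xa) ?coroot_h ?aS.1 //.
  move/(lower_modZ (- (ev a' (coroot br a))^-1)); rewrite -scaleN1r !scalerA mulrN1 opprK mulVf //.
  by rewrite scale1r.
have Ab : A b.
  by move=> x xb'; have [k ->] := rootsp_line bS.1 xb x0n xb'; apply: lower_modZ; exact: lower_mod_gen.
have PiS j : j \in S -> in_RS br Pi S Pi`_j by move=> jS; apply: RSpos_RS; exact: RSpos_Pi.
have [j jS nz] := root_coroot_Pi (RSpos_RS bS).
have Aj : A Pi`_j by exact: corA (RSpos_RS bS) Ab (PiS j jS) nz.
have APi k : k \in S -> A Pi`_k.
  move=> kS; apply: (@connect_closed _ _ (fun k : 'I_l => A Pi`_k) _ _ Aj _ (connectedS_connect conS jS kS)) => m n Am adj.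
  have /and3P[mS nS _] := adj.
  exact: corA (PiS m mS) Am (PiS n nS) (adjS_ev adj).
move=> a aS; apply: NNPP => K.
have [k kS nzk] := root_coroot_Pi aS.
have Aa : A a.
  apply: (corA _ _ (PiS k kS) (APi k kS) aS).
  by rewrite (pair_sym0 aS.1 (root_Pi k)).
have [x xa xn] := rootsp_pick (root_Ws aS.1) (root_neq0 aS.1).
have [z za nz'] := rootsp_pair xa xn.
by case/eqP: nz'; rewrite kappaC; exact: (lower_mod_weight xb (Aa x xa) K za).
Qed.

Lemma highestP S : connectedS br Pi S -> in_RS br Pi S (highest br Pi S) /\
  forall a, in_RS br Pi S a -> inNS Pi S (highest br Pi S - a).
Proof. by move=> /highest_exists H; exact: (epsilon_spec (inhabits 0) _ H). Qed.

(** * Supports of roots and Dynkin components *)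

Lemma dyn_adjC i j : dyn_adj br Pi i j = dyn_adj br Pi j i.
Proof. by rewrite /dyn_adj eq_sym orbC. Qed.

Lemma adjS_sym S : connect_sym (adjS br Pi S).
Proof.
apply: (@fingraph.sym_connect_sym 'I_l) => i j; rewrite /adjS dyn_adjC.
by case: (i \in S); case: (j \in S).
Qed.

Lemma nonadj_ev (i j : 'I_l) : i != j -> ~~ dyn_adj br Pi i j -> ev Pi`_j (coroot br Pi`_i) = 0.
Proof.
move=> ij; rewrite /dyn_adj ij /= negb_or => /andP[_]; rewrite negbK /pairing -/(ev _ _).
by move/eqP.
Qed.

Lemma RSpos_cf_neq0 S a : in_RSpos br Pi S a -> exists2 i, i \in S & icoef a i != 0.
Proof.
move=> [ra aS]; apply: NNPP => K; case/eqP: (root_neq0 ra).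
case/inNSP: aS => aZ _ aS; apply: icoef_eq0 => // i.
have [iS|iS] := boolP (i \in S); last exact: aS.
by apply/eqP; apply: contra_notT K => nz; exists i.
Qed.

Lemma RSpos_disj S T a : in_RSpos br Pi S a -> inNS Pi T a -> [disjoint S & T] -> False.
Proof.
move=> aS /inNSP[_ _ aT] dST; have [i iS] := RSpos_cf_neq0 aS.
by rewrite aT ?eqxx // (disjointFr dST).
Qed.

Lemma inNS_Pi S (i : 'I_l) : i \in S -> inNS Pi S Pi`_i.
Proof. by move=> /RSpos_Pi[]. Qed.

Lemma root_sub_Pi S a (i : 'I_l) : in_RSpos br Pi S a -> ~ inNS Pi [set i] a -> i \in S ->
  a - Pi`_i \in Ws -> in_RSpos br Pi S (a - Pi`_i).
Proof.
move=> aS ai iS aiW; have n0 : a - Pi`_i != 0.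
  by apply/eqP => /eqP; rewrite subr_eq0 => /eqP E; apply: ai; rewrite E; apply: inNS_Pi; rewrite inE.
have r : is_root br (a - Pi`_i) by rewrite rootE n0.
have ZS : inZS Pi S (a - Pi`_i).
  by apply: inZSD; [exact: inNS_inZS aS.2 | apply: inZSN; exact: inNS_inZS (inNS_Pi iS)].
case: (RS_sign (conj r ZS)) => // -[_ H]; exfalso; apply: ai.
apply: (inNS_face _ aS.2 H); rewrite opprB addrC subrK.
by apply: inNS_Pi; rewrite inE.
Qed.

(** Let a_i be the simple root of index i. The weights b + n a_i with n >= 0 are stable under both
    of its root vectors, and its coroot takes the value 2n on each; trace 0 leaves only n = 0. *)
Lemma cross_root (D D' : {set 'I_l}) b (i : 'I_l) :
  (forall j k, j \in D -> k \in D' -> j != k /\ ~~ dyn_adj br Pi j k) ->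
  i \in D -> in_RSpos br Pi D' b -> b + Pi`_i \notin Ws.
Proof.
move=> DD iD bD'; apply/negP => biW.
have ri := root_Pi i; have [x [y [_ _ _ E2]]] := corootP ri.
have iD' : i \notin D' by apply/negP => iD'; have [] := DD i i iD iD'; rewrite eqxx.
have bi : ev b (coroot br Pi`_i) = 0.
  rewrite (ev_icomb _ (inNS_inZ bD'.2)) big1 // => j _.
  have [jD'|jD'] := boolP (j \in D').
    by have [ij nadj] := DD i j iD jD'; rewrite nonadj_ev // mulr0.
  by case/inNSP: bD'.2 => _ _ ->; rewrite // mul0r.
pose Q c (n : nat) := c = b + n%:R *: Pi`_i.
pose P c := asb (exists n, Q c n).
pose n c := epsilon (inhabits 0%N) (Q c).
have nP c : P c -> c = b + (n c)%:R *: Pi`_i.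
  by move/asbP => Qc; exact: (epsilon_spec (inhabits 0%N) _ Qc).
have PS c : P c -> P (c + Pi`_i).
  by move=> /asbP[m ->]; apply/asbP; exists m.+1; rewrite /Q -addrA -natr1 scalerDl scale1r.
have Pb : P b by apply/asbP; exists 0%N; rewrite /Q scale0r addr0.
have : \sum_(c <- Ws | P c) ev c (coroot br Pi`_i) = 0.
  apply: trace_coroot => // c cW Pc ciW; first exact: PS.
  move: Pc => /asbP[[|m] cE]; apply/asbP; last first.
    by exists m; rewrite /Q cE -natr1 scalerDl scale1r addrA addrK.
  (* The string has no weight below b: b - a_i would be a root with coefficients of both signs, as i
     is outside the support of b. *)
  exfalso; move: ciW; rewrite cE scale0r addr0 => biW'.
  have Zb := inNS_inZ bD'.2; have Zi := inZ_root ri.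
  have n0 : b - Pi`_i != 0.
    apply/eqP => /eqP; rewrite subr_eq0 => /eqP bE.
    by case/inNSP: bD'.2 => _ _ /(_ i iD'); rewrite bE icoef_Pi eqxx.
  have r : is_root br (b - Pi`_i) by rewrite rootE n0.
  case: (root_sign r) => /inNSP[_ H _]; last first.
    have [j jD' nz] := RSpos_cf_neq0 bD'.
    have := H j; rewrite opprB (icoefD j Zi (inZN Zb)) (icoefN j Zb) icoef_Pi.
    have -> : (j == i) = false by apply: contraNF iD' => /eqP <-.
    rewrite add0r oppr_ge0 => le; case/inNSP: bD'.2 => _ /(_ j) ge _.
    by case/eqP: nz; apply/eqP; rewrite eq_le le.
  have := H i; rewrite (icoefD i Zb (inZN Zi)) (icoefN i Zi) icoef_Pi eqxx.
  by case/inNSP: bD'.2 => _ _ ->.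
rewrite (eq_bigr (fun c => (n c * 2)%:R)); last first.
  by move=> c Pc; rewrite {1}(nP c Pc) evD evZ bi add0r E2 natrM.
rewrite -natr_sum => /eqP; rewrite natF_eq0 // sum_nat_seq_eq0 => /allP /(_ _ biW).
rewrite (PS _ Pb) /= muln_eq0 orbF => /eqP n0.
have := nP _ (PS _ Pb); rewrite n0 scale0r addr0 => /eqP; rewrite -subr_eq0 addrC addKr.
by rewrite (negPf (root_neq0 ri)).
Qed.

(* By a trace argument the sum of all mixed positive roots is orthogonal to the simple roots
   of [S], hence zero by [base_definite]. *)
Lemma root_component S (C : {set 'I_l}) a : C \subset S ->
  (forall j k, j \in C -> k \in S :\: C -> ~~ dyn_adj br Pi j k) ->
  in_RSpos br Pi S a -> inNS Pi C a \/ inNS Pi (S :\: C) a.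
Proof.
move=> CS nadj aS0; set C' := S :\: C in nadj *.
have C'S : C' \subset S by exact: subsetDl.
have cross j k : j \in C -> k \in C' -> j != k /\ ~~ dyn_adj br Pi j k.
  move=> jC kC'; split; last exact: nadj.
  by apply: contraTneq kC' => <-; rewrite inE jC.
have cross' j k : j \in C' -> k \in C -> j != k /\ ~~ dyn_adj br Pi j k.
  by move=> jC kC'; have [] := cross _ _ kC' jC; rewrite eq_sym dyn_adjC.
have SCC' i : i \in S -> i \in C \/ i \in C'.
  by move=> iS; rewrite inE iS andbT; case: (i \in C); [left | right].
apply: NNPP => mix; pose mixed a := in_RSpos br Pi S a /\ ~ (inNS Pi C a \/ inNS Pi C' a).
pose P a := asb (mixed a).
have Pa : P a by apply/asbP; split.
(* Mixed roots stay mixed when a simple root of [S] is added or subtracted: were b - a_i supported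
   on the part not containing i, [cross_root] would deny that b is a root. *)
have tr0 (i : 'I_l) : i \in S -> \sum_(b <- Ws | P b) ev b (coroot br Pi`_i) = 0.
  move=> iS; apply: trace_coroot => [|b bW /asbP[bS nb] biW|b bW /asbP[bS nb] biW].
  - exact: root_Pi.
  - apply/asbP; split; first by apply: RSpos_D => //; exact: RSpos_Pi.
    case=> H; apply: nb; [left | right]; exact: inNS_face H bS.2 (inNS_Pi iS).
  have bi : ~ inNS Pi [set i] b.
    move=> H; apply: nb; case: (SCC' i iS) => iC; [left | right]; apply: inNSS H;
    by rewrite sub1set.
  have biS := root_sub_Pi bS bi iS biW.
  have bE : b - Pi`_i + Pi`_i = b by rewrite subrK.
  apply/asbP; split=> //; case=> H; case: (SCC' i iS) => iC.
  - by apply: nb; left; rewrite -bE; apply: inNSD H _; exact: inNS_Pi.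
  - by have := cross_root cross' iC (conj biS.1 H); rewrite bE bW.
  - by have := cross_root cross iC (conj biS.1 H); rewrite bE bW.
  by apply: nb; right; rewrite -bE; apply: inNSD H _; exact: inNS_Pi.
pose c i := (\sum_(b <- Ws | P b) absz (icoef b i))%N.
have cE b i : P b -> (absz (icoef b i))%:Z = icoef b i.
  by move=> /asbP[[_ /inNSP[_ b0 _]] _]; rewrite gez0_abs.
have sE : icomb (fun i => (c i)%:Z) = \sum_(b <- Ws | P b) b.
  rewrite [RHS](eq_bigr (fun b => icomb (icoef b))); last first.
    by move=> b /asbP[[_ /inNS_inZ bZ] _]; exact: icoefE.
  rewrite /icomb exchange_big; apply: eq_bigr => i _ /=.
  rewrite -scaler_suml; congr (_ *: _); rewrite /c.
  rewrite -[LHS]/((\sum_(b <- Ws | P b) absz (icoef b i))%N%:R) natr_sum.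
  by apply: eq_bigr => b Pb; rewrite -{2}(cE b i Pb).
have evs (i : 'I_l) : i \in S -> ev (icomb (fun i => (c i)%:Z)) (coroot br Pi`_i) = 0.
  move=> /tr0 <-; rewrite sE.
  by elim/big_rec2: _ => [|b y1 y2 _ E]; rewrite ?ev0 // evD E.
have c0 i : i \notin S -> c i = 0%N.
  move=> iS; rewrite /c big1 // => b /asbP[[_ /inNSP[_ _ bS]] _].
  by rewrite bS.
have : forall i, c i = 0%N.
  apply: base_definite => i ci; apply: evs; apply: contraNT ci => iS; by rewrite c0.
have [i iS nz] := RSpos_cf_neq0 aS0.
move=> /(_ i) /eqP; rewrite sum_nat_seq_eq0 => /allP /(_ a (root_Ws aS0.1)).
by rewrite Pa /= absz_eq0 (negPf nz).
Qed.

Lemma compsP S (C : {set 'I_l}) : C \in comps br Pi S ->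
  exists2 i, i \in S & C = [set j in S | connect (adjS br Pi S) i j].
Proof. by move/imsetP. Qed.

Lemma comps_sub S (C : {set 'I_l}) : C \in comps br Pi S -> C \subset S.
Proof. by move=> /compsP[i iS ->]; apply/subsetP => j; rewrite inE => /andP[]. Qed.

Lemma comps_eq S (C D : {set 'I_l}) i : C \in comps br Pi S ->
  D \in comps br Pi S -> i \in C -> i \in D -> C = D.
Proof.
move=> /compsP[j jS ->] /compsP[k kS ->]; rewrite !inE => /andP[_ ji] /andP[_ ki].
apply/setP => m; rewrite !inE; congr (_ && _).
rewrite (same_connect (@adjS_sym S) ji).
by rewrite -(same_connect (@adjS_sym S) ki).
Qed.

Lemma root_comps S a : in_RSpos br Pi S a -> exists2 C, C \in comps br Pi S & in_RSpos br Pi C a.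
Proof.
move=> aS; have [i iS nz] := RSpos_cf_neq0 aS.
pose C := [set j in S | connect (adjS br Pi S) i j].
have CC : C \in comps br Pi S by apply/imsetP; exists i.
have iC : i \in C by rewrite inE iS connect0.
exists C => //; split; first exact: aS.1.
have [|//|/inNSP[_ _ H]] := root_component (comps_sub CC) _ aS.
  move=> j k; rewrite !inE => /andP[jS ij] /andP[nk kS].
  apply: contra nk => adj; rewrite kS /=; apply: connect_trans ij _.
  by apply: connect1; rewrite /adjS jS kS.
by case/eqP: nz; apply: H; rewrite inE iC.
Qed.

(** * Highest roots *)

Section Highest.
Variable K : {set 'I_l}.
Hypothesis conK : connectedS br Pi K.
Let e := highest br Pi K.

Lemma highest_ge a : in_RS br Pi K a -> inNS Pi K (e - a).
Proof. exact: (highestP conK).2. Qed.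

Lemma highest_pos : in_RSpos br Pi K e.
Proof.
have [eK _] := highestP conK; case: (RS_sign eK) => // -[r Ne].
have := highest_ge (RS_N eK); rewrite opprK => H.
have := inNS_anti H (T := K); rewrite opprD => /(_ (inNSD Ne Ne)) /eqP.
rewrite -mulr2n -scaler_nat scaler_eq0 (negPf F2_neq0) /= => /eqP e0.
by have := root_neq0 eK.1; rewrite -/e e0 eqxx.
Qed.

Lemma highest_max a : in_RSpos br Pi K a -> a + e \notin Ws.
Proof.
move=> aK; apply/negP => aeW.
have H := highest_ge (RSpos_RS (RSpos_D aK highest_pos aeW)).
have := root_neq0 aK.1; rewrite (inNS_anti aK.2 (T := K)) ?eqxx //.
by move: H; rewrite opprD addrCA subrr addr0.
Qed.

(** Neither a + e nor a - 2e is a weight, so the string of a is contained in {a, a - e}; trace 0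
    gives the value 0 or 1. *)
Lemma pair_highest a : in_RSpos br Pi K a -> a != e ->
  ev a (coroot br e) = (a - e \in Ws)%:R.
Proof.
move=> aK ae; have eK := highest_pos; have [x [y [_ _ _ E2]]] := corootP eK.1.
have e0 := root_neq0 eK.1.
pose P c := (c == a) || (c == a - e).
have aNe : (a - e == a) = false by rewrite -subr_eq0 addrC addKr oppr_eq0 (negPf e0).
have aeW := highest_max aK.
have ge_a : inNS Pi K (e - a) by apply: highest_ge; exact: RSpos_RS.
have : \sum_(c <- Ws | P c) ev c (coroot br e) = 0.
  apply: trace_coroot eK.1 _ _ => c cW /orP[/eqP->|/eqP->].
  - by rewrite (negPf aeW).
  - by rewrite subrK /P eqxx.
  - by rewrite /P eqxx orbT.
  (* If a - 2e were a root, maximality of e over 2e - a would put a - e, besides e - a, among the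
     nonnegative combinations, so a = e. *)
  move=> bad; exfalso; case/negP: ae; apply/eqP.
  have [Z|nz] := eqVneq (a - e - e) 0.
    have aE : a = e + e by apply/eqP; rewrite -subr_eq0 opprD addrA Z.
    by move: ge_a; rewrite aE opprD addrA subrr sub0r => /(inNS_anti eK.2) /eqP; rewrite (negPf e0).
  have r : in_RS br Pi K (a - e - e).
    split; first by rewrite rootE nz.
    have eZ := inNS_inZS eK.2; have aZ := inNS_inZS aK.2.
    by apply: inZSD (inZSD aZ _) _; exact: inZSN.
  have := highest_ge (RS_N r); rewrite opprK addrC subrK => H.
  have /eqP E : e - a = 0 by apply: (inNS_anti ge_a (T := K)); rewrite opprB.
  by apply/esym/eqP; rewrite -subr_eq0.
have pb : perm_eq (filter P Ws) (a :: (if a - e \in Ws then [:: a - e] else [::])).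
  apply: uniq_perm => [||c]; first exact: filter_uniq.
    by case: ifP; rewrite //= inE eq_sym aNe.
  rewrite mem_filter inE /P; have [->|ca] /= := eqVneq c a.
    by rewrite root_Ws // aK.1.
  have [->|ce] /= := eqVneq c (a - e); last first.
    by case: ifP; rewrite ?inE ?(negPf ce).
  by case: ifP; rewrite ?inE ?eqxx.
rewrite -big_filter (perm_big _ pb) big_cons; case: ifP => _ /=; last by rewrite big_nil addr0.
rewrite big_seq1 evD evN E2 addrA => /eqP; rewrite subr_eq0 => /eqP H.
by apply: (mulfI F2_neq0); rewrite mulr1 -[RHS]H mulrDl mul1r.
Qed.

Lemma pair_highest_nat a : in_RSpos br Pi K a -> exists n : nat, ev a (coroot br e) = n%:R.
Proof.
move=> aK; have [->|ae] := eqVneq a e.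
  by have [x [y [_ _ _ ->]]] := corootP highest_pos.1; exists 2%N.
by rewrite pair_highest //; exists (a - e \in Ws).
Qed.

Definition orthK := [set i in K | pairing br Pi`_i e == 0].

(** The value of a on the coroot of e is a sum of products of natural numbers, so each simple root
    in the support of a is orthogonal to e. *)
Lemma orthK_pos a : in_RSpos br Pi K a -> ev a (coroot br e) = 0 -> in_RSpos br Pi orthK a.
Proof.
move=> aK; have [ra /inNSP[aZ a0 aS]] := aK; rewrite (ev_icomb _ aZ) => E.
split=> //; apply/inNSP; split=> // i; rewrite inE negb_and => /orP[/aS//|nz].
have [iK|/aS//] := boolP (i \in K).
pose n i := epsilon (inhabits 0%N) (fun n : nat => ev Pi`_i (coroot br e) = n%:R).
have nP (j : 'I_l) : j \in K -> ev Pi`_j (coroot br e) = (n j)%:R.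
  by move=> jK; exact: (epsilon_spec (inhabits 0%N) _ (pair_highest_nat (RSpos_Pi jK))).
have : (\sum_j (absz (icoef a j) * (if j \in K then n j else 0)))%N = 0%N.
  apply: (natF_inj char0); rewrite natr_sum -[RHS]E; apply: eq_bigr => j _.
  rewrite natrM -[in RHS](gez0_abs (a0 j)); case: ifP => [jK|/negbT/aS ->]; last by rewrite mulr0 /= mul0r.
  by rewrite nP.
move/eqP; rewrite sum_nat_eq0 => /forallP /(_ i); rewrite /= iK muln_eq0 absz_eq0.
case/orP => [/eqP//|/eqP n0]; case/negP: nz; rewrite /pairing -/(ev _ _).
by rewrite nP // n0.
Qed.

Lemma orthK_ev a : inNS Pi orthK a -> ev a (coroot br e) = 0.
Proof.
move=> /inNSP[aZ _ aS]; rewrite (ev_icomb _ aZ) big1 // => i _.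
have [|iK] := boolP (i \in orthK); last by rewrite aS // mul0r.
by rewrite inE => /andP[_ /eqP]; rewrite /pairing -/(ev _ _) => ->; rewrite mulr0.
Qed.

Lemma orthK_lt : (#|orthK| < #|K|)%N.
Proof.
apply: proper_card; apply/properP; split.
  by apply/subsetP => i; rewrite inE => /andP[].
have [i iK nz] := root_coroot_Pi (RSpos_RS highest_pos).
by exists i => //; rewrite inE iK /pairing -/(ev _ _).
Qed.

End Highest.

(** * Kostant's cascade *)

Notation hi := (highest br Pi).

(** The roots of the Heisenberg algebra whose centre is the root space of e_K. *)
Definition inGamma (K : {set 'I_l}) a := in_RSpos br Pi K a /\ ev a (coroot br (hi K)) != 0.

(** These Heisenberg sets partition the positive roots of [S]. For connected [S], a root not
    orthogonal to e_S is in the set of [S] itself, and one orthogonal to it is supported on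
    [orthK S]; otherwise it belongs to one component. *)
Lemma Kf_cascade n S : (#|S| <= n)%N ->
  [/\ forall K, K \in Kf br Pi n S -> K \subset S /\ connectedS br Pi K,
      forall a, in_RSpos br Pi S a -> exists2 K, K \in Kf br Pi n S & inGamma K a &
      forall K K' a, K \in Kf br Pi n S -> K' \in Kf br Pi n S ->
        inGamma K a -> inGamma K' a -> K = K'].
Proof.
elim: n S => [|n IH] S leS.
  have S0 : S = set0 by apply/eqP; rewrite -cards_eq0 -leqn0.
  split=> [K|a aS|K K' a]; rewrite /= ?inE //.
  by have [i] := RSpos_cf_neq0 aS; rewrite S0 inE.
rewrite /=; case: ifP => conS.
  pose S' := orthK S; rewrite -/(orthK S) -/S'.
  have [|sub cov dis] := IH S'; first by rewrite -ltnS (leq_trans (orthK_lt conS)).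
  have S'S : S' \subset S by apply/subsetP => i; rewrite inE => /andP[].
  have excl K a : K \in Kf br Pi n S' -> inGamma K a -> inGamma S a -> False.
    move=> /sub[KS' _] [aK _] [_ /eqP]; apply; apply: orthK_ev => //.
    exact: inNSS KS' aK.2.
  split=> [K|a aS|K K' a].
  - rewrite !inE => /predU1P[->|/sub[KS' conK]]; first by rewrite subxx conS.
    by split=> //; exact: subset_trans KS' S'S.
  - have [E|nz] := eqVneq (ev a (coroot br (hi S))) 0.
      have [K KS' aK] := cov a (orthK_pos conS aS E).
      by exists K => //; rewrite !inE KS' orbT.
    by exists S; rewrite ?setU11.
  rewrite !inE => /predU1P[->|KS'] /predU1P[->|KS''] aK aK' //.
  - by case: (excl K' a).
  - by case: (excl K a).
  exact: dis aK aK'.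
(* Components of a disconnected [S] are proper, so the decreased fuel still suffices. *)
have ltC C : C \in comps br Pi S -> (#|C| <= n)%N.
  move=> CC; rewrite -ltnS (leq_trans _ leS) // ltnNge; apply/negP => leSC.
  have /eqP CS : C == S by rewrite eqEcard comps_sub.
  case/negP: (negbT conS); rewrite /connectedS.
  have -> : comps br Pi S = [set S]; last by rewrite cards1.
  rewrite -CS; apply/setP => D; rewrite inE; apply/idP/eqP => [DC|->]; last by rewrite CS in CC *.
  rewrite CS in DC; have /compsP[i iS DE] := DC.
  by apply: (comps_eq DC CC (i := i)); rewrite ?CS // DE inE iS connect0.
split=> [K|a aS|K K' a].
- case/bigcupP => C CC KC; have [sub _ _] := IH C (ltC C CC).
  have [KC' conK] := sub K KC; split=> //.
  exact: subset_trans KC' (comps_sub CC).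
- have [C CC aC] := root_comps aS; have [_ cov _] := IH C (ltC C CC).
  by have [K KC aK] := cov a aC; exists K => //; apply/bigcupP; exists C.
case/bigcupP => C CC KC /bigcupP[D DD KD] aK aK'.
have [subC _ disC] := IH C (ltC C CC); have [subD _ _] := IH D (ltC D DD).
have [CD|nCD] := eqVneq C D; first by apply: disC aK aK'; rewrite ?CD // -CD.
exfalso; have [KC' _] := subC K KC; have [KD' _] := subD K' KD.
apply: (RSpos_disj (conj aK.1.1 (inNSS KC' aK.1.2)) (inNSS KD' aK'.1.2)).
rewrite disjoint_subset; apply/subsetP => i iC; rewrite inE; apply/negP => iD.
by case/eqP: nCD; exact: comps_eq CC DD iC iD.
Qed.

Lemma Kset_cascade S :
  [/\ forall K, K \in Kset br Pi S -> K \subset S /\ connectedS br Pi K,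
      forall a, in_RSpos br Pi S a -> exists2 K, K \in Kset br Pi S & inGamma K a &
      forall K K' a, K \in Kset br Pi S -> K' \in Kset br Pi S ->
        inGamma K a -> inGamma K' a -> K = K'].
Proof. exact: Kf_cascade. Qed.

Definition is_cascade S a := a \in [seq hi K | K <- enum (Kset br Pi S)].

Lemma is_cascadeP S a : reflect (exists2 K, K \in Kset br Pi S & a = hi K) (is_cascade S a).
Proof.
apply: (iffP mapP) => -[K]; first by rewrite mem_enum => KS ->; exists K.
by move=> KS ->; exists K; rewrite ?mem_enum.
Qed.

Lemma is_cascade_pos S a : is_cascade S a -> in_RSpos br Pi S a.
Proof.
case/is_cascadeP => K KS ->; have [sub _ _] := Kset_cascade S; have [KS' conK] := sub K KS.
have [r H] := highest_pos conK; split=> //; exact: inNSS KS' H.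
Qed.

Lemma hi_gamma K : connectedS br Pi K -> inGamma K (hi K).
Proof.
move=> conK; split; first exact: highest_pos.
have [x [y [_ _ _ ->]]] := corootP (highest_pos conK).1; exact: F2_neq0.
Qed.

Lemma gamma_sum S K a b : K \in Kset br Pi S -> in_RSpos br Pi S a -> in_RSpos br Pi S b ->
  a + b = hi K -> inGamma K a /\ a != hi K.
Proof.
move=> KS aS bS E; have [sub _ _] := Kset_cascade S; have [_ conK] := sub K KS.
have hK := highest_pos conK.
have aK : in_RSpos br Pi K a.
  split; first exact: aS.1.
  by apply: inNS_face aS.2 bS.2; rewrite E; exact: hK.2.
have nE : a != hi K.
  by rewrite -E -subr_eq0 opprD addrA subrr sub0r oppr_eq0 (root_neq0 bS.1).
split=> //; split=> //; rewrite pair_highest // -E opprD addrA subrr sub0r.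
by rewrite WsN ?root_Ws ?bS.1 // oner_neq0.
Qed.

(** The partner is e_K - a, for the only K whose Heisenberg set contains a. Any b' with a + b' =
    e_K' puts a in the set of K', which gives K' = K. *)
Lemma partner S a : in_RSpos br Pi S a -> ~~ is_cascade S a -> exists b,
  [/\ in_RSpos br Pi S b, ~~ is_cascade S b, is_cascade S (a + b) &
      forall b', in_RSpos br Pi S b' -> is_cascade S (a + b') -> b' = b].
Proof.
move=> aS aE; have [sub cov dis] := Kset_cascade S.
have [K KS aK] := cov a aS; have [KS' conK] := sub K KS.
have nE : a != hi K by apply: contra aE => /eqP ->; apply/is_cascadeP; exists K.
have hK := highest_pos conK.
have := aK.2; rewrite (pair_highest conK aK.1 nE).
have [aeW _|_] := boolP (a - hi K \in Ws); last by rewrite eqxx.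
have bK : in_RSpos br Pi K (hi K - a).
  have r : is_root br (hi K - a) by rewrite rootE subr_eq0 eq_sym nE -opprB WsN.
  split=> //; apply: highest_ge => //; apply: RSpos_RS; exact: aK.1.
have bS : in_RSpos br Pi S (hi K - a) by split; [exact: bK.1 | exact: inNSS KS' bK.2].
have abE : a + (hi K - a) = hi K by rewrite addrC subrK.
have baE : (hi K - a) + a = hi K by rewrite subrK.
exists (hi K - a); split=> //.
- apply/is_cascadeP => -[K' KS2 E]; have [_ conK'] := sub K' KS2.
  have [gb _] := gamma_sum KS bS aS baE.
  have KK' : K' = K by apply: (dis _ _ (hi K')) => //; [exact: hi_gamma | rewrite -E].
  move: E; rewrite KK' => /eqP; rewrite subr_eq addrC -subr_eq0 opprD addrCA subrr addr0 oppr_eq0.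
  by rewrite (negPf (root_neq0 aS.1)).
- by rewrite abE; apply/is_cascadeP; exists K.
move=> b' b'S /is_cascadeP[K' KS2 E]; have [ga _] := gamma_sum KS2 aS b'S E.
by rewrite (dis K K' a KS KS2 aK ga) -E addrC addKr.
Qed.

(** By invariance the value is kappa([z, x], y); [br_neq0] gives [z, x] != 0, and kappa pairs the
    opposite root lines perfectly. *)
Lemma pair_neq0 S a b x y z : in_RSpos br Pi S a -> in_RSpos br Pi S b -> is_cascade S (a + b) ->
  x \in g a -> x != 0 -> y \in g b -> y != 0 -> z \in g (- (a + b)) -> z != 0 ->
  kappa z (br x y) != 0.
Proof.
move=> aS bS /is_cascadeP[K KS E] xa x0 yb y0 icomb z0.
have [sub _ _] := Kset_cascade S; have [_ conK] := sub K KS.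
have [ga _] := gamma_sum KS aS bS E; have hK := highest_pos conK.
rewrite -kappa_inv; rewrite E in icomb.
have w0 : br z x != 0.
  apply: (br_neq0 (a := hi K) (b := a)) => //; [exact: hK.1 | exact: highest_max ga.1 | exact: ga.2].
have wb : br z x \in g (- b).
  have -> : - b = - hi K + a by rewrite -E opprD addrAC addNr sub0r.
  exact: rootsp_br.
have [y' y'b nz] := rootsp_pair wb w0.
rewrite opprK in y'b; have [k yE] := rootsp_line bS.1 yb y0 y'b.
by apply: contraNneq nz => Z; rewrite yE linearZ /= Z mulr0.
Qed.

Lemma pair_neq0N S a b x y z : in_RSpos br Pi S a -> in_RSpos br Pi S b -> is_cascade S (a + b) ->
  x \in g (- a) -> x != 0 -> y \in g (- b) -> y != 0 -> z \in g (a + b) -> z != 0 ->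
  kappa z (br x y) != 0.
Proof.
move=> aS bS /is_cascadeP[K KS E] xa x0 yb y0 icomb z0.
have [sub _ _] := Kset_cascade S; have [_ conK] := sub K KS.
have [ga _] := gamma_sum KS aS bS E; have hK := highest_pos conK.
rewrite -kappa_inv; rewrite E in icomb.
have w0 : br z x != 0.
  apply: (br_neq0 (a := - hi K) (b := - a)); rewrite ?opprK //; first exact: rootN hK.1.
    by rewrite -opprD; apply: contra (highest_max conK ga.1) => /WsN; rewrite opprK.
  rewrite (pair_sym0 (rootN aS.1) (rootN hK.1)) evN oppr_eq0.
  by rewrite (pair_sym0 hK.1 (rootN aS.1)) evN oppr_eq0; exact: ga.2.
have wb : br z x \in g b.
  have -> : b = hi K + - a by rewrite -E addrAC subrr add0r.
  exact: rootsp_br.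
have [y' y'b nz] := rootsp_pair wb w0.
have [k yE] := rootsp_line (rootN bS.1) yb y0 y'b.
by apply: contraNneq nz => Z; rewrite yE linearZ /= Z mulr0.
Qed.

(** * The functional and its stabiliser *)

Section Index.
Variables S T : {set 'I_l}.

Definition is_nonhigh a := (in_RSpos br Pi S a /\ ~~ is_cascade S a) \/
  (in_RSpos br Pi T (- a) /\ ~~ is_cascade T (- a)).
Definition nonhigh : seq hd := [seq a <- Ws | asb (is_nonhigh a)].
Definition root_vec a : L := vpick (g a).

Lemma mem_nonhigh a : a \in nonhigh -> is_nonhigh a.
Proof. by rewrite mem_filter => /andP[/asbP]. Qed.

Lemma root_vec_in a : root_vec a \in g a. Proof. exact: memv_pick. Qed.
Lemma root_vec_neq0 a : is_root br a -> root_vec a != 0.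
Proof. by move=> /andP[_]; rewrite /root_vec vpick0. Qed.

Lemma nonhigh_root a : is_nonhigh a -> is_root br a.
Proof. by case=> -[[r _] _] //; rewrite -[a]opprK; exact: rootN. Qed.

Lemma nonhigh_mem a : is_nonhigh a -> a \in nonhigh.
Proof. by move=> Va; rewrite mem_filter root_Ws ?nonhigh_root // andbT; apply/asbP. Qed.

Lemma RSpos_notneg S' T' a : in_RSpos br Pi S' a -> in_RSpos br Pi T' (- a) -> False.
Proof. by move=> [r H] [_ HN]; case/eqP: (root_neq0 r); exact: inNS_anti H HN. Qed.

Definition abs_height a : nat := absz (height a).

Lemma height_nonhigh a : is_nonhigh a -> inZ a /\
  ((in_RSpos br Pi S a /\ height a = (abs_height a)%:Z) \/
   (in_RSpos br Pi T (- a) /\ height a = - (abs_height a)%:Z)).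
Proof.
move=> Va; have aZ := inZ_root (nonhigh_root Va); split=> //.
case: Va => -[H _]; [left | right]; split=> //.
  by rewrite /abs_height gez0_abs // (height_ge0 H.2).
have hN : height (- a) = - height a by rewrite /height -sumrN; apply: eq_bigr => i _; rewrite icoefN.
by have := height_ge0 H.2; rewrite hN oppr_ge0 /abs_height => le; rewrite lez0_abs // opprK.
Qed.

Lemma abs_height_gt0 a : is_nonhigh a -> (0 < abs_height a)%N.
Proof.
move=> Va; have [aZ _] := height_nonhigh Va; rewrite /abs_height absz_gt0; have ra := root_neq0 (nonhigh_root Va).
case: Va => -[H _]; first by rewrite gt_eqF // (height_gt0 H.2).
have hN : height (- a) = - height a by rewrite /height -sumrN; apply: eq_bigr => i _; rewrite icoefN.
by rewrite -oppr_eq0 -hN gt_eqF // (height_gt0 H.2) // oppr_eq0.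
Qed.

Definition same_sign a b := (in_RSpos br Pi S a /\ in_RSpos br Pi S b) \/
  (in_RSpos br Pi T (- a) /\ in_RSpos br Pi T (- b)).

(** Heights of these roots are nonzero with the sign of the root. The inequality makes the exponents
    of [pcoef_mx] true differences; the equality case tells which entries survive at 0. *)
Lemma abs_heightD a b : is_nonhigh a -> is_nonhigh b ->
  (abs_height (a + b)%R <= abs_height a + abs_height b)%N /\
  (abs_height (a + b) == (abs_height a + abs_height b)%N) = asb (same_sign a b).
Proof.
move=> Va Vb; have [aZ Ha] := height_nonhigh Va; have [bZ Hb] := height_nonhigh Vb.
have wa := abs_height_gt0 Va; have wb := abs_height_gt0 Vb.
have -> : abs_height (a + b) = absz (height a + height b) by rewrite /abs_height heightD.
move: (abs_height a) (abs_height b) wa wb Ha Hb => m n m0 n0 Ha Hb.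
case: Ha => -[Ra ->]; case: Hb => -[Rb ->]; split; try lia.
- by transitivity true; [lia | apply/esym/asbP; left].
- transitivity false; first lia.
  by apply/esym/asbP => -[[_ H]|[H _]]; [exact: RSpos_notneg H Rb | exact: RSpos_notneg Ra H].
- transitivity false; first lia.
  by apply/esym/asbP => -[[H _]|[_ H]]; [exact: RSpos_notneg H Ra | exact: RSpos_notneg Rb H].
by transitivity true; [lia | apply/esym/asbP; right].
Qed.

(** Duplicates are removed so that sums over it have one term per root; [dim_E'] asks only for an
    upper bound on its size. *)
Definition cascS := undup [seq hi K | K <- enum (Kset br Pi S)].
Definition cascT := undup [seq hi K | K <- enum (Kset br Pi T)].

Lemma mem_cascS a : (a \in cascS) = is_cascade S a. Proof. by rewrite mem_undup. Qed.
Lemma mem_cascT a : (a \in cascT) = is_cascade T a. Proof. by rewrite mem_undup. Qed.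

Lemma root_cascS a : a \in cascS -> in_RSpos br Pi S a.
Proof. by rewrite mem_cascS; exact: is_cascade_pos. Qed.
Lemma root_cascT a : a \in cascT -> in_RSpos br Pi T a.
Proof. by rewrite mem_cascT; exact: is_cascade_pos. Qed.

(** The entry of the Gram matrix of f([x, y]) with its power of t stripped off. *)
Definition pcoef a b : F := if (a + b \in cascS) || (- (a + b) \in cascT)
  then kappa (root_vec (- (a + b))) (br (root_vec a) (root_vec b)) else 0.

(** [partner] transcribed to signed roots: the same-sign part of the Gram matrix is monomial. *)
Lemma pcoef_partner a : is_nonhigh a -> exists b, [/\ is_nonhigh b, same_sign a b, pcoef a b != 0 &
  forall b', is_nonhigh b' -> same_sign a b' -> pcoef a b' != 0 -> b' = b].
Proof.
case=> -[aS aE].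
  have [b [bS bE abE uniqb]] := partner aS aE; exists b; split=> //; [by left | by left | |].
    rewrite /pcoef mem_cascS abE /=; apply: (pair_neq0 aS bS abE); rewrite ?root_vec_in ?root_vec_neq0 ?aS.1 ?bS.1 //.
    by apply: rootN; exact: (is_cascade_pos abE).1.
  move=> b' _ [[_ b'S]|[H _]]; last by case: (RSpos_notneg aS H).
  rewrite /pcoef; case: ifP => [/orP[|]|_]; last by rewrite eqxx.
    by rewrite mem_cascS => H _; exact: uniqb.
  (* A sum of two positive roots is not negative, so it cannot come from the cascade of [T]. *)
  move/root_cascT => H; case: (RSpos_notneg _ H (S' := S)).
  have ab : is_root br (a + b') by rewrite -[a + b']opprK; apply: rootN; exact: H.1.
  by apply: RSpos_D => //; exact: root_Ws.
have [b [bS bE abE uniqb]] := partner aS aE; exists (- b).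
have Vb : is_nonhigh (- b) by right; rewrite opprK.
have rab : is_root br (a - b) by rewrite -[a - b]opprK; apply: rootN; rewrite opprB addrC (is_cascade_pos abE).1.
have NabE : - (a - b) = - a + b by rewrite opprB addrC.
split=> //; first by right; rewrite opprK.
  rewrite /pcoef mem_cascT NabE abE orbT.
  have ra : is_root br a by rewrite -[a]opprK; exact: rootN aS.1.
  by apply: (pair_neq0N aS bS abE); rewrite ?opprK ?root_vec_in // root_vec_neq0 //;
    [exact: rootN bS.1 | exact: (is_cascade_pos abE).1].
move=> b' _ [[H _]|[_ b'S]]; first by case: (RSpos_notneg H aS).
rewrite /pcoef; case: ifP => [/orP[|]|_]; last by rewrite eqxx.
  move/root_cascS => H; case: (RSpos_notneg H (T' := T)).
  by rewrite opprD; apply: RSpos_D => //; rewrite -opprD WsN ?root_Ws //; exact: H.1.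
by rewrite mem_cascT opprD => H _; rewrite -[b']opprK (uniqb (- b')).
Qed.

Lemma pcoefC a b : pcoef a b = - pcoef b a.
Proof.
by rewrite /pcoef [b + a]addrC brC; case: ifP; rewrite ?oppr0 // linearN.
Qed.

Lemma same_signC a b : same_sign a b -> same_sign b a.
Proof. by case=> -[Ha Hb]; [left | right]. Qed.

Lemma abs_heightN a : inZ a -> abs_height (- a) = abs_height a.
Proof.
by move=> aZ; rewrite /abs_height /height (eq_bigr (fun i => - icoef a i)) ?sumrN ?abszN // => i _; rewrite icoefN.
Qed.

Definition uvec t : L :=
  \sum_(e <- cascS) t ^+ abs_height e *: root_vec (- e) +
  \sum_(e <- cascT) t ^+ abs_height e *: root_vec e.

Lemma big_uniq_single (I : eqType) (s : seq I) (f : I -> F) (k : I) : uniq s ->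
  (forall e, e \in s -> e != k -> f e = 0) -> \sum_(e <- s) f e = if k \in s then f k else 0.
Proof.
move=> us H; case: ifP => [cs|ncs].
  by rewrite (bigD1_seq k) //= big_seq_cond big1 ?addr0 // => e /andP[es ec]; exact: H.
rewrite big_seq big1 // => e es; apply: H => //.
by apply: contraFneq ncs => <-.
Qed.

Lemma kappa_u t c z : z \in g c -> kappa (uvec t) z =
  (if c \in cascS then t ^+ abs_height c * kappa (root_vec (- c)) z else 0) +
  (if - c \in cascT then t ^+ abs_height (- c) * kappa (root_vec (- c)) z else 0).
Proof.
move=> zc; rewrite kappaC linearD !linear_sum /=; congr (_ + _).
  rewrite (@big_uniq_single _ cascS _ c) ?undup_uniq // => [|e eE ec].
    by case: ifP => // _; rewrite linearZ /= kappaC.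
  rewrite linearZ /= kappaC (rootsp_orth (a := - e) (b := c)) ?mulr0 ?root_vec_in //.
  by rewrite addrC subr_eq0 eq_sym.
rewrite (@big_uniq_single _ cascT _ (- c)) ?undup_uniq // => [|e eE ec].
  by case: ifP => // _; rewrite linearZ /= kappaC.
by rewrite linearZ /= kappaC (rootsp_orth (a := e) (b := c)) ?mulr0 ?root_vec_in // addr_eq0.
Qed.

Lemma kappa_u_br t a b :
  kappa (uvec t) (br (root_vec a) (root_vec b)) = t ^+ abs_height (a + b) * pcoef a b.
Proof.
rewrite (kappa_u t (rootsp_br (root_vec_in a) (root_vec_in b))) /pcoef.
case: ifP => /= cS; case: ifP => cT.
- by case: (RSpos_notneg (root_cascS cS) (root_cascT cT)).
- by rewrite addr0.
- by rewrite add0r abs_heightN // -[a + b]opprK; apply: inZN; apply: inZ_root; case: (root_cascT cT).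
by rewrite addr0 mulr0.
Qed.

Let n := size nonhigh.
Let q (i : 'I_n) : hd := nonhigh`_i.

Let qV i : is_nonhigh (q i). Proof. by apply: mem_nonhigh; rewrite mem_nth. Qed.
Let q_inj i j : q i = q j -> i = j.
Proof.
by move=> /eqP; rewrite nth_uniq ?filter_uniq // => /eqP /val_inj.
Qed.

(* The Gram matrix rescaled by powers of s = 1/t: entries with a, b of the same sign are
   constant, and all the others vanish at s = 0. *)
Definition pcoef_mx : 'M[{poly F}]_n :=
  \matrix_(i, j) (pcoef (q i) (q j) *:
    'X^(abs_height (q i) + abs_height (q j) - abs_height (q i + q j)%R)).

Lemma horner_pcoef_mx s i j : map_mx (horner_eval s) pcoef_mx i j =
  pcoef (q i) (q j) * s ^+ (abs_height (q i) + abs_height (q j) - abs_height (q i + q j)%R).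
Proof. by rewrite !mxE /horner_eval hornerZ hornerXn. Qed.

Lemma pcoef_mx0 i j : map_mx (horner_eval 0) pcoef_mx i j =
  if asb (same_sign (q i) (q j)) then pcoef (q i) (q j) else 0.
Proof.
rewrite horner_pcoef_mx; have [le <-] := abs_heightD (qV i) (qV j).
rewrite expr0n subn_eq0 eqn_leq le /=; case: leqP => _; first by rewrite mulr1.
by rewrite mulr0.
Qed.

(** In a row vector v of the left kernel, the column of the partner of i retains only the term of i,
    so [v i] vanishes. *)
Lemma det_pcoef_mx0 : \det (map_mx (horner_eval (0 : F)) pcoef_mx) != 0.
Proof.
apply/det0P => -[v v0 vM]; case/eqP: v0; apply/rowP => i; rewrite mxE.
have [b [Vb ss nz _]] := pcoef_partner (qV i).
have bQ := nonhigh_mem Vb; have ltb : (index b nonhigh < n)%N by rewrite index_mem.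
pose j := Ordinal ltb; have qj : q j = b by rewrite /q nth_index.
have := congr1 (fun w : 'rV_n => w 0 j) vM; rewrite !mxE (bigD1 i) //= big1 => [|k ki].
  rewrite addr0 pcoef_mx0 qj (introT (asbP _) ss) => /eqP.
  by rewrite mulf_eq0 (negPf nz) orbF => /eqP.
rewrite pcoef_mx0; case: ifP => [/asbP sk|_]; last by rewrite mulr0.
have [->|Nk] := eqVneq (pcoef (q k) (q j)) 0; first by rewrite mulr0.
have [c [Vc _ _ uc]] := pcoef_partner (qV j).
have Nn x y : (pcoef x y != 0) = (pcoef y x != 0) by rewrite pcoefC oppr_eq0.
have ki' : q k = q i.
  have Nkj : pcoef (q j) (q k) != 0 by rewrite Nn.
  have Nij : pcoef (q j) (q i) != 0 by rewrite Nn qj.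
  have sij : same_sign (q j) (q i) by rewrite qj; exact: same_signC.
  by rewrite (uc _ (qV k) (same_signC sk) Nkj) (uc _ (qV i) sij Nij).
by rewrite (q_inj ki') eqxx in ki.
Qed.

Lemma exists_nondegenerate : exists2 t, t != 0 & forall c : hd -> F,
  (forall b, b \in nonhigh -> \sum_(a <- nonhigh) c a * kappa (uvec t) (br (root_vec a) (root_vec b)) = 0) ->
  forall a, a \in nonhigh -> c a = 0.
Proof.
pose p := \det pcoef_mx.
have p0 : p != 0.
  apply: contra det_pcoef_mx0 => /eqP E.
  by rewrite -[X in \det X]/(map_mx (horner_eval 0) pcoef_mx) det_map_mx /= -/p E /horner_eval horner0.
(* The factor X keeps s away from 0, so that t = 1/s exists. *)
have [s] : exists s, ~~ root (p * 'X) s.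
  by apply/closed_nonrootP; rewrite mulf_neq0 // polyX_eq0.
rewrite rootM negb_or rootX => /andP[ps s0]; exists s^-1; first by rewrite invr_eq0.
move=> c Hc a aQ; set t := s^-1 in Hc.
have lta : (index a nonhigh < n)%N by rewrite index_mem.
have qa : q (Ordinal lta) = a by rewrite /q nth_index.
(* Rows are rescaled through v by powers of t and column j by a power of s, which turns the
   relations on [c] into membership of v in the left kernel at s. *)
pose v : 'rV[F]_n := \row_i (c (q i) * t ^+ abs_height (q i)).
have dn : \det (map_mx (horner_eval s) pcoef_mx) != 0.
  by rewrite det_map_mx /= /horner_eval -/p -/(root p s).
have v0 : v = 0.
  apply/eqP; apply/negPn/negP => vn; case/negP: dn; apply/det0P; exists v => //.
  apply/rowP => j; rewrite !mxE.
  have := Hc (q j) (nonhigh_mem (qV j)); rewrite (big_nth 0) big_mkord => E.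
  transitivity (s ^+ abs_height (q j) * \sum_(i < n) c (q i) * kappa (uvec t) (br (root_vec (q i)) (root_vec (q j)))); last first.
    by rewrite E mulr0.
  rewrite mulr_sumr; apply: eq_bigr => i _.
  rewrite !mxE /horner_eval hornerZ hornerXn kappa_u_br.
  have [le _] := abs_heightD (qV i) (qV j); set w := abs_height (q i + q j) in le *.
  have st k : t ^+ k * s ^+ k = 1 by rewrite -exprMn mulVf // expr1n.
  have E2 : s ^+ (abs_height (q i) + abs_height (q j) - w) = s ^+ abs_height (q i) * s ^+ abs_height (q j) * t ^+ w.
    by rewrite -exprD -{2}(subnK le) exprD -mulrA [s ^+ w * _]mulrC st mulr1.
  rewrite E2 -!mulrA [RHS]mulrCA; congr (_ * _).
  by rewrite [pcoef _ _ * _]mulrC !mulrA st mul1r.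
have := congr1 (fun w : 'rV_n => w 0 (Ordinal lta)) v0; rewrite !mxE qa => /eqP.
by rewrite mulf_eq0 expf_eq0 invr_eq0 (negPf s0) andbF orbF => /eqP.
Qed.

(** * The subalgebra g_(S,T) and its decomposition *)

Variable Rs : seq hd.
Hypothesis Rs_roots : forall a, (a \in Rs) = is_root br a.
Let A := gST br Pi Rs S T.

Definition inA a := [\/ a = 0, in_RSpos br Pi S a | in_RSpos br Pi T (- a)].

Lemma inA_Ws a : inA a -> a \in Ws.
Proof.
case=> [->|[/root_Ws//]|[/root_Ws/WsN + _]]; first by rewrite WsE eqxx.
by rewrite opprK.
Qed.

Lemma big_addv_cond_sub (s : seq hd) (P : pred hd) (V : {vspace L}) :
  (forall a, a \in s -> P a -> (g a <= V)%VS) -> (\sum_(a <- s | P a) g a <= V)%VS.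
Proof.
by move=> H; rewrite -big_filter; apply: big_addv_sub => a; rewrite mem_filter => /andP[/H K /K].
Qed.

Lemma sub_big_addv_cond (s : seq hd) (P : pred hd) a : a \in s -> P a ->
  (g a <= \sum_(a <- s | P a) g a)%VS.
Proof.
move=> a_s Pa; have m : a \in filter P s by rewrite mem_filter Pa.
by rewrite -big_filter; exact: (sub_big_addv g m).
Qed.

Lemma gST_E : A = (\sum_(a <- [seq a <- Ws | asb (inA a)]) g a)%VS.
Proof.
have sub a : inA a -> (g a <= \sum_(a <- [seq a <- Ws | asb (inA a)]) g a)%VS.
  move=> Aa; have m : a \in [seq a <- Ws | asb (inA a)].
    by rewrite mem_filter inA_Ws // andbT; apply/asbP.
  exact: (sub_big_addv g m).
apply/eqP; rewrite eqEsubv /A /gST !subv_add; apply/andP; split.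
  apply/andP; split; first apply/andP; first split.
  - by apply: (@subv_trans _ _ (g (0 : hd))); [rewrite rootsp0 subvv | apply/sub/Or31].
  - by apply: big_addv_cond_sub => a _ /asbP Sa; apply/sub/Or32.
  by apply: big_addv_cond_sub => a _ /asbP/RSneg_pos Ta; apply/sub/Or33.
apply: big_addv_sub => a; rewrite mem_filter => /andP[/asbP Aa _].
case: Aa => [->|Sa|Ta].
- by rewrite rootsp0; apply: subv_trans (addvSl _ _) (addvSl _ _).
- apply: subv_trans _ (addvSl _ _); apply: subv_trans _ (addvSr _ _).
  by apply: sub_big_addv_cond; [rewrite Rs_roots Sa.1 | apply/asbP].
apply: subv_trans _ (addvSr _ _); apply: sub_big_addv_cond.
  by rewrite Rs_roots -[a]opprK; exact: rootN Ta.1.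
by apply/asbP/RSneg_pos.
Qed.

Lemma g_gST a : inA a -> (g a <= A)%VS.
Proof.
move=> Aa; have m : a \in [seq a <- Ws | asb (inA a)].
  by rewrite mem_filter inA_Ws // andbT; apply/asbP.
by rewrite gST_E; exact: (sub_big_addv g m).
Qed.

(** In the mixed case the sign of a + b decides: if it is positive, a = (a + b) + (-b) is a sum of
    two nonnegative combinations, so the support of a + b is in [S]; likewise for [T]. *)
Lemma inA_D a b : inA a -> inA b -> a + b \in Ws -> inA (a + b).
Proof.
have mixed a' b' : in_RSpos br Pi S a' -> in_RSpos br Pi T (- b') -> a' + b' \in Ws -> inA (a' + b').
  move=> Sa Tb abW; have [->|nz] := eqVneq (a' + b') 0; first exact: Or31.
  have r : is_root br (a' + b') by rewrite rootE nz.
  case: (root_sign r) => H.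
    apply: Or32; split=> //; apply: (inNS_face _ H Tb.2).
    by rewrite addrK; exact: Sa.2.
  apply: Or33; split; first exact: rootN.
  apply: (inNS_face _ H Sa.2); rewrite opprD addrAC addNr add0r; exact: Tb.2.
case=> [->|Sa|Ta]; case=> [->|Sb|Tb] abW; rewrite ?add0r ?addr0 //.
- exact: Or31.
- exact: Or32.
- exact: Or33.
- exact: Or32.
- by apply: Or32; exact: RSpos_D.
- exact: mixed.
- exact: Or33.
- by rewrite addrC; apply: mixed; rewrite // addrC.
by apply: Or33; rewrite opprD; apply: RSpos_D => //; rewrite -opprD WsN.
Qed.

Lemma gST_br x y : x \in A -> y \in A -> br x y \in A.
Proof.
rewrite {1 2}gST_E => xA yA; move: x xA.
apply: (mem_big_addv_ind (P := fun x => br x y \in A)) => [|u v Hu Hv|a x].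
- by rewrite br0x mem0v.
- by rewrite br_Dl memvD.
rewrite mem_filter => /andP[/asbP Aa _] xa; move: y yA.
apply: (mem_big_addv_ind (P := fun y => br x y \in A)) => [|u v Hu Hv|b y].
- by rewrite brx0 mem0v.
- by rewrite br_Dr memvD.
rewrite mem_filter => /andP[/asbP Ab _] yb; have xy := rootsp_br xa yb.
have [->|nz] := eqVneq (br x y) 0; first by rewrite mem0v.
exact: (subvP (g_gST (inA_D Aa Ab (rootsp_out xy nz)))).
Qed.

Let V0 := (\sum_(a <- nonhigh) g a)%VS.
Let E' := (\sum_(e <- cascS) g e + \sum_(e <- cascT) g (- e))%VS.
Let B := (h + V0)%VS.

Lemma V0P v : v \in V0 -> exists c : hd -> F, v = \sum_(a <- nonhigh) c a *: root_vec a.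
Proof.
apply: (mem_big_addv_ind (P := fun v => exists c : hd -> F, v = \sum_(a <- nonhigh) c a *: root_vec a)).
- by exists (fun=> 0); rewrite big1 // => a _; rewrite scale0r.
- move=> x y [c ->] [d ->]; exists (fun a => c a + d a).
  by rewrite -big_split; apply: eq_bigr => a _; rewrite scalerDl.
move=> a x aQ xa; have ra := nonhigh_root (mem_nonhigh aQ).
have [k ->] := rootsp_line ra (root_vec_in a) (root_vec_neq0 ra) xa.
exists (fun b => if b == a then k else 0).
rewrite (bigD1_seq a) ?filter_uniq //= eqxx big1 ?addr0 // => b /negPf->.
by rewrite scale0r.
Qed.

Lemma inA_nonhigh a : is_nonhigh a -> inA a.
Proof. by case=> -[H _]; [exact: Or32 | exact: Or33]. Qed.

Lemma h_sub : (h <= A)%VS.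
Proof. by rewrite -rootsp0; apply: g_gST; exact: Or31. Qed.

Lemma A_sub : (A <= E' + B)%VS.
Proof.
rewrite {1}gST_E; apply: big_addv_sub => a; rewrite mem_filter => /andP[/asbP Aa aW].
have VB : is_nonhigh a -> (g a <= E' + B)%VS.
  move=> Va; apply: subv_trans _ (addvSr _ _); apply: subv_trans _ (addvSr _ _).
  by apply: (sub_big_addv g); exact: nonhigh_mem.
case: Aa => [->|Sa|Ta].
- by rewrite rootsp0; apply: subv_trans _ (addvSr _ _); exact: addvSl.
- have [aE|aE] := boolP (is_cascade S a); last by apply: VB; left.
  apply: subv_trans _ (addvSl _ _); apply: subv_trans _ (addvSl _ _).
  by apply: (sub_big_addv g); rewrite mem_cascS.
have [aE|aE] := boolP (is_cascade T (- a)); last by apply: VB; right.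
apply: subv_trans _ (addvSl _ _); apply: subv_trans _ (addvSr _ _).
have {1}-> : g a = (fun e => g (- e)) (- a) by rewrite opprK.
by apply: (sub_big_addv (fun e => g (- e))); rewrite mem_cascT.
Qed.

Lemma dim_E' : (\dim E' <= #|Kset br Pi S| + #|Kset br Pi T|)%N.
Proof.
have b s (f : hd -> hd) : (forall e, e \in s -> is_root br (f e)) ->
    (\dim (\sum_(e <- s) g (f e))%VS <= size s)%N.
  elim: s => [|e s IH] Hs; first by rewrite big_nil dimv0.
  rewrite big_cons /= -add1n; apply: leq_trans (dimv_add_leqif _ _) _.
  rewrite leq_add ?IH // => [|e' e's]; last by apply: Hs; rewrite inE e's orbT.
  have r := Hs e (mem_head _ _).
  by rewrite rootsp_gwspace dim_gwspace ?root_Ws ?root_neq0.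
apply: leq_trans (dimv_add_leqif _ _) _; apply: leq_add.
  apply: leq_trans (b cascS id _) _ => [e /root_cascS[]//|].
  by apply: leq_trans (size_undup _) _; rewrite size_map -cardE.
apply: leq_trans (b cascT -%R _) _ => [e /root_cascT[r _]|]; first exact: rootN.
by apply: leq_trans (size_undup _) _; rewrite size_map -cardE.
Qed.

(** * Dimension count for the stabiliser *)

Section Bound.
Variable t : F.
Hypothesis t0 : t != 0.
Hypothesis nondeg : forall c : hd -> F,
  (forall b, b \in nonhigh -> \sum_(a <- nonhigh) c a * kappa (uvec t) (br (root_vec a) (root_vec b)) = 0) ->
  forall a, a \in nonhigh -> c a = 0.
Let phi z := kappa (uvec t) z.

Lemma phi_nonhigh a x : is_nonhigh a -> x \in g a -> phi x = 0.
Proof.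
move=> Va xa; rewrite /phi (kappa_u t xa) mem_cascS mem_cascT.
case: Va => -[Ha aE].
  rewrite (negPf aE) add0r; case: ifP => // /is_cascade_pos H; by case: (RSpos_notneg Ha H).
rewrite (negPf aE) addr0; case: ifP => // /is_cascade_pos H; by case: (RSpos_notneg H Ha).
Qed.

Lemma phi_V0 v : v \in V0 -> phi v = 0.
Proof.
apply: (mem_big_addv_ind (P := fun v => phi v = 0)) => [|x y|a x /mem_nonhigh]; rewrite /phi.
- by rewrite linear0.
- by rewrite linearD /= => -> ->; rewrite addr0.
exact: phi_nonhigh.
Qed.

Lemma phi_cascS e : e \in cascS -> phi (root_vec e) != 0.
Proof.
move=> eE; rewrite /phi (kappa_u t (root_vec_in e)) eE; have [r H] := root_cascS eE.
case: ifP => [/root_cascT N'|_]; first by case: (RSpos_notneg (conj r H) N').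
rewrite addr0 mulf_neq0 ?expf_neq0 //.
have [y ye K] := rootsp_pair (root_vec_in (- e)) (root_vec_neq0 (rootN r)).
rewrite opprK in ye; have [k yE] := rootsp_line r (root_vec_in e) (root_vec_neq0 r) ye.
by apply: contraNneq K => Z; rewrite yE linearZ /= Z mulr0.
Qed.

Lemma phi_cascT e : e \in cascT -> phi (root_vec (- e)) != 0.
Proof.
move=> eE; rewrite /phi (kappa_u t (root_vec_in (- e))) opprK eE; have [r H] := root_cascT eE.
case: ifP => [/root_cascS N'|_]; first by case: (RSpos_notneg (conj r H) N').
rewrite add0r mulf_neq0 ?expf_neq0 //.
have [y ye K] := rootsp_pair (root_vec_in e) (root_vec_neq0 r).
have [k yE] := rootsp_line (rootN r) (root_vec_in (- e)) (root_vec_neq0 (rootN r)) ye.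
by apply: contraNneq K => Z; rewrite yE linearZ /= Z mulr0.
Qed.

Lemma phi_h_br H x a : H \in h -> x \in g a -> phi (br H x) = ev a H * phi x.
Proof. by move=> hH /mem_rootsp Hx; rewrite Hx // /phi linearZ. Qed.

Let Nh := vspace_of (fun H => H \in h /\ forall a, a \in Esp br Pi S T -> ev a H = 0).

Lemma NhP H : H \in Nh <-> H \in h /\ forall a, a \in Esp br Pi S T -> ev a H = 0.
Proof.
apply: vspace_ofP => [|k x y [xh Hx] [yh Hy]]; first by split; [exact: mem0v | move=> *; rewrite linear0].
split=> [|a aE]; first by rewrite memvD ?memvZ.
by rewrite linearP /= Hx // Hy // mulr0 addr0.
Qed.

(** Evaluation on a complement of E in the dual of h is injective on [Nh], because weights separate
    h. *)
Lemma dim_Nh : (\dim Nh + \dim (Esp br Pi S T) <= \dim h)%N.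
Proof.
set Es := Esp br Pi S T; pose C := (Es^C)%VS.
have dC : (\dim C + \dim Es = \dim h)%N.
  rewrite dimv_compl subnK ?dimvS ?subvf //.
  by rewrite dimvf -[RHS]muln1.
rewrite -dC leq_add2r.
pose f x : 'rV[F]_(\dim C) := \row_j ev (vbasis C)`_j x.
have flin : linear f by move=> k x y; apply/rowP => j; rewrite !mxE linearP.
have K0 : (Nh :&: lker (linfun f) = 0)%VS.
  apply/eqP; rewrite -subv0; apply/subvP => x; rewrite memv_cap memv_ker (linfunE flin) memv0.
  case/andP=> /NhP[xh Hx] /eqP fx; apply/eqP; apply: sep => // a _.
  have /memv_addP[b bE [c cC ->]] : a \in (Es + C)%VS by rewrite addv_complf memvf.
  rewrite evD Hx // add0r (coord_vbasis cC).
  elim/big_rec: _ => [|j y _ E]; first by rewrite ev0.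
  have := congr1 (fun w : 'rV_(\dim C) => w 0 j) fx; rewrite !mxE => E2.
  by rewrite evD evZ E2 mulr0 add0r.
have := limg_dim_eq K0 => <-.
apply: leq_trans (dimvS (subvf _)) _; rewrite dimvf.
by rewrite -[X in (_ <= X)%N]mul1n.
Qed.

(** Sends a root vector X_a to phi(X_a) a. On [E'] its image contains E, and its kernel is the first
    summand of the count. *)
Let theta x : hd := linfun (fun H : subvs_of h => phi (br (vsval H) x) : F^o).

Lemma thetaE x H : H \in h -> ev (theta x) H = phi (br H x).
Proof.
move=> hH; rewrite /ev /theta linfunE ?vsprojK // => k y z.
by rewrite linearP /= brl /phi linearP.
Qed.

Lemma theta_linear : linear theta.
Proof.
move=> k x y; apply: ev_inj => H hH.
by rewrite evD evZ !thetaE // brr /phi linearP.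
Qed.

Lemma theta_root e : is_root br e -> phi (root_vec e) != 0 -> root_vec e \in E' ->
  e \in (linfun theta @: E')%VS.
Proof.
move=> r nz eE; have -> : e = (phi (root_vec e))^-1 *: linfun theta (root_vec e).
  rewrite (linfunE theta_linear); apply: ev_inj => H hH.
  by rewrite evZ thetaE // (phi_h_br hH (root_vec_in e)) mulrC mulfK.
by rewrite memvZ // memv_img.
Qed.

Lemma Esp_sub : (Esp br Pi S T <= linfun theta @: E')%VS.
Proof.
apply/span_subvP => b /mapP[K]; rewrite mem_enum inE => KST ->; case/orP: KST => [KS|KT].
  have eE : hi K \in cascS by rewrite mem_cascS; apply/is_cascadeP; exists K.
  apply: theta_root (root_cascS eE).1 (phi_cascS eE) _.
  by apply: (subvP (addvSl _ _)); apply: (subvP (sub_big_addv g eE)); exact: root_vec_in.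
have eE : hi K \in cascT by rewrite mem_cascT; apply/is_cascadeP; exists K.
rewrite -[hi K]opprK memvN; apply: theta_root (rootN (root_cascT eE).1) (phi_cascT eE) _.
apply: (subvP (addvSr _ _)); apply: (subvP (sub_big_addv (fun e => g (- e)) eE)); exact: root_vec_in.
Qed.

Let Z := (E' :&: lker (linfun theta))%VS.

Lemma dim_Z : (\dim Z + \dim (Esp br Pi S T) <= #|Kset br Pi S| + #|Kset br Pi T|)%N.
Proof.
apply: leq_trans dim_E'; rewrite -(limg_ker_dim (linfun theta) E') leq_add2l.
exact: dimvS Esp_sub.
Qed.

Variable W : {vspace L}.
Hypothesis WA : (W <= A)%VS.
Hypothesis Wst : forall x y, x \in W -> y \in A -> phi (br x y) = 0.

(** Tested against non-cascade root vectors, H + v loses its H-part since phi vanishes on them, so v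
    = 0 by nondegeneracy; testing H against cascade vectors gives e_K(H) = 0. *)
Lemma W_cap_B : (W :&: B <= Nh)%VS.
Proof.
apply/subvP => x; rewrite memv_cap => /andP[xW /memv_addP[H hH [v vV xE]]].
have [c vE] := V0P vV.
have c0 a : a \in nonhigh -> c a = 0.
  apply: nondeg => b bQ; have Vb := mem_nonhigh bQ.
  have bA : root_vec b \in A := subvP (g_gST (inA_nonhigh Vb)) _ (root_vec_in b).
  have := Wst xW bA; rewrite xE br_Dl /phi linearD /= -/(phi _) (phi_h_br hH (root_vec_in b)).
  rewrite (phi_nonhigh Vb (root_vec_in b)) mulr0 add0r vE -adE linear_sum sum_lfunE linear_sum /= => E0; rewrite -[RHS]E0.
  by apply: eq_bigr => a' _; rewrite linearZ scale_lfunE /= linearZ /= adE.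
have v0 : v = 0 by rewrite vE big_seq big1 // => a /c0 ->; rewrite scale0r.
rewrite v0 addr0 in xE; subst x; apply/NhP; split=> // a aE.
have [m ->] : exists m : 'I_(size [seq hi K | K <- enum (Kset br Pi S :|: Kset br Pi T)]) -> F,
    a = \sum_i m i *: [seq hi K | K <- enum (Kset br Pi S :|: Kset br Pi T)]`_i.
  exists (fun i => coord (in_tuple [seq hi K | K <- enum (Kset br Pi S :|: Kset br Pi T)]) i a).
  exact: (coord_span (X := in_tuple _)).
elim/big_rec: _ => [|i y _ E]; first by rewrite ev0.
rewrite evD E addr0 evZ; set e := _`_i.
have : e \in [seq hi K | K <- enum (Kset br Pi S :|: Kset br Pi T)] by apply: mem_nth.
case/mapP => K; rewrite mem_enum inE => /orP[KS|KT] ->.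
  have eE : hi K \in cascS by rewrite mem_cascS; apply/is_cascadeP; exists K.
  have := Wst xW (subvP (g_gST (Or32 _ _ (root_cascS eE))) _ (root_vec_in _)).
  rewrite (phi_h_br hH (root_vec_in _)) => /eqP; rewrite mulf_eq0 (negPf (phi_cascS eE)) orbF => /eqP->.
  by rewrite mulr0.
have eE : hi K \in cascT by rewrite mem_cascT; apply/is_cascadeP; exists K.
have r := root_cascT eE.
have Ae : inA (- hi K) by apply: Or33; rewrite opprK.
have := Wst xW (subvP (g_gST Ae) _ (root_vec_in _)).
rewrite (phi_h_br hH (root_vec_in _)) => /eqP; rewrite mulf_eq0 (negPf (phi_cascT eE)) orbF evN oppr_eq0 => /eqP->.
by rewrite mulr0.
Qed.

(** Testing against h: phi vanishes on [B, h], so the [E']-component of a stabilising element is in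
    the kernel of [theta]. *)
Lemma W_sub_ZB : (W <= Z + B)%VS.
Proof.
apply/subvP => x xW; have /memv_addP[e eE [b bB xE]] := subvP A_sub x (subvP WA x xW).
rewrite xE memv_add // memv_cap eE memv_ker (linfunE theta_linear).
apply/eqP; apply: ev_inj => H hH; rewrite thetaE // ev0.
have := Wst xW (subvP h_sub H hH); rewrite xE br_Dl /phi linearD /= -!/(phi _).
have -> : phi (br b H) = 0.
  move/memv_addP: bB => [H' hH' [v vV ->]]; rewrite br_Dl h_ab // add0r brC /phi linearN /=.
  rewrite -/(phi _) phi_V0 ?oppr0 // -adE; move: v vV; apply: big_addv_img => a v aQ va.
  by rewrite adE (subvP (sub_big_addv g aQ)) // ((mem_rootsp a v).1 va) // memvZ.
by rewrite addr0 brC /phi linearN => /eqP; rewrite oppr_eq0 => /eqP.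
Qed.

Lemma dim_W : (\dim W <= \dim Z + \dim Nh)%N.
Proof.
have E := dimv_sum_cap W B.
have l1 : (\dim (W + B) <= \dim Z + \dim B)%N.
  apply: leq_trans (dimv_add_leqif Z B); apply: dimvS.
  by rewrite subv_add W_sub_ZB addvSr.
have l2 := dimvS W_cap_B.
by move: E l1 l2; lia.
Qed.

End Bound.

Lemma lie_index_bound : (lie_index br A + 2 * \dim (Esp br Pi S T) <=
  \dim h + #|Kset br Pi S| + #|Kset br Pi T|)%N.
Proof.
have [t t0 nondeg] := exists_nondegenerate.
pose f0 (x : subvs_of A) : F^o := kappa (uvec t) (vsval x).
have f0lin : linear f0 by move=> k x y; rewrite /f0 !linearP.
pose f : 'Hom(subvs_of A, F^o) := linfun f0.
(* The stabiliser carried into [L] by the inclusion, which preserves its dimension. *)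
pose W := (linfun vsval @: stabsp br f)%VS.
have dW : \dim W = \dim (stabsp br f).
  apply: limg_dim_eq; apply/eqP; rewrite -subv0; apply/subvP => x.
  rewrite memv_cap memv_ker lfunE /= memv0 => /andP[_ /eqP E].
  by apply/eqP/subvs_inj; rewrite E.
have WA : (W <= A)%VS.
  by apply/subvP => _ /memv_imgP[x _ ->]; rewrite lfunE /= subvsP.
have Wst x y : x \in W -> y \in A -> kappa (uvec t) (br x y) = 0.
  move=> /memv_imgP[z zst ->] yA; rewrite lfunE /= (coord_vbasis yA) -adE linear_sum linear_sum /=.
  rewrite big1 // => j _; rewrite !linearZ /= adE.
  move/subv_bigcapP: zst => /(_ j isT); rewrite -memvE memv_ker linfunE => [/eqP|].
    rewrite (linfunE f0lin) /f0 vsprojK => [->|]; first by rewrite mulr0.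
    by apply: gST_br; [exact: subvsP | rewrite vbasis_mem // mem_nth // size_tuple].
  by move=> k v w; rewrite linearP /= brl !linearP.
have le : (lie_index br A <= \dim W)%N.
  rewrite /lie_index; case: ex_minnP => m _; apply.
  by apply/asbP; exists f.
have lW := dim_W t0 nondeg WA Wst; have lN := dim_Nh; have lZ := dim_Z t0.
by move: le lW lN lZ; lia.
Qed.

End Index.

End Base.

End Semisimple.

End Weights.

(** * Separation of h by functionals, and the final assembly *)

Section FunctionalsOnCartan.
Variables (F : closedFieldType) (L : vectType F) (h : {vspace L}).

Lemma ev_separates H : H \in h -> (forall a : hdual h, ev a H = 0) -> H = 0.
Proof.
move=> hH E; rewrite -(vsprojK hH); set w := vsproj h H.
suff -> : w = 0 by rewrite linear0.
rewrite (coord_vbasis (memvf w)) big1 // => i _.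
pose f (x : subvs_of h) : F^o := coord (vbasis {:subvs_of h}) i x.
have flin : linear f by move=> k x y; rewrite /f linearP.
by have := E (linfun f); rewrite /ev (linfunE flin) /f -/w => ->; rewrite scale0r.
Qed.

Lemma ev_eq0_basis (l : nat) (Pi : l.-tuple (hdual h)) H : basis_of fullv Pi ->
  H \in h -> (forall i : 'I_l, ev Pi`_i H = 0) -> H = 0.
Proof.
move=> Pib hH E; apply: (ev_separates hH) => a.
rewrite (coord_basis Pib (memvf a)); elim/big_rec: _ => [|i b _ Eb]; first by rewrite ev0.
by rewrite evD evZ E mulr0 add0r.
Qed.

End FunctionalsOnCartan.

Theorem theorem3p9
  (F : closedFieldType) (char0 : [pchar F] =i pred0)
  (L : vectType F) (br : L -> L -> L)
  (br_linl : forall (a : F) (x y z : L), br (a *: x + y) z = a *: br x z + br y z)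
  (br_alt : forall x : L, br x x = 0)
  (br_jacobi : forall x y z : L,
      br x (br y z) + br y (br z x) + br z (br x y) = 0)
  (g_ss : semisimple br)
  (h : {vspace L}) (h_cartan : is_cartan br h)
  (Rs : seq (hdual h)) (Rs_roots : forall a, (a \in Rs) = is_root br a)
  (l : nat) (Pi : l.-tuple (hdual h)) (Pi_base : is_base br Pi)
  (S T : {set 'I_l}) :
  ((lie_index br (gST br Pi Rs S T))%:Z
    <= (\dim h)%:Z + (#|Kset br Pi S|)%:Z + (#|Kset br Pi T|)%:Z
       - 2 * (\dim (Esp br Pi S T))%:Z)%R.
Proof.
have brC := brNC char0 br_linl br_alt br_jacobi g_ss.
have brr a x y z : br z (a *: x + y) = a *: br z x + br z y.
  by rewrite ![br z _]brC br_linl opprD scalerN.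
have no_ab := abelian_ideal_eq0 g_ss.
have [h_sub _ h_norm] := h_cartan.
have [Pi_roots Pi_basis _] := Pi_base.
(* On a root vector of a simple root a, [x, y] acts by a(x)a(y) - a(y)a(x) = 0, so a([x, y]) = 0;
   simple roots form a basis of the dual of h. *)
have h_ab x y : x \in h -> y \in h -> br x y = 0.
  move=> xh yh; have xyh := h_sub _ _ xh yh.
  apply: (ev_eq0_basis Pi_basis xyh) => i.
  have /andP[_ nz] := Pi_roots i.
  set a := Pi`_i in nz *; have Hv := (mem_rootsp br_linl brr a (vpick (rootsp br a))).1 (memv_pick _).
  have := Hv _ xyh; have brZ k u v : br u (k *: v) = k *: br u v.
    by have := brr k v 0 u; rewrite !addr0 [br u 0]brC (br0l br_linl) oppr0 addr0.
  have -> : br (br x y) (vpick (rootsp br a)) = 0.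
    have := br_jacobi x y (vpick (rootsp br a)).
    rewrite [br _ (br x y)]brC [br (vpick _) x]brC (Hv x xh) (Hv y yh).
    rewrite -scaleNr !brZ (Hv x xh) (Hv y yh) !scalerA mulNr [_ * ev a x]mulrC.
    by rewrite scaleNr addrN add0r => /eqP; rewrite oppr_eq0 => /eqP.
  by move/esym/eqP; rewrite scaler_eq0 vpick0 (negPf nz) orbF => /eqP.
(* The weight 0 joins the roots, so that h counts among the weight spaces. *)
pose Ws := undup (0 :: Rs).
have WsE a : (a \in Ws) = (a == 0) || (rootsp br a != 0%VS).
  by rewrite mem_undup inE Rs_roots /is_root; case: eqP.
have sep H : H \in h -> (forall a, a \in Ws -> ev a H = 0) -> H = 0.
  move=> hH E; apply: (ev_eq0_basis Pi_basis hH) => i; apply: E.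
  by rewrite mem_undup inE Rs_roots Pi_roots orbT.
have := lie_index_bound br_linl brr br_alt br_jacobi h_ab char0 no_ab h_norm
  (undup_uniq _) WsE sep Pi_base S T Rs_roots.
by lia.
Qed.
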